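(* Let $\ell$ be an NMC intensity and let $P_\ell$ be the law of the NMC process with intensity $\ell$ and initial law $\mu$, with expectation $E_\ell$; the initial law $\mu\in\mathcal{P}(\mathbb{Z})$ is not made precise since it does not play any role. Then $P_\ell$ satisfies the following duality formulas: for all $\Phi\in\mathcal{S}$ and all $u\in\mathcal{U}$, $$E_\ell(\mathcal{D}_u\Phi)=E_\ell\Big(\Phi\int_{[0,1]}\frac{\partial_t(\ell u)}{\ell}(t,X_{t^-})\,\big[dX_t-\ell(t,X_{t^-})\,dt\big]\Big)$$ and $$E_\ell(\mathcal{D}_u\Phi)=E_\ell\Big(\Phi\int_{[0,1]}\big[\dot u(t)+\Xi_\ell(t,X_{t^-})u(t)\big]\,dX_t\Big).$$
   Context: Path space: $\Omega$ is the set of all càdlàg step functions $\omega:[0,1]\to\mathbb{Z}$ with initial value in $\mathbb{Z}$ and finitely many jumps, all of amplitude $+1$, occurring at instants $0<t_1<\cdots<t_n<1$ (where $n=\omega_1-\omega_0$). Set $t_i=1$ for $i>n$ and $T_i(\omega):=t_i$ for all $i\ge1$. $X=(X_t)_{0\le t\le 1}$ is the canonical process; $\mathcal{P}(\Omega)$ and $\mathcal{P}(\mathbb{Z})$ are the sets of probability measures on $\Omega$ and $\mathbb{Z}$. Integrals against $X$ are $\int_{[0,1]}f(t,X_{t^-})\,dX_t=\sum_{i:T_i<1}f(T_i,X_{T_i^-})$. NMC (nice Markov counting) intensity: a function $\ell:[0,1]\times\mathbb{Z}\to(0,\infty)$, bounded above by some constant, with $t\mapsto\ell(t,z)$ in $\mathcal{C}^1([0,1])$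 for each $z\in\mathbb{Z}$. The NMC process with intensity $\ell$ and initial law $\mu$ is the counting process whose law $P_\ell=P_\ell^\mu\in\mathcal{P}(\Omega)$ is such that $X_0$ has law $\mu$ and $X_t-X_0-\int_0^t\ell(s,X_{s^-})\,ds$ is a local martingale. Here $\frac{\partial_t(\ell u)}{\ell}(t,z)=\dot u(t)+u(t)\,\partial_t\log\ell(t,z)$. Reciprocal invariant: $\Xi_\ell(t,z):=\partial_t\log\ell(t,z)+\ell(t,z+1)-\ell(t,z)$. Perturbation functions: $\mathcal{U}$ is the set of $\mathcal{C}^1$ functions $u:[0,1]\to\mathbb{R}$ with $u(0)=u(1)=0$; $\dot u$ is the derivative of $u$. Derivative: for $u\in\mathcal{U}$ and small $\varepsilon>0$, $\theta^\varepsilon_u(t):=t+\varepsilon u(t)$ is a change of time of $[0,1]$, and $\Theta^\varepsilon_u(\omega):=\omega\circ\theta^\varepsilon_u$. For measurable $\Phi:\Omega\to\mathbb{R}$, $\mathcal{D}_u\Phi:=\lim_{\varepsilon\to0}\frac1\varepsilon(\Phi\circ\Theta^\varepsilon_u-\Phi)$, provided this limit exists. Simple functions: $\mathcal{S}$ is the set of $\Phi:\Omega\to\mathbb{R}$ for which there is $m\ge1$ such that $\Phi=\varphi(X_0;T_1,\dots,T_m)$ for some $\varphi:\mathbb{Z}\times[0,1]^m\to\mathbb{R}$ with $\varphi(x;\cdot)$ being $\mathcal{C}^\infty$ for every $x\in\mathbb{Z}$. Such $\Phi$ is differentiable in the direction of any $u\in\mathcal{U}$, with $\mathcal{D}_u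\Phi=-\sum_{j=1}^m\partial_{t_j}\varphi(X_0;T_1,\dots,T_m)\,u(T_j)$.
   Formalization: Each duality formula is stated for those Φ and u for which the expectations on both of its sides exist in [-∞,+∞]; since μ and the growth of φ(x;·) in x and of ∂_tℓ(·,z) in z are unrestricted, these expectations can otherwise be undefined. *)

(* Defs.v *)
From HB Require Import structures.
From mathcomp Require Import all_boot all_order all_algebra.
From mathcomp Require Import all_classical all_reals all_analysis.

Set Implicit Arguments.
Unset Strict Implicit.
Unset Printing Implicit Defensive.

Import Order.TTheory GRing.Theory Num.Theory.
Import numFieldNormedType.Exports.

Local Open Scope classical_set_scope.
Local Open Scope ring_scope.

(* Functions on [0, 1] are total functions on R whose values outside [0, 1] are
   irrelevant: derivatives and continuity are taken within [0, 1] (hence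
   one-sided at 0 and 1). *)

Definition diffquot01 (R : realType) (f : R -> R) (t s : R) : R :=
  (s - t)^-1 * (f s - f t).

Definition deriv01 (R : realType) (f : R -> R) (t : R) : R :=
  lim (diffquot01 f t s @[s --> within `[0, 1] t^']).

Definition derivable01 (R : realType) (f : R -> R) (t : R) : Prop :=
  cvg (diffquot01 f t s @[s --> within `[0, 1] t^']).

Definition C1_01 (R : realType) (f : R -> R) : Prop :=
  (forall t : R, 0 <= t <= 1 -> derivable01 f t) /\
  {within `[0, 1], continuous (deriv01 f)}.

Definition cube (R : realType) (m : nat) : set 'rV[R]_m :=
  [set t | forall j, 0 <= t 0 j <= 1].

Definition slice (R : realType) (m : nat) (f : 'rV[R]_m -> R) (j : 'I_m)
    (t : 'rV[R]_m) (s : R) : R :=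
  f (\row_k (if k == j then s else t 0 k)).

Definition partial01 (R : realType) (m : nat) (f : 'rV[R]_m -> R) (j : 'I_m)
    (t : 'rV[R]_m) : R :=
  deriv01 (slice f j t) (t 0 j).

Fixpoint Ck_cube (R : realType) (m : nat) (k : nat) (f : 'rV[R]_m -> R) : Prop :=
  {within @cube R m, continuous f} /\
  if k is k'.+1 then
    forall j : 'I_m, (forall t, cube t -> derivable01 (slice f j t) (t 0 j)) /\
                     Ck_cube k' (partial01 f j)
  else True.

Definition smooth_cube (R : realType) (m : nat) (f : 'rV[R]_m -> R) : Prop :=
  forall k, Ck_cube k f.

(* A path is extended from [0, 1] to R by the constants w 0 on the left and w 1
   on the right; this makes the representing function unique.  The list s is
   t_1 < ... < t_n. *)
Definition is_counting_path (R : realType) (w : R -> int) : Prop :=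
  exists s : seq R,
    [/\ sorted <%R s, (forall r, r \in s -> 0 < r < 1) &
        forall t : R, w t = w 0 + (count (fun r => r <= t) s)%:Z].

Record Omega (R : realType) := CountingPath {
  path_fun :> R -> int;
  path_funP : is_counting_path path_fun }.

Lemma cst_counting_path (R : realType) : is_counting_path (fun _ : R => 0 : int).
Proof. by exists [::]; split=> // t; rewrite addr0. Qed.

HB.instance Definition _ (R : realType) := gen_eqMixin (Omega R).
HB.instance Definition _ (R : realType) := gen_choiceMixin (Omega R).
HB.instance Definition _ (R : realType) :=
  isPointed.Build (Omega R) (CountingPath (cst_counting_path R)).

Definition cylinders (R : realType) (t : R) : set_system (Omega R) :=
  [set A | exists (s : R) (z : int), 0 <= s <= t /\ A = [set w : Omega R | w s = z :> int]].

Definition filtr (R : realType) (t : R) : set_system (Omega R) :=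
  <<s @cylinders R t >>.

HB.instance Definition _ (R : realType) :=
  @isMeasurable.Build (sigma_display (@cylinders R 1)) (Omega R)
    (filtr 1) (@sigma_algebra0 _ setT (@cylinders R 1))
    (@sigma_algebraC _ (@cylinders R 1))
    (@sigma_algebra_bigcup _ setT (@cylinders R 1)).

HB.instance Definition _ := isPointed.Build int 0.
HB.instance Definition _ := @isMeasurable.Build default_measure_display
  int discrete_measurable discrete_measurable0
  discrete_measurableC discrete_measurableU.

(* The instants t_1 < ... < t_n at which w jumps. *)
Definition jumps (R : realType) (w : Omega R) : seq R := sval (cid (path_funP w)).

(* T_i, for i >= 1 *)
Definition jump_time (R : realType) (i : nat) (w : Omega R) : R :=
  nth 1 (jumps w) i.-1.

(* X_{t^-}; the convention X_{0^-} = X_0 comes from the extension of paths to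
   negative times *)
Definition left_lim (R : realType) (w : Omega R) (t : R) : int :=
  xget 0 [set z : int | \forall s \near t^'-, w s = z].

(* The integral over [0, 1] of f(t, X_{t^-}) against dX_t. *)
Definition int_dX (R : realType) (f : R -> int -> R) (w : Omega R) : R :=
  \sum_(t <- jumps w) f t (left_lim w t).

(* The integral over [0, 1] of f(t, X_{t^-}) against dX_t - l(t, X_{t^-}) dt. *)
Definition int_compensated (R : realType) (l f : R -> int -> R) (w : Omega R) : R :=
  int_dX f w -
  \int[lebesgue_measure]_(t in `[0, 1]) (f t (left_lim w t) * l t (left_lim w t)).

Definition NMC_intensity (R : realType) (l : R -> int -> R) : Prop :=
  [/\ forall (t : R) z, 0 <= t <= 1 -> 0 < l t z,
      exists C, forall (t : R) z, 0 <= t <= 1 -> l t z <= C &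
      forall z, C1_01 (l ^~ z)].

Definition stopping_time (R : realType) (tau : Omega R -> R) : Prop :=
  (forall w, 0 <= tau w) /\
  forall t : R, 0 <= t <= 1 -> filtr t [set w | tau w <= t].

(* Martingale on the time interval [0, 1] in the canonical filtration; the
   conditional expectation given F_s is spelled out by integration over the
   events of F_s. *)
Definition martingale (R : realType) (P : probability (Omega R) R)
    (M : R -> Omega R -> R) : Prop :=
  [/\ forall t : R, 0 <= t <= 1 ->
        forall B : set R, measurable B -> filtr t (M t @^-1` B),
      forall t : R, 0 <= t <= 1 -> P.-integrable setT (EFin \o M t) &
      forall s t : R, 0 <= s -> s <= t -> t <= 1 -> forall A, filtr s A ->
        (\int[P]_(w in A) (M t w)%:E = \int[P]_(w in A) (M s w)%:E)%E].

(* Since the time interval is [0, 1], localizing stopping times are required to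
   be eventually at least 1. *)
Definition local_martingale (R : realType) (P : probability (Omega R) R)
    (M : R -> Omega R -> R) : Prop :=
  exists tau : nat -> Omega R -> R,
    [/\ forall n, stopping_time (tau n),
        {ae P, forall w, {homo tau ^~ w : n p / (n <= p)%N >-> n <= p} /\
                         \forall n \near \oo, 1 <= tau n w} &
        forall n, martingale P (fun t w => M (Order.min t (tau n w)) w)].

(* X_t - X_0 minus its compensator *)
Definition compensated (R : realType) (l : R -> int -> R) (t : R) (w : Omega R) : R :=
  (w t - w 0)%:~R - \int[lebesgue_measure]_(s in `[0, t]) l s (left_lim w s).

(* P is the law of the NMC process with intensity l and initial law mu. *)
Definition NMC_law (R : realType) (l : R -> int -> R) (mu : probability int R)
    (P : probability (Omega R) R) : Prop :=
  (forall A : set int, P [set w | A (w 0)] = mu A) /\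
  local_martingale P (compensated l).

(* The function (t, z) |-> d_t (l u) / l. *)
Definition dlog_weighted (R : realType) (l : R -> int -> R) (u : R -> R)
    (t : R) (z : int) : R :=
  deriv01 (fun s => l s z * u s) t / l t z.

Definition reciprocal_invariant (R : realType) (l : R -> int -> R)
    (t : R) (z : int) : R :=
  deriv01 (fun s => ln (l s z)) t + l t (z + 1) - l t z.

Definition perturbation (R : realType) (u : R -> R) : Prop :=
  [/\ C1_01 u, u 0 = 0 & u 1 = 0].

Definition time_change (R : realType) (u : R -> R) (e t : R) : R := t + e * u t.

(* The path w \o time_change u e; for e so large that this composition is not in
   Omega, the (irrelevant) default value is w. *)
Definition Theta (R : realType) (u : R -> R) (e : R) (w : Omega R) : Omega R :=
  xget w [set w' | forall t : R, 0 <= t <= 1 -> w' t = w (time_change u e t)].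

Definition deriv_dir (R : realType) (u : R -> R) (Phi : Omega R -> R)
    (w : Omega R) : R :=
  lim (e^-1 * (Phi (Theta u e w) - Phi w) @[e --> 0^'+]).

Definition simple_functional (R : realType) (Phi : Omega R -> R) : Prop :=
  exists (m : nat) (phi : int -> 'rV[R]_m -> R),
    [/\ (1 <= m)%N, forall x, smooth_cube (phi x) &
        forall w, Phi w = phi (w 0) (\row_(j < m) jump_time j.+1 w)].

(* The expectation of Y makes sense in [-oo, +oo], i.e. it is not of the form
   (+oo) - (+oo).  Neither mu nor the growth in z of the derivative of l (., z)
   nor that in x of phi (x; .) is restricted, so the random variables of the
   duality formulas need not be integrable. *)
Definition has_expectation (R : realType) (P : probability (Omega R) R)
    (Y : Omega R -> R) : Prop :=
  (\int[P]_w (Order.max (Y w) 0)%:E < +oo)%E \/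
  (\int[P]_w (Order.max (- Y w) 0)%:E < +oo)%E.

(* Main.v *)
Require Import Defs.
From HB Require Import structures.
From mathcomp Require Import all_boot all_order all_algebra.
From mathcomp Require Import all_classical all_reals all_analysis measurable_realfun.
From mathcomp Require Import ring lra.

Set Implicit Arguments.
Unset Strict Implicit.
Unset Printing Implicit Defensive.

Import Order.TTheory GRing.Theory Num.Theory.
Import numFieldNormedType.Exports.

Local Open Scope classical_set_scope.
Local Open Scope ring_scope.

(** The right-hand sides of the two formulas are the same random variable. Along
    a path, the function l u moves by its time derivative between the jumps and by
    an increment at each jump, and u vanishes at 0 and 1; so the integral of
    d_t (l u) along the path is minus the sum of the increments, and the
    compensated integral becomes the integral of u' + Xi u against dX
    ([int_compensatedE]).

    The second formula is the derivative at e = 0 of a change of variables. The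
    time change moves every jump time T to theta_e^-1 T. On the event that the
    path starts at x and jumps n times, the law of the moved jump times has an
    explicit density with respect to the law of the jump times: a product over the
    jumps, in which the jump from z to z + 1 at time t contributes the factor
      theta_e'(t) l(theta_e t, z) / l(t, z)
    times an exponential of the integrals of l(., z) and l(., z + 1) between
    theta_e t and t ([time_changed_law]). The derivative of this product at e = 0
    is the integral of u' + Xi u against dX ([density_quotient]).

    The density comes out of the martingale property alone. Since the rate is
    bounded, the number of jumps is integrable, and the local martingale is a
    martingale ([compensated_martingale]); so the jumps and the rate define the same
    measure on the predictable sigma-algebra ([jump_measureE]), and the jump sum of
    a bounded predictable process has the same mean as its integral against the rate
    ([compensation]). Consequently the mean of a product of functions g_k of the
    successive jump times, on the paths from x with n jumps, is the probability of
    the start x times v_0(0), where v solves the linear backward equations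
      v_k' = l(., x + k) (v_k - g_k v_(k+1)), v_k(1) = 1 if k = n, 0 otherwise
    ([stratum_law]). A change of time maps solutions of these equations to solutions
    for the functions g_k o theta times the density ([quasi_invariance]). Products
    are enough, because Lipschitz functions on the cube are uniform limits of
    combinations of products of tent functions ([tensor_extension]).

    The derivative can be taken under the expectation on each of these events,
    because everything there is bounded ([stratum_duality]). The events form a
    countable partition, and a random variable whose expectation makes sense is
    summed over a countable partition ([quasi_integral_cvg]), which gives the formula
    for the whole space. *)

(** * Counting paths and their jump times *)

Section paths.
Variable R : realType.
Implicit Types (w : Omega R) (s : seq R) (t : R) (k : nat).

Lemma jumpsP w : [/\ sorted <%R (jumps w), forall r, r \in jumps w -> 0 < r < 1 &
  forall t, w t = w 0 + (count (fun r => r <= t) (jumps w))%:Z].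
Proof. by rewrite /jumps; case: cid. Qed.

(** A downward closed predicate holds on an initial segment of a sorted sequence,
    whose length is the number of entries that satisfy it. *)
Lemma count_sorted (p : pred R) s d k :
    (forall x y, x <= y -> p y -> p x) -> sorted <%R s -> (k < size s)%N ->
  p (nth d s k) = (k < count p s)%N.
Proof.
move=> pdown; elim: s k => // a s IH k /= pas.
have sas : sorted <%R s by exact: path_sorted pas.
have las : all (fun x => a < x) s by apply: order_path_min pas; exact: lt_trans.
have pa : ~~ p a -> count p s = 0%N.
  move=> npa; apply/eqP; rewrite -leqn0 leqNgt -has_count; apply/hasPn => x xs.
  by apply: contra npa; apply/pdown/ltW/(allP las).
case: k => [|k] ks /=.
  by case: (boolP (p a)) => [//|/pa ->].
case: (boolP (p a)) => [_|npa]; first by rewrite IH// add1n.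
rewrite pa//; apply/negbTE; apply: contra npa; apply: pdown.
by apply/ltW/(allP las)/mem_nth.
Qed.

Lemma left_limE w t :
  left_lim w t = w 0 + (count (fun r => r < t) (jumps w))%:Z.
Proof.
have [_ _ wE] := jumpsP w.
have H : \forall s \near t^'-, w s = w 0 + (count (fun r => r < t) (jumps w))%:Z.
  have : \forall s \near t^'-, count (fun r => r <= s) (jumps w) =
                               count (fun r => r < t) (jumps w).
    elim: (jumps w) => [|a s IH /=]; first by near=> x.
    have [ta|ta] := leP t a; near=> x; congr addn; try by near: x.
      congr nat_of_bool; apply/negbTE; rewrite -ltNge.
      have : x < t by near: x; apply: nbhs_left_lt.
      by move=> xt; rewrite (lt_le_trans xt ta).
    by congr nat_of_bool; apply/idP; near: x; exact: nbhs_left_ge.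
  by apply: filterS => x xE; rewrite wE xE.
apply: xget_subset1 => //= y z Hy Hz.
near (t^'-) => x.
by rewrite -(near Hy x)// -(near Hz x).
Unshelve. all: by end_near. Qed.

Lemma size_jumps w : w 1 = w 0 + (size (jumps w))%:Z.
Proof.
have [_ w01 ->] := jumpsP w; congr (_ + Posz _).
rewrite -[RHS]count_predT; apply: eq_in_count => r /w01 /andP[_ /ltW].
by [].
Qed.

Lemma jump_timeS k w : jump_time k.+1 w = nth 1 (jumps w) k.
Proof. by []. Qed.

Lemma jump_time_lt1 k w : (jump_time k.+1 w < 1) = (k < size (jumps w))%N.
Proof.
rewrite jump_timeS; have [_ w01 _] := jumpsP w.
have [ks|sk] := ltnP k (size (jumps w)).
  by have /w01/andP[] := mem_nth 1 ks.
by rewrite nth_default// ltxx.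
Qed.

Lemma jump_time_gt0 k w : 0 < jump_time k w.
Proof.
rewrite /jump_time; have [_ w01 _] := jumpsP w.
have [ks|sk] := ltnP k.-1 (size (jumps w)).
  by have /w01/andP[] := mem_nth 1 ks.
by rewrite nth_default// ltr01.
Qed.

Lemma jump_time_le1 k w : jump_time k w <= 1.
Proof.
rewrite /jump_time; have [_ w01 _] := jumpsP w.
have [ks|sk] := ltnP k.-1 (size (jumps w)).
  by have /w01/andP[_ /ltW] := mem_nth 1 ks.
by rewrite nth_default.
Qed.

(** The equivalence fails at t = 1, since the times of the missing jumps are 1. *)
Lemma jump_time_le k w t : t < 1 -> (jump_time k.+1 w <= t) = (w 0 + k%:Z < w t).
Proof.
move=> t1; rewrite jump_timeS; have [sw w01 wE] := jumpsP w.
rewrite (wE t) ltrD2l ltz_nat; have [ks|sk] := ltnP k (size (jumps w)).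
  rewrite -(@count_sorted (fun r => r <= t) _ 1)// => x y xy yt.
  exact: le_trans xy yt.
rewrite nth_default// leNgt t1/=; apply/esym/negbTE; rewrite -leqNgt.
by apply: leq_trans sk; exact: count_size.
Qed.

Lemma jump_time_lt k w t : t <= 1 ->
  (jump_time k.+1 w < t) = (w 0 + k%:Z < left_lim w t).
Proof.
move=> t1; rewrite jump_timeS left_limE; have [sw w01 _] := jumpsP w.
rewrite ltrD2l ltz_nat; have [ks|sk] := ltnP k (size (jumps w)).
  rewrite -(@count_sorted (fun r => r < t) _ 1)// => x y xy yt.
  exact: le_lt_trans xy yt.
rewrite nth_default// ltNge t1/=; apply/esym/negbTE; rewrite -leqNgt.
by apply: leq_trans sk; exact: count_size.
Qed.

Lemma left_lim_jump k w : (k < size (jumps w))%N ->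
  left_lim w (jump_time k.+1 w) = w 0 + k%:Z.
Proof.
move=> kw; rewrite left_limE jump_timeS; have [sw w01 _] := jumpsP w.
congr (_ + Posz _); set t := nth _ _ _.
have tdown x y : x <= y -> y < t -> x < t by exact: le_lt_trans.
apply/eqP; rewrite eqn_leq; apply/andP; split.
  by rewrite leqNgt -(count_sorted 1 tdown)// ltxx.
rewrite {}/t in tdown *; case: k kw tdown => // k kw tdown.
rewrite -(count_sorted 1 tdown) ?(ltnW kw)//.
by apply: (sorted_ltn_nth lt_trans) => //; rewrite inE// ltnW.
Qed.

Lemma jump_time_default k w : (size (jumps w) <= k)%N -> jump_time k.+1 w = 1.
Proof. by move=> ks; rewrite jump_timeS nth_default. Qed.

Lemma left_lim_ge w t : w 0 <= left_lim w t.
Proof. by rewrite left_limE lerDl. Qed.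

Lemma sum_jumpsE w (f : R -> R) :
  \sum_(t <- jumps w) f t = \sum_(k < size (jumps w)) f (jump_time k.+1 w).
Proof. by rewrite (big_nth 1) big_mkord. Qed.

Lemma int_dXE (f : R -> int -> R) w :
  int_dX f w = \sum_(k < size (jumps w)) f (jump_time k.+1 w) (w 0 + k%:Z).
Proof.
by rewrite /int_dX sum_jumpsE; apply: eq_bigr => k _; rewrite left_lim_jump.
Qed.

Lemma path_increment w (s t : R) : s <= t ->
  ((w t - w s)%:~R : R) = \sum_(r <- jumps w) ((s < r <= t)%R)%:R.
Proof.
have [_ _ wE] := jumpsP w => st.
rewrite (wE t) (wE s) opprD addrACA subrr add0r.
elim: (jumps w) => [|a l IH]; first by rewrite big_nil subrr.
rewrite big_cons -IH /= !PoszD opprD addrACA intrD; congr (_ + _).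
have [as_|sa] := leP a s; first by rewrite (le_trans as_ st) subrr.
by rewrite subr0 /=; case: (a <= t).
Qed.

End paths.

(** * Integrals along a path *)

Section pathwise.
Variable R : realType.
Notation mu := (@lebesgue_measure R).

Lemma integrable_setU d (T : measurableType d) (m : {measure set T -> \bar R})
    (A B : set T) (f : T -> \bar R) :
    measurable A -> measurable B -> [disjoint A & B] ->
  m.-integrable A f -> m.-integrable B f -> m.-integrable (A `|` B) f.
Proof.
move=> mA mB AB /integrableP[mfA fA] /integrableP[mfB fB].
have mf : measurable_fun (A `|` B) f by exact/measurable_funU.
apply/integrableP; split => //; rewrite ge0_integral_setU//.
- exact: lte_add_pinfty.
- exact: measurableT_comp.
Qed.

Lemma Rintegral_glue (f f1 f2 : R -> R) (a b c : R) : a <= b -> b <= c ->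
    mu.-integrable `[a, b] (EFin \o f1) -> mu.-integrable `[b, c] (EFin \o f2) ->
    {in `[a, b], f =1 f1} -> {in `]b, c], f =1 f2} ->
  mu.-integrable `[a, c] (EFin \o f) /\
  \int[mu]_(t in `[a, c]) f t =
    \int[mu]_(t in `[a, b]) f1 t + \int[mu]_(t in `[b, c]) f2 t.
Proof.
move=> ab bc i1 i2 ff1 ff2.
have E : `[a, c]%classic = `[a, b]%classic `|` `]b, c]%classic :> set R.
  by rewrite -itv_bndbnd_setU// bnd_simp.
have D : [disjoint `[a, b]%classic & `]b, c]%classic].
  apply/disj_setPS => y [/=]; rewrite 2!in_itv/= => /andP[_ yx] /andP[].
  by rewrite ltNge yx.
have i1' : mu.-integrable `[a, b] (EFin \o f).
  by apply: eq_integrable i1 => // x; rewrite inE => /= xab; rewrite /= ff1.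
have i2' : mu.-integrable `]b, c] (EFin \o f2).
  by apply: integrableS i2 => //; apply: subset_itvr; rewrite bnd_simp.
have i2'' : mu.-integrable `]b, c] (EFin \o f).
  by apply: eq_integrable i2' => // x; rewrite inE => /= xab; rewrite /= ff2.
have ii : mu.-integrable `[a, c] (EFin \o f).
  by rewrite E; exact: integrable_setU.
split => //; rewrite E Rintegral_setU -?E//; congr (_ + _).
  by apply: eq_Rintegral => x; rewrite inE => /= xab; rewrite ff1.
rewrite -(Rintegral_itv_obnd_cbnd i2').
by apply: eq_Rintegral => x; rewrite inE => /= xab; rewrite ff2.
Qed.

Lemma Rintegral_FTC (f F : R -> R) (a b : R) : a <= b ->
    continuous f -> continuous F ->
    (forall t, a < t < b -> is_derive t 1 F (f t)) ->
  \int[mu]_(t in `[a, b]) f t = F b - F a.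
Proof.
rewrite le_eqVlt => /predU1P[<- _ _ _|ab cf cF dF].
  by rewrite set_itv1 Rintegral_set1 subrr.
rewrite /Rintegral (@continuous_FTC2 _ f F a b)//.
- exact: continuous_subspaceT.
- split; [|exact/cvg_at_right_filter/cF|exact/cvg_at_left_filter/cF].
  by move=> x; rewrite in_itv/= => /dF[].
- by move=> x; rewrite in_itv/= => /dF xF; rewrite derive1E derive_val.
Qed.

Lemma integrable_continuous (f : R -> R) (a b : R) : continuous f ->
  mu.-integrable `[a, b] (EFin \o f).
Proof.
move=> cf; apply: continuous_compact_integrable; first exact: segment_compact.
exact: continuous_subspaceT.
Qed.

(** Induction on the jumps: the integral is split at the first jump, and the
    fundamental theorem applies before it; k counts the jumps up to time a. *)
Lemma Rintegral_steps (f V : nat -> R -> R) (s : seq R) (a : R) (k : nat) :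
    path <%R a s -> last a s <= 1 ->
    (forall k, continuous (f k)) -> (forall k, continuous (V k)) ->
    (forall k t, a < t < 1 -> is_derive t 1 (V k) (f k t)) ->
  let F (t : R) := f (k + count (fun r => (r < t)%R) s)%N t in
  mu.-integrable `[a, 1] (EFin \o F) /\
  \int[mu]_(t in `[a, 1]) F t =
    V (k + size s)%N 1 - V k a +
    \sum_(i < size s) (V (k + i)%N (nth 1 s i) - V (k + i).+1 (nth 1 s i)).
Proof.
move=> + + cf cV; elim: s a k => [|b s IH] a k /=.
  move=> _ a1 dV; rewrite big_ord0 addr0 addn0.
  split; first exact: integrable_continuous.
  by apply: Rintegral_FTC => //; exact: dV.
move=> /andP[ab bs] s1 dV.
have las : all (fun x => b < x) s by apply: order_path_min bs; exact: lt_trans.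
have b1 : b <= 1.
  case: (s) las s1 => [//|c s'] /= /andP[bc] /allP la lc.
  rewrite (le_trans _ lc)//.
  have := mem_last c s'; rewrite inE => /predU1P[->|/la/ltW//]; exact: ltW.
have [|i2 E2] := IH b k.+1 bs s1.
  by move=> j t /andP[bt t1]; apply: dV; rewrite t1 (lt_trans ab bt).
have := @Rintegral_glue
  (fun t => f (k + ((b < t)%R + count (fun r => (r < t)%R) s))%N t)
  (f k) _ a b 1 (ltW ab) b1 (@integrable_continuous _ _ _ (cf k)) i2.
case.
- move=> x; rewrite in_itv/= => /andP[ax xb].
  rewrite ltNge xb/= (@eq_in_count _ _ pred0) ?count_pred0 ?addn0//.
  by move=> r /(allP las) br /=; apply/negbTE; rewrite -leNgt (le_trans xb)// ltW.
- by move=> x; rewrite in_itv/= => /andP[-> _]; rewrite add1n addnS addSn.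
move=> iF ->; split => //.
have dVb t : a < t < b -> is_derive t 1 (V k) (f k t).
  by move=> /andP[at_ tb]; apply: dV; rewrite at_ (lt_le_trans tb).
rewrite (Rintegral_FTC (ltW ab) (cf k) (cV k) dVb) E2 big_ord_recl/= addn0 addSn addnS.
under [in RHS]eq_bigr do rewrite /bump/= add1n addnS.
under eq_bigr do rewrite addSn.
by ring.
Qed.

(** The integral collects what V gains between the jumps; the sum corrects for the
    change of index at the jumps. *)
Lemma path_change_of_variables (w : Omega R) (f V : nat -> R -> R) :
    (forall k, continuous (f k)) -> (forall k, continuous (V k)) ->
    (forall k (t : R), 0 < t < 1 -> is_derive t 1 (V k) (f k t)) ->
  let F (t : R) := f (count (fun r => (r < t)%R) (jumps w)) t in
  mu.-integrable `[0, 1] (EFin \o F) /\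
  \int[mu]_(t in `[0, 1]) F t =
    V (size (jumps w)) 1 - V 0%N 0 + \sum_(i < size (jumps w))
      (V i (jump_time i.+1 w) - V i.+1 (jump_time i.+1 w)).
Proof.
move=> cf cV dV; have [sw w01 _] := jumpsP w.
apply: (@Rintegral_steps f V (jumps w) 0 0) => //.
  rewrite path_min_sorted//; apply/allP => r /w01/andP[] //.
have := mem_last 0 (jumps w); rewrite inE => /predU1P[->//|/w01/andP[_ /ltW]].
by [].
Qed.

End pathwise.

(** * Functions on the unit interval *)

Section C1.
Variable R : realType.
Implicit Types (f g : R -> R) (t : R).

Lemma within01_dnbhs t : 0 < t < 1 -> within `[0, 1]%classic t^' = t^'.
Proof.
move=> /andP[t0 t1]; apply/seteqP; split => U.
  move=> /= HU.
  have H : \forall s \near t, s \in `]0, 1[ by apply: near_in_itvoo; rewrite in_itv/= t0.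
  have H' : \forall s \near t^', s \in `]0, 1[ by apply: cvg_within H.
  rewrite /within/= in HU; near=> s; apply: (near HU s) => //.
  by apply: subset_itv_oo_cc; near: s; exact: H'.
by move=> /= HU; apply: filterS HU => ? ? ?.
Unshelve. all: by end_near. Qed.

Lemma diffquot_shift f t (F : set_system R) :
  (diffquot01 f t s @[s --> t^'] --> F) <->
  ((fun h => h^-1 *: ((f \o shift t) (h *: 1) - f t)) h @[h --> 0^'] --> F).
Proof.
have E : t^' = (fun h => h + t) @ 0^'.
  apply/seteqP; split => U; rewrite /= /dnbhs /within /= nbhs_simpl /=.
    move=> /(nbhs0P (fun y : R => y != t -> U y)) H.
    apply: filterS H => h /= + h0; rewrite addrC; apply.
    by rewrite -subr_eq0 addrK.
  move=> H; apply/(nbhs0P (fun y : R => y != t -> U y)).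
  apply: filterS H => h /=; rewrite addrC => + h0; apply.
  by apply: contra h0 => /eqP->; rewrite addr0.
rewrite E; have <- : diffquot01 f t \o (fun h => h + t) =
  (fun h => h^-1 *: ((f \o shift t) (h *: 1) - f t)).
  by apply/funext => h /=; rewrite /diffquot01 addrK [h%:A]mulr1.
by [].
Qed.

Lemma is_derive_diffquot01 f t l : 0 < t < 1 ->
  is_derive t 1 f l <-> (diffquot01 f t s @[s --> within `[0, 1]%classic t^'] --> l).
Proof.
move=> t01; rewrite (within01_dnbhs t01) (diffquot_shift f t (nbhs l)).
split=> [[dv dvl]|H].
  by rewrite -dvl; exact: dv.
by split; [apply/cvg_ex; exists l|exact/cvg_lim].
Qed.

Lemma derivable01_is_derive f t : 0 < t < 1 -> derivable01 f t ->
  is_derive t 1 f (deriv01 f t).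
Proof. move=> t01 df; apply/(is_derive_diffquot01 _ _ t01). exact: df. Qed.

Lemma is_derive_deriv01 f t l : 0 < t < 1 -> is_derive t 1 f l -> deriv01 f t = l.
Proof.
move=> t01 /(is_derive_diffquot01 _ _ t01).
by rewrite /deriv01 within01_dnbhs//; exact: cvg_lim.
Qed.

Lemma derivable01_continuous f t : derivable01 f t ->
  f s @[s --> within `[0, 1]%classic (nbhs t)] --> f t.
Proof.
move=> df.
have H : f s @[s --> within `[0, 1]%classic t^'] --> f t.
  have sub : ((s - t) @[s --> within `[0, 1]%classic t^'] --> (0 : R)).
    apply: cvg_within_filter; apply: cvg_within_filter.
    have H0 : (s - t) @[s --> t] --> t - t by apply: cvgB; [exact: cvg_id|exact: cvg_cst].
    by rewrite subrr in H0; exact: H0.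
  have H1 : (s - t) * diffquot01 f t s + f t @[s --> within `[0, 1]%classic t^']
      --> 0 * deriv01 f t + f t.
    by apply: cvgD; [apply: cvgM; [exact: sub|exact: df]|exact: cvg_cst].
  rewrite mul0r add0r in H1.
  apply: cvg_trans H1; apply: near_eq_cvg.
  rewrite near_withinE near_withinE; apply: nearW => s st _; rewrite /= /diffquot01 mulrA.
  by rewrite divff ?mul1r ?subrK// subr_eq0.
move=> U Uf; have /= := H U Uf.
rewrite /within/= => HU.
have {}HU : \forall s \near t, s != t -> `[0, 1]%classic s -> U (f s) by exact: HU.
suff : \forall s \near t, `[0, 1]%classic s -> U (f s) by [].
near=> s => s01; have [->|st] := eqVneq s t; first by apply: nbhs_singleton; exact: Uf.
by apply: (near HU s) => //.
Unshelve. all: by end_near. Qed.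

(** The projection of the line onto [0, 1], which turns a function on [0, 1]
    into a function on the line with the same regularity. *)
Definition clamp (t : R) : R := Order.max 0 (Order.min t 1).

Lemma clamp_itv t : 0 <= clamp t <= 1.
Proof.
rewrite /clamp le_max lexx/= ge_max ler01/= ge_min lexx orbT//.
Qed.

Lemma clamp_id t : 0 <= t <= 1 -> clamp t = t.
Proof. by move=> /andP[t0 t1]; rewrite /clamp min_l// max_r. Qed.

Lemma clamp_le0 t : t <= 0 -> clamp t = 0.
Proof.
by move=> t0; rewrite /clamp min_l ?max_l// (le_trans t0)//.
Qed.

Lemma clamp_ge1 t : 1 <= t -> clamp t = 1.
Proof. by move=> t1; rewrite /clamp min_r ?max_r. Qed.

Lemma clamp_lipschitz (a b : R) : a <= b -> clamp a <= clamp b <= clamp a + (b - a).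
Proof.
move=> ab; rewrite /clamp; have [a1|a1] := leP a 1; have [b1|b1] := leP b 1.
- by have [a0|a0] := leP a 0; have [b0|b0] := leP b 0; lra.
- by have [a0|a0] := leP a 0; rewrite max_r//; lra.
- lra.
- by lra.
Qed.

Lemma clamp_continuous : continuous clamp.
Proof.
move=> x; apply: (@continuous_max R R (cst 0) (id \min cst 1)).
  exact: cst_continuous.
apply: (@continuous_min R R id (cst 1)); [exact: cvg_id|exact: cst_continuous].
Qed.

Lemma continuous_clamp (g : R -> R) :
  {within `[0, 1], continuous g} -> continuous (g \o clamp).
Proof.
move=> /subspace_continuousP cg t.
have /cg H : `[0, 1]%classic (clamp t) by rewrite /= in_itv/= clamp_itv.
apply: cvg_comp H => U; rewrite /within/= => HU.
have {}HU : \forall s \near t, `[0, 1]%classic (clamp s) -> U (clamp s).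
  exact: clamp_continuous HU.
suff : \forall s \near t, U (clamp s) by [].
by apply: filterS HU => s; apply; rewrite /= in_itv/= clamp_itv.
Qed.

Lemma C1_01_continuous (f : R -> R) : C1_01 f -> continuous (f \o clamp).
Proof.
move=> [df _]; apply/continuous_clamp/subspace_continuousP => t.
by rewrite /= in_itv/= => /df; exact: derivable01_continuous.
Qed.

Lemma C1_01_deriv_continuous (f : R -> R) :
  C1_01 f -> continuous (deriv01 f \o clamp).
Proof. by move=> [_]; exact: continuous_clamp. Qed.

Lemma C1_01_is_derive (f : R -> R) t : C1_01 f -> 0 < t < 1 ->
  is_derive t 1 (f \o clamp) ((deriv01 f \o clamp) t).
Proof.
move=> [df _] t01; rewrite /= clamp_id; last by case/andP: t01 => /ltW-> /ltW->.
apply: (@near_eq_is_derive _ _ _ f).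
  have H : \forall s \near t, s \in `]0, 1[ by apply: near_in_itvoo; rewrite in_itv/=.
  apply: filterS H => s; rewrite in_itv/= => /andP[s0 s1] /=.
  by rewrite clamp_id// (ltW s0) ltW.
by apply: derivable01_is_derive => //; apply: df; case/andP: t01 => /ltW-> /ltW->.
Qed.

Lemma continuous_bounded01 (g : R -> R) : continuous g ->
  exists2 M, 0 < M & forall t, 0 <= t <= 1 -> `|g t| <= M.
Proof.
move=> cg.
have cng : {within `[0, 1], continuous (fun t => `|g t|)}.
  apply: continuous_subspaceT => x.
  by apply: (continuous_comp (cg x)); exact: norm_continuous.
have [c _ cM] := EVT_max ler01 cng.
exists (`|g c| + 1); first by rewrite ltr_wpDl.
by move=> t t01; rewrite (le_trans (cM t _)) ?in_itv// lerDl.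
Qed.

Lemma lipschitz_is_derive (f df : R -> R) (M : R) :
    continuous f -> (forall t, 0 < t < 1 -> is_derive t 1 f (df t)) ->
    (forall t, 0 <= t <= 1 -> `|df t| <= M) ->
  forall a b, 0 <= a <= 1 -> 0 <= b <= 1 -> `|f b - f a| <= M * `|b - a|.
Proof.
move=> cf dfE dfM a b; wlog ab : a b / a <= b.
  move=> H a01 b01; have [ab|/ltW ba] := leP a b; first exact: H.
  by rewrite distrC (distrC b); exact: H.
move=> /andP[a0 a1] /andP[b0 b1].
have [||c] := @MVT_segment _ f df a b ab.
- move=> x; rewrite in_itv/= => /andP[ax xb]; apply: dfE.
  by rewrite (le_lt_trans a0 ax) (lt_le_trans xb b1).
- exact: continuous_subspaceT.
rewrite in_itv/= => /andP[ac cb] ->; rewrite normrM ler_wpM2r// dfM//.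
by rewrite (le_trans a0 ac) (le_trans cb b1).
Qed.

Lemma C1_01_lipschitz (f : R -> R) : C1_01 f -> exists2 K, 0 < K &
  forall a b, 0 <= a <= 1 -> 0 <= b <= 1 -> `|f b - f a| <= K * `|b - a|.
Proof.
move=> fC; have [K K0 dK] := continuous_bounded01 (C1_01_deriv_continuous fC).
exists K => // a b a01 b01.
have := lipschitz_is_derive (C1_01_continuous fC)
  (fun t => @C1_01_is_derive f t fC) dK a01 b01.
by rewrite /= !clamp_id.
Qed.

End C1.

(** * The filtration of the counting process *)

Section filtration.
Variable R : realType.
Implicit Types (s t : R) (w : Omega R).

Lemma filtr_sub s t : s <= t -> @filtr R s `<=` @filtr R t.
Proof.
move=> st; apply: sub_sigma_algebra2 => A [r [z [/andP[r0 rs] ->]]].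
by exists r, z; rewrite r0 (le_trans rs st).
Qed.

Lemma filtr_measurable s (A : set (Omega R)) : s <= 1 -> filtr s A -> measurable A.
Proof. by move=> s1; exact: filtr_sub. Qed.

Lemma filtr_coord s t z : 0 <= s <= t -> filtr t [set w : Omega R | w s = z].
Proof. by move=> st; apply: sub_sigma_algebra; exists s, z. Qed.

Lemma filtr_bigcup (I : countType) t (F : I -> set (Omega R)) :
  (forall i, filtr t (F i)) -> filtr t (\bigcup_i F i).
Proof.
exact: (@countable_bigcupT_measurable _ (g_sigma_algebraType (@cylinders R t))).
Qed.

Lemma filtrI t (A B : set (Omega R)) : filtr t A -> filtr t B -> filtr t (A `&` B).
Proof. exact: (@measurableI _ (g_sigma_algebraType (@cylinders R t))). Qed.

Lemma filtrC t (A : set (Omega R)) : filtr t A -> filtr t (~` A).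
Proof. exact: (@measurableC _ (g_sigma_algebraType (@cylinders R t))). Qed.

Lemma filtrT t : filtr t [set: Omega R].
Proof. exact: (@measurableT _ (g_sigma_algebraType (@cylinders R t))). Qed.

Lemma filtr0 t : filtr t (@set0 (Omega R)).
Proof. exact: (@measurable0 _ (g_sigma_algebraType (@cylinders R t))). Qed.

Lemma filtr_start_value s t (Q : int -> int -> Prop) : 0 <= s <= t ->
  filtr t [set w : Omega R | Q (w 0) (w s)].
Proof.
move=> /andP[s0 st].
have -> : [set w : Omega R | Q (w 0) (w s)] =
    \bigcup_(x : int * int) (if `[< Q x.1 x.2 >] then
      [set w : Omega R | w 0 = x.1] `&` [set w : Omega R | w s = x.2] else set0).
  apply/seteqP; split => w /=.
    by move=> wk; exists (w 0, w s) => //=; rewrite asboolT.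
  by move=> [[x y] _ /=]; case: ifPn => // /asboolP xy [-> ->].
apply: filtr_bigcup => x; case: ifPn => _; last exact: filtr0.
by apply: filtrI; apply: filtr_coord; rewrite ?lexx ?s0 ?(le_trans s0 st).
Qed.

Lemma filtr_jump_time_le t k : 0 <= t < 1 ->
  filtr t [set w : Omega R | jump_time k.+1 w <= t].
Proof.
move=> /andP[t0 t1]; rewrite (_ : mkset _ = [set w : Omega R | w 0 + k%:Z < w t]).
  by apply: (@filtr_start_value _ _ (fun x y => x + k%:Z < y)); rewrite t0 lexx.
by apply/seteqP; split => w /=; rewrite jump_time_le.
Qed.

Lemma filtr_jump_time_gt t k :
  filtr (clamp t) [set w : Omega R | t < jump_time k.+1 w].
Proof.
have [t0|t0] := ltP t 0.
  rewrite (_ : mkset _ = setT); first exact: filtrT.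
  by apply/seteqP; split => w //= _; rewrite (lt_trans t0)// jump_time_gt0.
have [t1|t1] := leP 1 t.
  rewrite (_ : mkset _ = set0); first exact: filtr0.
  by apply/seteqP; split => w //=; rewrite ltNge (le_trans (jump_time_le1 _ _)).
rewrite clamp_id ?t0 ?ltW// (_ : mkset _ = ~` [set w : Omega R | jump_time k.+1 w <= t]).
  by apply: filtrC; apply: filtr_jump_time_le; rewrite t0.
by apply/seteqP; split => w /=; rewrite ltNge => /negP.
Qed.

Lemma measurable_ray d (T : measurableType d) (f : T -> R) :
  (forall a, measurable [set x | a < f x]) -> measurable_fun setT f.
Proof.
move=> mf; apply: (measurability _ (RGenOInfty.measurableE R)) => //.
move=> _ [_ [a ->] <-]; rewrite setTI.
rewrite (_ : f @^-1` _ = [set x | a < f x])//.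
by apply/seteqP; split => x /=; rewrite in_itv/= andbT.
Qed.

Lemma measurable_jump_time k : measurable_fun setT (@jump_time R k.+1).
Proof.
apply: measurable_ray => a; apply: (filtr_measurable _ (@filtr_jump_time_gt a k)).
by have /andP[] := clamp_itv a.
Qed.

Lemma measurable_start z : measurable [set w : Omega R | w 0 = z].
Proof. by apply: (@filtr_measurable 0) => //; apply: filtr_coord; rewrite lexx. Qed.

Lemma measurable_final z : measurable [set w : Omega R | w 1 = z].
Proof. by apply: (@filtr_measurable 1) => //; apply: filtr_coord; rewrite ler01 lexx. Qed.

(** * The predictable sigma-algebra *)

(** The half-lines extend to the negative times, where A belongs to the initial
    sigma-algebra; so the generators are stable under intersection and cover the
    space. *)
Definition predictable_gen : set_system (R * Omega R) :=
  [set B | exists s A, filtr (clamp s) A /\ B = [set x | s < x.1 /\ A x.2]].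

Definition pred_space : Type := g_sigma_algebraType predictable_gen.
HB.instance Definition _ := Pointed.on pred_space.
HB.instance Definition _ := Measurable.on pred_space.

Definition to_pred (x : R * Omega R) : pred_space := x.

Lemma clamp_max s t : clamp (Order.max s t) = Order.max (clamp s) (clamp t).
Proof.
have [st|/ltW ts] := leP s t.
  by have /andP[cst _] := clamp_lipschitz st; rewrite max_r.
by have /andP[cts _] := clamp_lipschitz ts; rewrite max_l.
Qed.

Lemma predictable_genI : setI_closed predictable_gen.
Proof.
move=> _ _ [s [A [As ->]]] [t [B [Bt ->]]].
exists (Order.max s t), (A `&` B); split.
  rewrite clamp_max; apply: filtrI; first by apply: filtr_sub As; rewrite le_max lexx.
  by apply: filtr_sub Bt; rewrite le_max lexx orbT.
apply/seteqP; split => -[r w] /=; rewrite gt_max.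
  by move=> [[-> ?] [-> ?]].
by move=> [/andP[-> ->] [? ?]].
Qed.

Lemma measurable_to_pred : measurable_fun setT to_pred.
Proof.
apply: (@measurability _ _ _ pred_space _ _ predictable_gen) => //.
move=> _ [_ [s [A [As ->]] <-]]; rewrite setTI.
rewrite (_ : _ @^-1` _ = `]s, +oo[%classic `*` A).
  apply: measurableX => //; apply: (filtr_measurable _ As).
  by have /andP[] := clamp_itv s.
by apply/seteqP; split => -[r w] /=; rewrite in_itv/= andbT.
Qed.

Lemma measurable_pred_gen s A : filtr (clamp s) A ->
  measurable ([set x | s < x.1 /\ A x.2] : set pred_space).
Proof. by move=> As; apply: sub_sigma_algebra; exists s, A. Qed.

Lemma measurable_pred_time : measurable_fun setT (fun x : pred_space => x.1 : R).
Proof.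
apply: measurable_ray => a.
rewrite (_ : mkset _ = [set x : pred_space | a < x.1 /\ [set: Omega R] x.2]).
  by apply: (@measurable_pred_gen a setT); exact: filtrT.
by apply/seteqP; split => x //= -[].
Qed.

Lemma measurable_pred_start z : measurable [set x : pred_space | x.2 0 = z].
Proof.
rewrite (_ : mkset _ = \bigcup_n
  [set x : pred_space | - n%:R < x.1 /\ [set w : Omega R | w 0 = z] x.2]).
  apply: bigcupT_measurable => n; apply: (@measurable_pred_gen _ [set w : Omega R | w 0 = z]).
  by rewrite clamp_le0 ?oppr_le0//; apply: filtr_coord; rewrite lexx.
apply/seteqP; split => -[r w] /=; last by move=> [n _ []].
move=> wz; exists (Num.bound `|r|) => //=; split => //.
by rewrite ltrNl (le_lt_trans (ler_norm _))// normrN archi_boundP.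
Qed.

(** A rational time between the jump and the present makes this event a countable
    union of generators. *)
Lemma measurable_pred_jump k :
  measurable [set x : pred_space | jump_time k.+1 x.2 < clamp x.1].
Proof.
rewrite (_ : mkset _ = \bigcup_(q : rat) (if (0 <= (ratr q : R) < 1) then
  [set x : pred_space | ratr q < x.1 /\ [set w | jump_time k.+1 w <= ratr q] x.2]
  else set0)).
  apply: bigcupT_measurable_rat => q; case: ifPn => // q01.
  apply: (@measurable_pred_gen _ [set w | jump_time k.+1 w <= ratr q]).
  rewrite clamp_id; first exact: filtr_jump_time_le.
  by case/andP: q01 => -> /ltW.
apply/seteqP; split => -[r w] /=.
  move=> /rat_in_itvoo[q]; rewrite in_itv/= => /andP[jq qr].
  have q1 : ratr q < 1 :> R.
    by rewrite (lt_le_trans qr)//; have /andP[] := clamp_itv r.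
  have q0 : 0 <= ratr q :> R by rewrite ltW// (lt_trans _ jq)// jump_time_gt0.
  exists q => //; rewrite q0 q1/=; split; last exact: ltW.
  move: qr; have [r1|r1 _] := leP r 1; last exact: lt_trans r1.
  have [r0|r0] := leP 0 r; first by rewrite clamp_id ?r0.
  by rewrite clamp_le0 ?ltW// ltNge q0.
move=> [q _ /=]; case: ifPn => // /andP[q0 q1] [qr jq].
rewrite (le_lt_trans jq)//; have [r1|r1] := leP r 1; last by rewrite clamp_ge1// ltW.
by rewrite clamp_id// r1 (le_trans q0)// ltW.
Qed.

(** A jump time is not predictable, but its minimum with the present time is. *)
Lemma measurable_pred_past k :
  measurable_fun setT (fun x : pred_space => Order.min (jump_time k.+1 x.2) x.1).
Proof.
apply: measurable_ray => a.
rewrite (_ : mkset _ = [set x : pred_space | a < x.1 /\ [set w | a < jump_time k.+1 w] x.2]).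
  apply: (@measurable_pred_gen a [set w | a < jump_time k.+1 w]).
  exact: filtr_jump_time_gt.
by apply/seteqP; split => x /=; rewrite lt_min; [move=> /andP[]|move=> [-> ->]].
Qed.

Lemma measurable_pred_state x k : measurable
  [set p : pred_space | p.2 0 = x /\ left_lim p.2 (clamp p.1) = x + k%:Z].
Proof.
rewrite (_ : mkset _ = [set p : pred_space | p.2 0 = x] `&`
   (~` [set p : pred_space | jump_time k.+1 p.2 < clamp p.1]) `&`
   (if k is k'.+1 then [set p : pred_space | jump_time k'.+1 p.2 < clamp p.1] else setT)).
  apply: measurableI; first apply: measurableI.
  - exact: measurable_pred_start.
  - by apply: measurableC; exact: measurable_pred_jump.
  - by case: k => // k; exact: measurable_pred_jump.
have lc r : clamp r <= 1 :> R by have /andP[] := clamp_itv r.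
apply/seteqP; split => -[r w] /=.
  move=> [wx wk]; rewrite !jump_time_lt// wk wx ltxx; split => //.
  by case: k wk => // k wk /=; rewrite jump_time_lt// wk wx ltrD2l ltz_nat.
move=> [[wx]]; rewrite !jump_time_lt// => /negP; rewrite -leNgt wx => kw kw'.
split=> //; apply/eqP; rewrite eq_le kw/=.
case: k kw kw' => [|k] kw; first by rewrite addr0 -wx left_lim_ge.
rewrite /= jump_time_lt// wx; rewrite -lezD1 -addrA.
by rewrite -[k.+1]addn1 PoszD.
Qed.

Lemma measurable_pred_left_lim z :
  measurable [set p : pred_space | left_lim p.2 (clamp p.1) = z].
Proof.
rewrite (_ : mkset _ = \bigcup_(x : int * nat) (if x.1 + x.2%:Z == z then
  [set p : pred_space | p.2 0 = x.1 /\ left_lim p.2 (clamp p.1) = x.1 + x.2%:Z] else set0)).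
  apply: countable_bigcupT_measurable => // -[x k] /=; case: ifPn => // _.
  exact: measurable_pred_state.
apply/seteqP; split => -[r w] /=.
  move=> wz; have := left_limE w (clamp r); set k := count _ _ => wk.
  by exists (w 0, k) => //=; rewrite -wk wz eqxx.
by move=> [[x k] _ /=]; case: ifPn => //= /eqP <- [].
Qed.

Lemma measurable_pred_compose (f : R -> int -> R) :
    (forall z, measurable_fun setT (f ^~ z)) ->
  measurable_fun setT (fun p : pred_space => f p.1 (left_lim p.2 (clamp p.1))).
Proof.
move=> mf _ B mB; rewrite setTI.
rewrite (_ : _ @^-1` _ = \bigcup_(z : int)
  ([set p : pred_space | left_lim p.2 (clamp p.1) = z] `&`
   (fun p : pred_space => f p.1 z) @^-1` B)).
  apply: countable_bigcupT_measurable => // z; apply: measurableI.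
    exact: measurable_pred_left_lim.
  rewrite -[X in measurable X]setTI.
  exact: (measurableT_comp (mf z) measurable_pred_time).
by apply/seteqP; split => -[r w] /= => [?|[z _ [-> //]]]; eexists.
Qed.

End filtration.

(** * Measures with a density *)

Section density.
Local Open Scope ereal_scope.
Context d (T : measurableType d) (R : realType) (mu : {measure set T -> \bar R}).
Variable rho : T -> R.
Hypothesis mrho : measurable_fun setT rho.
Hypothesis rho0 : forall x, (0 <= rho x)%R.

(** The proofs are arguments so that the measure structure can be attached to the
    set function. *)
Definition mdensity (_ : measurable_fun setT rho) (_ : forall x, (0 <= rho x)%R)
  (A : set T) : \bar R := \int[mu]_(x in A) (rho x)%:E.

Local Notation md := (mdensity mrho rho0).

Let mrhoE : measurable_fun setT (EFin \o rho).
Proof. exact/measurable_EFinP. Qed.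

Let md0 : md set0 = 0.
Proof. exact: integral_set0. Qed.

Let md_ge0 A : 0 <= md A.
Proof. by apply: integral_ge0 => x _; rewrite lee_fin. Qed.

Let md_sigma_additive : semi_sigma_additive md.
Proof.
move=> F mF tF mUF; rewrite /mdensity ge0_integral_bigcup//.
- by apply: is_cvg_nneseries => n _ _; exact: md_ge0.
- exact: measurable_funTS.
- by move=> x _; rewrite lee_fin.
Qed.

HB.instance Definition _ := isMeasure.Build _ _ _ md md0 md_ge0 md_sigma_additive.

Import HBNNSimple.

Lemma integral_mdensity_nnsfun (g : {nnsfun T >-> R}) :
  \int[md]_x (g x)%:E = \int[mu]_x ((g x)%:E * (rho x)%:E).
Proof.
rewrite integralT_nnsfun sintegralE.
transitivity (\int[mu]_x (\sum_(r \in range g)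
    r%:E * ((rho x)%:E * (\1_(g @^-1` [set r]) x)%:E))).
  rewrite ge0_integral_fsum//.
  - apply: eq_fsbigr => r /[!inE] -[t _ <-].
    rewrite ge0_integralZl//.
    + congr (_ * _); rewrite /= /mdensity integral_mkcond.
      by apply: eq_integral => x _; rewrite epatch_indic.
    + apply: emeasurable_funM => //; apply/measurable_EFinP; exact: measurable_indic.
    + by move=> x _; rewrite mule_ge0 ?lee_fin.
    + by rewrite lee_fin.
  - move=> r; apply: emeasurable_funM => //; apply: emeasurable_funM => //.
    by apply/measurable_EFinP; exact: measurable_indic.
  - move=> r x _; have [[t _ <-]|nr] := pselect (range g r).
      by rewrite !mule_ge0 ?lee_fin.
    rewrite indicE memNset ?mule0//= => gx; apply: nr; by exists x.
apply: eq_integral => x _; rewrite [in RHS]fimfunE/= -fsumEFin//.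
rewrite ge0_mule_fsuml//.
  by apply: eq_fsbigr => r _; rewrite EFinM -muleA (muleC (rho x)%:E).
by move=> r; rewrite lee_fin; exact: nnfun_muleindic_ge0.
Qed.

Lemma ge0_integral_mdensity (f : T -> \bar R) :
    measurable_fun setT f -> (forall x, 0 <= f x) ->
  \int[md]_x f x = \int[mu]_x (f x * (rho x)%:E).
Proof.
move=> mf f0.
pose f_ := nnsfun_approx measurableT mf.
have nd x : {homo (fun n => (f_ n x)%:E) : n m / (n <= m)%N >-> n <= m}.
  by move=> a b ab; rewrite lee_fin; exact/lefP/nd_nnsfun_approx.
have cf x : (f_ n x)%:E @[n --> \oo] --> f x.
  by apply: cvg_nnsfun_approx.
have H1 : \int[md]_x (f_ n x)%:E @[n --> \oo] --> \int[md]_x f x.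
  have -> : \int[md]_x f x = \int[md]_x limn (fun n => (f_ n x)%:E).
    by apply: eq_integral => x _; apply/esym/cvg_lim.
  apply: cvg_monotone_convergence => //.
  - by move=> n; exact/measurable_EFinP.
  - by move=> n x _; rewrite lee_fin.
have H2 : \int[mu]_x ((f_ n x)%:E * (rho x)%:E) @[n --> \oo] -->
    \int[mu]_x (f x * (rho x)%:E).
  have -> : \int[mu]_x (f x * (rho x)%:E) =
      \int[mu]_x limn (fun n => (f_ n x)%:E * (rho x)%:E).
    apply: eq_integral => x _; apply/esym/cvg_lim => //.
    by apply: cvgeZr.
  apply: cvg_monotone_convergence => //.
  - by move=> n; apply: emeasurable_funM => //; exact/measurable_EFinP.
  - by move=> n x _; rewrite mule_ge0// lee_fin.
  - by move=> x _ a b ab; apply: lee_pmul => //; rewrite ?lee_fin//; exact: nd.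
have E : (fun n => \int[md]_x (f_ n x)%:E) =
    (fun n => \int[mu]_x ((f_ n x)%:E * (rho x)%:E)).
  by apply/funext => n; exact: integral_mdensity_nnsfun.
by rewrite E in H1; exact: (cvg_unique _ H1 H2).
Qed.

End density.

(** * The compensated process is a martingale *)

Section martingale.
Variables (R : realType) (l : R -> int -> R) (hl : NMC_intensity l).
Notation lam := (@lebesgue_measure R).

(** The intensity at the left limit of the path, as a function on the predictable
    space *)
Definition rate (p : pred_space R) : R := l (clamp p.1) (left_lim p.2 (clamp p.1)).

Lemma intensity_continuous z : continuous (fun t => l (clamp t) z).
Proof. by case: hl => _ _ /(_ z) /C1_01_continuous. Qed.

Lemma measurable_rate : measurable_fun setT rate.
Proof.
apply: (@measurable_pred_compose _ (fun t z => l (clamp t) z)) => z.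
by apply: continuous_measurable_fun; exact: intensity_continuous.
Qed.

Lemma rate_gt0 p : 0 < rate p.
Proof. by case: hl => + _ _; apply; exact: clamp_itv. Qed.

Lemma rate_le : exists2 C, 0 < C & forall p, rate p <= C.
Proof.
case: hl => _ [C lC] _; exists (`|C| + 1); first by rewrite ltr_wpDl.
move=> p; rewrite (le_trans (lC _ _ (clamp_itv _)))//.
by rewrite (le_trans (ler_norm _))// lerDl.
Qed.

Definition integrated_rate (s : R) (w : Omega R) : R :=
  \int[lam]_(r in `[0, s]) l r (left_lim w r).

Lemma compensatedE s w : compensated l s w = (w s - w 0)%:~R - integrated_rate s w.
Proof. by []. Qed.

Lemma measurable_rate_prod : measurable_fun setT (fun p : R * Omega R => rate (to_pred p)).
Proof. exact: (measurableT_comp measurable_rate (@measurable_to_pred R)). Qed.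

Lemma measurable_rate_time w : measurable_fun setT (fun r => rate (to_pred (r, w))).
Proof. exact: (measurableT_comp measurable_rate_prod (pair2_measurable w)). Qed.

Lemma itv_rate s w r : s <= 1 -> `[0, s]%classic r ->
  l r (left_lim w r) = rate (to_pred (r, w)).
Proof.
move=> s1; rewrite /= in_itv/= => /andP[r0 rs].
by rewrite /rate/= clamp_id// r0 (le_trans rs).
Qed.

Lemma integrable_rate s w : s <= 1 ->
  lam.-integrable `[0, s] (fun r => (l r (left_lim w r))%:E).
Proof.
move=> s1; have [C C0 rC] := rate_le.
suff : lam.-integrable `[0, s] (EFin \o (fun r => rate (to_pred (r, w)))).
  apply: eq_integrable => // r; rewrite inE => rs.
  by rewrite /= (itv_rate _ s1 rs).
apply: measurable_bounded_integrable => //.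
- by rewrite /= lebesgue_measure_itv; case: ifP => //= _; rewrite -EFinB ltry.
- by apply: measurable_funTS; apply: measurable_rate_time.
- exists C; split; first exact: num_real.
  by move=> x Cx r _ /=; rewrite ger0_norm ?(ltW (rate_gt0 _))// (le_trans (rC _))// ltW.
Qed.

Lemma integrated_rateE s w : s <= 1 -> (integrated_rate s w)%:E =
  (\int[lam]_r (rate (to_pred (r, w)) * \1_(`[0, s]) r)%:E)%E.
Proof.
move=> s1; rewrite /integrated_rate /Rintegral fineK; last first.
  by apply: integrable_fin_num => //; exact: integrable_rate.
rewrite integral_mkcond; apply: eq_integral => r _.
rewrite patchE indicE; case: ifPn => rs; last by rewrite mulr0.
by rewrite mulr1 (itv_rate _ s1)//; exact/set_mem.
Qed.

Lemma measurable_rate_indic s :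
  measurable_fun setT (fun p : R * Omega R => (rate (to_pred p) * \1_(`[0, s]) p.1)%:E).
Proof.
apply/measurable_EFinP; apply: measurable_funM; first exact: measurable_rate_prod.
by apply: (@measurableT_comp _ _ _ _ _ _ (\1_(`[0, s]%classic) : R -> R)) => //;
  exact: measurable_indic.
Qed.

Lemma measurable_integrated_rate s : s <= 1 ->
  measurable_fun setT (integrated_rate s).
Proof.
move=> s1; apply/measurable_EFinP.
rewrite (_ : EFin \o _ = fubini_G lam
   (fun p : R * Omega R => (rate (to_pred p) * \1_(`[0, s]) p.1)%:E)); last first.
  by apply/funext => w /=; rewrite integrated_rateE.
apply: measurable_fun_fubini_tonelli_G; first exact: measurable_rate_indic.
by move=> p; rewrite lee_fin mulr_ge0// ltW// rate_gt0.
Qed.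

Lemma integrated_rate_ge0 s w : s <= 1 -> 0 <= integrated_rate s w.
Proof.
move=> s1; apply: Rintegral_ge0 => r rs.
by rewrite (itv_rate _ s1 rs) ltW// rate_gt0.
Qed.

Lemma integrated_rate_le : exists2 C, 0 < C &
  forall s w, 0 <= s <= 1 -> integrated_rate s w <= C.
Proof.
have [C C0 rC] := rate_le; exists C => // s w /andP[s0 s1].
rewrite -lee_fin /integrated_rate /Rintegral fineK; last first.
  by apply: integrable_fin_num => //; exact: integrable_rate.
apply: (@le_trans _ _ (\int[lam]_(r in `[0%R, s]) C%:E)%E).
  apply: le_integral => //; first exact: integrable_rate.
    exact/integrable_continuous/cst_continuous.
  by move=> r; rewrite inE lee_fin => rs; rewrite (itv_rate _ s1 rs).
rewrite integral_cst//= lebesgue_measure_itv/= lte_fin.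
case: ifP => _; last by rewrite mule0 lee_fin ltW.
by rewrite -EFinD subr0 -EFinM lee_fin ler_piMr// ltW.
Qed.

Lemma integrated_rate0 w : integrated_rate 0 w = 0.
Proof. by rewrite /integrated_rate set_itv1 Rintegral_set1. Qed.

Lemma measurable_increment s t : 0 <= s <= 1 -> 0 <= t <= 1 ->
  measurable_fun setT (fun w : Omega R => (w t - w s)%:~R : R).
Proof.
move=> /andP[s0 s1] /andP[t0 t1].
have mX r : 0 <= r <= 1 -> measurable_fun setT (fun w : Omega R => (w r - w 0)%:~R : R).
  move=> r01; apply: measurable_ray => a; apply: (@filtr_measurable R 1) => //.
  exact: (@filtr_start_value _ _ _ (fun x y => a < (y - x)%:~R)).
rewrite (_ : (fun _ => _) = (fun w : Omega R => (w t - w 0)%:~R - (w s - w 0)%:~R)); last first.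
  by apply/funext => w; rewrite -intrB opprB addrA subrK.
by apply: measurable_funB; apply: mX; rewrite ?s0 ?t0.
Qed.

Lemma path_mono (w : Omega R) (s t : R) : s <= t -> w s <= w t.
Proof.
move=> st; rewrite -subr_ge0 -(ler_int R) (path_increment w st).
by apply: sumr_ge0 => r _.
Qed.

Section law.
Variables (P : probability (Omega R) R) (hM : local_martingale P (compensated l)).

Let measurable_compensated s : 0 <= s <= 1 -> measurable_fun setT (compensated l s).
Proof.
move=> s01; apply: measurable_funB; first by apply: measurable_increment => //; rewrite lexx ler01.
by apply: measurable_integrated_rate; case/andP: s01.
Qed.

(** The localized martingales are bounded below and have mean zero, so Fatou
    bounds the mean of the total number of jumps by the bound of the total rate. *)
Lemma integrable_size : P.-integrable setT (fun w => (w 1 - w 0)%:~R%:E).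
Proof.
have [tau [tau_stop tau_cvg tauM]] := hM.
have [C C0 rC] := integrated_rate_le.
pose M n w := compensated l (Order.min 1 (tau n w)) w.
have min01 n w : 0 <= Order.min 1 (tau n w) <= 1.
  by rewrite le_min ler01/= ge_min lexx andbT; case: (tau_stop n) => + _; exact.
have MC n w : - C <= M n w.
  have /andP[r0 _] := min01 n w.
  have X0 : 0 <= (w (Order.min 1 (tau n w)) - w 0)%:~R :> R.
    by rewrite ler0z subr_ge0 path_mono.
  by rewrite /M compensatedE; have := rC _ w (min01 n w); lra.
have mM n : P.-integrable setT (EFin \o M n).
  by case: (tauM n) => _ /(_ 1) + _; apply; rewrite ler01 lexx.
have EM n : (\int[P]_w (M n w)%:E = 0)%E.
  case: (tauM n) => _ _ /(_ 0 1 (lexx _) ler01 (lexx _) setT (@filtrT R 0)) ->.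
  apply: integral0_eq => w _; rewrite min_l; last by case: (tau_stop n).
  by rewrite compensatedE integrated_rate0 subrr subr0.
pose f n w := (M n w + C)%:E.
have mf n : measurable_fun setT (f n).
  apply/measurable_EFinP; apply: measurable_funD => //.
  by apply/measurable_EFinP; exact: (measurable_int P (mM n)).
have f0 n w : (0 <= f n w)%E by rewrite lee_fin -lerBlDr sub0r.
have Ef n : (\int[P]_w f n w = C%:E)%E.
  rewrite (_ : f n = (fun w => (M n w)%:E + (cst C w)%:E)%E)//.
  rewrite integralD_EFin//; last exact: finite_measure_integrable_cst.
  rewrite EM add0e; transitivity (C%:E * P setT)%E; first exact: (integral_cst P measurableT C%:E).
  by rewrite probability_setT mule1.
have [N [mN N0 subN]] := tau_cvg.
pose g w := (compensated l 1 w + C)%:E.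
have mg : measurable_fun setT g.
  apply/measurable_EFinP; apply: measurable_funD => //.
  by apply: measurable_compensated; rewrite ler01 lexx.
have Xg (w : Omega R) : ((w 1 - w 0)%:~R%:E <= g w)%E.
  by rewrite lee_fin compensatedE -addrA lerDl addrC subr_ge0 rC// ler01 lexx.
have X0 (w : Omega R) : (0 <= (w 1 - w 0)%:~R%:E :> \bar R)%E.
  by rewrite lee_fin ler0z subr_ge0 path_mono.
have g0 w : (0 <= g w)%E by exact: le_trans (X0 w) (Xg w).
have mX : measurable_fun setT (fun w : Omega R => (w 1 - w 0)%:~R%:E : \bar R).
  apply/measurable_EFinP; apply: measurable_increment; rewrite ?lexx ?ler01 //.
apply/integrableP; split => //.
apply: (@le_lt_trans _ _ C%:E); last exact: ltry.
apply: (@le_trans _ _ (\int[P]_w g w)%E).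
  apply: ge0_le_integral => //; first exact: measurableT_comp.
  by move=> w _; rewrite gee0_abs.
have mNC : measurable (~` N) by exact: measurableC.
rewrite (ge0_negligible_integral mN measurableT)// setTD.
have -> : (\int[P]_(w in ~` N) g w = \int[P]_(w in ~` N) limn_einf (f ^~ w))%E.
  apply: eq_integral => w; rewrite inE => Nw.
  have [_ cw] : {homo tau ^~ w : n p / (n <= p)%N >-> n <= p} /\
      \forall n \near \oo, 1 <= tau n w.
    by apply: contrapT => H; apply: Nw; exact: subN.
  have /cvg_limn_einf_sup[-> _] // : f ^~ w @ \oo --> g w.
  apply: cvg_near_cst; apply: filterS cw => n tn.
  by rewrite /f /g /M min_l.
apply: (le_trans (fatou _ _ _ _)) => //.
  by move=> n; exact: measurable_funTS.
have -> : (fun n => \int[P]_(w in ~` N) f n w)%E = cst C%:E.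
  apply/funext => n /=; rewrite -(Ef n) [RHS](ge0_negligible_integral mN measurableT)// setTD.
  by [].
have H : cst C%:E @ \oo --> C%:E by exact: cvg_cst.
by rewrite (cvg_limn_einf_sup H).
Qed.

(** On [0, 1] the compensated process is bounded by the total number of jumps plus
    a constant, so the localization is removed by dominated convergence. *)
Lemma cvg_localized t (A : set (Omega R)) (tau : nat -> Omega R -> R) :
    0 <= t <= 1 -> measurable A ->
    (forall n w, 0 <= tau n w) ->
    {ae P, forall w, \forall n \near \oo, 1 <= tau n w} ->
    (forall n, P.-integrable setT
      (fun w => (compensated l (Order.min t (tau n w)) w)%:E)) ->
  P.-integrable A (fun w => (compensated l t w)%:E) /\
  (\int[P]_(w in A) (compensated l (Order.min t (tau n w)) w)%:E @[n --> \oo] -->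
    \int[P]_(w in A) (compensated l t w)%:E)%E.
Proof.
move=> t01 mA tau0 tau_cvg tauM; have /andP[t0 t1] := t01.
have [C C0 rC] := integrated_rate_le.
have min01 n w : 0 <= Order.min t (tau n w) <= 1.
  by rewrite le_min t0 tau0/= ge_min t1.
have dom : P.-integrable A (fun w => (w 1 - w 0)%:~R%:E + (cst C w)%:E)%E.
  apply: integrableD => //; first exact: (integrableS measurableT mA _ integrable_size).
  exact: finite_measure_integrable_cst.
have [] // := @dominated_convergence _ _ _ P A mA
  (fun n w => (compensated l (Order.min t (tau n w)) w)%:E)
  (fun w => (compensated l t w)%:E) _ _ _ _ dom.
- by move=> n; apply: measurable_funTS; exact: (measurable_int P (tauM n)).
- by apply: measurable_funTS; apply/measurable_EFinP; exact: measurable_compensated.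
- apply: filterS tau_cvg => w tw _; apply: cvg_near_cst.
  by apply: filterS tw => n tn; rewrite min_l// (le_trans t1).
apply: aeW => w n _; rewrite -EFinD lee_fin.
have /andP[r0 r1] := min01 n w; set r := Order.min _ _ in r0 r1 *.
have X0 : 0 <= (w r - w 0)%:~R :> R by rewrite ler0z subr_ge0 path_mono.
have X1 : (w r - w 0)%:~R <= (w 1 - w 0)%:~R :> R.
  by rewrite ler_int lerD2r path_mono.
have a0 := integrated_rate_ge0 w r1.
have aC : integrated_rate r w <= C by apply: rC; rewrite r0.
by rewrite ler_norml compensatedE /=; apply/andP; split; lra.
Qed.

(** The localized martingales have equal means at s and 1 on A, and both means
    converge. *)
Lemma compensated_martingale s (A : set (Omega R)) : 0 <= s <= 1 -> filtr s A ->
  [/\ P.-integrable A (fun w => (compensated l s w)%:E),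
      P.-integrable A (fun w => (compensated l 1 w)%:E) &
      (\int[P]_(w in A) (compensated l 1 w)%:E =
       \int[P]_(w in A) (compensated l s w)%:E)%E].
Proof.
move=> s01 As; have /andP[s0 s1] := s01; have mA := filtr_measurable s1 As.
have [tau [tau_stop tau_cvg tauM]] := hM.
have tau0 n w : 0 <= tau n w by case: (tau_stop n) => + _; exact.
have taue : {ae P, forall w, \forall n \near \oo, 1 <= tau n w}.
  by apply: filterS tau_cvg => w [].
have tauI t : 0 <= t <= 1 -> forall n, P.-integrable setT
      (fun w => (compensated l (Order.min t (tau n w)) w)%:E).
  by move=> t01 n; case: (tauM n) => _ /(_ t t01).
have o01 : 0 <= (1 : R) <= 1 by rewrite ler01 lexx.
have [is_ cs] := cvg_localized s01 mA tau0 taue (tauI _ s01).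
have [i1 c1] := cvg_localized o01 mA tau0 taue (tauI _ o01).
split; [exact: is_|exact: i1|].
have H : (fun n => \int[P]_(w in A) (compensated l (Order.min 1 (tau n w)) w)%:E)%E =
  (fun n => \int[P]_(w in A) (compensated l (Order.min s (tau n w)) w)%:E)%E.
  apply/funext => n; case: (tauM n) => _ _ H.
  exact: (H s 1 s0 s1 (lexx _) A As).
rewrite H in c1.
exact: (@cvg_unique _ (@ereal_hausdorff R) _ _ _ _ c1 cs).
Qed.

Lemma integrable_integrated_rate t (A : set (Omega R)) : 0 <= t <= 1 ->
  measurable A -> P.-integrable A (fun w => (integrated_rate t w)%:E).
Proof.
move=> t01 mA; have /andP[t0 t1] := t01; have [C C0 rC] := integrated_rate_le.
apply: (@measurable_bounded_integrable _ _ _ P (integrated_rate t) A mA).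
- by apply: (le_lt_trans (probability_le1 P mA)); rewrite ltry.
- by apply: measurable_funTS; exact: measurable_integrated_rate.
exists C; split; first exact: num_real.
move=> x Cx w _ /=; rewrite ger0_norm; last exact: integrated_rate_ge0.
by apply: le_trans (ltW Cx); exact: rC.
Qed.

(** The expected number of jumps after s, on an event of the past of s, is the
    expected integral of the rate after s. *)
Lemma increment_rate s (A : set (Omega R)) : 0 <= s <= 1 -> filtr s A ->
  (\int[P]_(w in A) (w 1 - w s)%:~R%:E =
   \int[P]_(w in A) (integrated_rate 1 w - integrated_rate s w)%:E)%E.
Proof.
move=> s01 As; have /andP[s0 s1] := s01; have mA := filtr_measurable s1 As.
have [is_ i1 E] := compensated_martingale s01 As.
have o01 : 0 <= (1 : R) <= 1 by rewrite ler01 lexx.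
have ida := integrableB mA (integrable_integrated_rate o01 mA)
  (integrable_integrated_rate s01 mA).
have idc := integrableB mA i1 is_.
transitivity (\int[P]_(w in A) (((compensated l 1 w)%:E - (compensated l s w)%:E) +
  ((integrated_rate 1 w)%:E - (integrated_rate s w)%:E)))%E.
  apply: eq_integral => w _; rewrite -!EFinB -EFinD !compensatedE; congr EFin.
  by rewrite !intrB; ring.
transitivity (\int[P]_(w in A) ((compensated l 1 w)%:E - (compensated l s w)%:E) +
  \int[P]_(w in A) ((integrated_rate 1 w)%:E - (integrated_rate s w)%:E))%E.
  exact: (integralD mA idc ida).
rewrite -[RHS]add0e; congr (_ + _)%E.
have -> := integralB mA i1 is_.
rewrite E; apply: subee; exact: (integrable_fin_num mA is_).
Qed.

End law.
End martingale.

(** * The measure of the jumps and its compensator *)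

Section jump_measure.
Variables (R : realType) (P : probability (Omega R) R).
Notation lam := (@lebesgue_measure R).

Lemma measurable_jump_mark (j : nat) :
  measurable_fun setT (fun w : Omega R => to_pred (jump_time j.+1 w, w)).
Proof.
apply: (measurableT_comp (@measurable_to_pred R)).
apply: measurable_fun_pair; last exact: measurable_id.
exact: (@measurable_jump_time R j).
Qed.

Lemma measurable_before1 :
  measurable_fun setT (fun p : pred_space R => \1_(`]-oo, 1[) p.1 : R).
Proof.
apply: (@measurableT_comp _ _ _ _ _ _ (\1_(`]-oo, 1[%classic) : R -> R)).
  exact: measurable_indic.
exact: measurable_pred_time.
Qed.

Definition jump_image (j : nat) : {measure set (pred_space R) -> \bar R} :=
  measure_function_pushforward__canonical__measure_function_Measure P (measurable_jump_mark j).

Definition jump_images : {measure set (pred_space R) -> \bar R} :=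
  mseries jump_image 0%N.

Let before1_ge0 (p : pred_space R) : 0 <= (\1_(`]-oo, 1[) p.1 : R).
Proof. by []. Qed.

(** The sum of the laws of the marked jump times; missing jumps are recorded at
    time 1, and removed by the density. *)
Definition jump_measure : {measure set (pred_space R) -> \bar R} :=
  mdensity jump_images measurable_before1 before1_ge0.

Lemma sum_jumps_series (h : pred_space R -> R) w : (forall p, 0 <= h p) ->
  ((\sum_(t <- jumps w) h (t, w))%:E = \sum_(n <oo)
    ((h (jump_time n.+1 w, w))%:E * (\1_(`]-oo, 1[) (jump_time n.+1 w))%:E))%E.
Proof.
move=> h0; rewrite (@nneseries_split _ _ 0%N (size (jumps w))); last first.
  by move=> k _; rewrite mule_ge0// lee_fin.
rewrite add0n [X in (_ + X)%E]eseries0.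
  rewrite adde0 big_mkord sum_jumpsE -sumEFin; apply: eq_bigr => k _.
  by rewrite indicE mem_set ?mule1//= in_itv/= jump_time_lt1.
move=> k kw _; rewrite indicE memNset ?mule0//= in_itv/=.
by rewrite jump_time_lt1; apply/negP; rewrite -leqNgt.
Qed.

Lemma measurable_marked (h : pred_space R -> R) n : measurable_fun setT h ->
  measurable_fun setT (fun w : Omega R =>
    (h (jump_time n.+1 w, w))%:E * (\1_(`]-oo, 1[) (jump_time n.+1 w))%:E)%E.
Proof.
move=> mh.
have mf : measurable_fun setT
    (fun p : pred_space R => (h p)%:E * (\1_(`]-oo, 1[) p.1)%:E)%E.
  by apply: emeasurable_funM; apply/measurable_EFinP => //; exact: measurable_before1.
exact: (measurableT_comp mf (measurable_jump_mark n)).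
Qed.

Lemma measurable_sum_jumps (h : pred_space R -> R) :
    measurable_fun setT h -> (forall p, 0 <= h p) ->
  measurable_fun setT (fun w : Omega R => \sum_(t <- jumps w) h (t, w)).
Proof.
move=> mh h0; apply/measurable_EFinP.
rewrite (_ : _ \o _ = fun w => (\sum_(n <oo)
    ((h (jump_time n.+1 w, w))%:E * (\1_(`]-oo, 1[) (jump_time n.+1 w))%:E))%E); last first.
  by apply/funext => w; rewrite -sum_jumps_series.
apply: ge0_emeasurable_sum => [n w _ _|n _].
  by rewrite mule_ge0// lee_fin.
exact: measurable_marked.
Qed.

Lemma integral_jump_measure (h : pred_space R -> R) :
    measurable_fun setT h -> (forall p, 0 <= h p) ->
  (\int[jump_measure]_p (h p)%:E =
   \int[P]_w (\sum_(t <- jumps w) h (t, w))%:E)%E.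
Proof.
move=> mh h0; rewrite ge0_integral_mdensity//; last exact/measurable_EFinP.
pose f (p : pred_space R) : \bar R := ((h p)%:E * (\1_(`]-oo, 1[) p.1)%:E)%E.
have mf : measurable_fun setT f.
  by apply: emeasurable_funM; apply/measurable_EFinP => //; exact: measurable_before1.
have f0 p : (0 <= f p)%E by rewrite mule_ge0// lee_fin.
transitivity (\sum_(n <oo) \int[P]_w f (to_pred (jump_time n.+1 w, w)))%E.
  rewrite (ge0_integral_measure_series jump_image measurableT (fun p _ => f0 p) mf).
  apply: eq_eseriesr => n _.
  exact: (@ge0_integral_pushforward _ _ _ _ _ _ (measurable_jump_mark n) P setT f measurableT mf).
rewrite -integral_nneseries//; last by move=> n; exact: measurable_marked.
by apply: eq_integral => w _; rewrite sum_jumps_series.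
Qed.

Variables (l : R -> int -> R) (hl : NMC_intensity l).

Let unit_rate (p : pred_space R) : R := rate l p * \1_(`[0, 1]) p.1.

Let unit_rate_ge0 p : 0 <= unit_rate p.
Proof. by rewrite mulr_ge0// ltW// rate_gt0. Qed.

Let measurable_unit_rate : measurable_fun setT unit_rate.
Proof.
apply: measurable_funM; first exact: measurable_rate.
apply: (@measurableT_comp _ _ _ _ _ _ (\1_(`[0, 1]%classic) : R -> R)).
  exact: measurable_indic.
exact: measurable_pred_time.
Qed.

(** The same statement on the copy of the line that carries Lebesgue measure *)
Lemma measurable_to_predL :
  measurable_fun setT (@to_pred R : measurableTypeR R * Omega R -> pred_space R).
Proof. by move=> _ Y mY; have := @measurable_to_pred R measurableT Y mY. Qed.

Let product : {measure set (measurableTypeR R * Omega R) -> \bar R} := (lam \x P)%E.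

Definition rate_measure : {measure set (pred_space R) -> \bar R} :=
  mdensity (measure_function_pushforward__canonical__measure_function_Measure
    product measurable_to_predL) measurable_unit_rate unit_rate_ge0.

Lemma integral_rate_measure (h : pred_space R -> R) :
    measurable_fun setT h -> (forall p, 0 <= h p) ->
  (\int[rate_measure]_p (h p)%:E = \int[P]_w
   \int[lam]_t (h (t, w) * (rate l (t, w) * \1_(`[0, 1]) t))%:E)%E.
Proof.
move=> mh h0; rewrite ge0_integral_mdensity//; last exact/measurable_EFinP.
pose f (p : pred_space R) : \bar R := ((h p)%:E * (unit_rate p)%:E)%E.
have mf : measurable_fun setT f.
  by apply: emeasurable_funM; apply/measurable_EFinP.
have f0 p : (0 <= f p)%E by rewrite mule_ge0// lee_fin.
have mfL := measurableT_comp mf measurable_to_predL.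
transitivity (\int[product]_p f (to_pred p))%E.
  have f0' : {in setT, forall p, (0 <= f p)%E} by move=> p _; exact: f0.
  have := @ge0_integral_pushforward _ _ _ _ _ _ measurable_to_predL
    product setT f measurableT mf f0'.
  by rewrite preimage_setT.
exact: (@fubini_tonelli2 _ _ _ _ _ lam P (f \o @to_pred R) mfL (fun p => f0 _)).
Qed.

End jump_measure.

(** * The compensation formula *)

Section predictable_formula.
Variables (R : realType) (P : probability (Omega R) R).
Variables (l : R -> int -> R) (hl : NMC_intensity l).
Hypothesis hM : local_martingale P (compensated l).
Notation lam := (@lebesgue_measure R).

Lemma clamp_lt (s t : R) : 0 < t < 1 -> (clamp s < t) = (s < t).
Proof.
move=> /andP[t0 t1]; have [s0|s0] := leP s 0.
  by rewrite clamp_le0// t0 (le_lt_trans s0 t0).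
have [s1|s1] := leP 1 s.
  by rewrite clamp_ge1// !ltNge (ltW t1) (le_trans (ltW t1) s1).
by rewrite clamp_id// (ltW s0) ltW.
Qed.

Lemma jump_measure_gen s (A : set (Omega R)) : filtr (clamp s) A ->
  (jump_measure P [set p : pred_space R | (s < p.1)%R /\ A p.2] =
   \int[P]_(w in A) (w 1 - w (clamp s))%:~R%:E)%E.
Proof.
move=> As; set B := mkset _; have mB : measurable B by exact: measurable_pred_gen.
rewrite -[B]setIT -integral_indic//.
have mh : measurable_fun setT (\1_B : pred_space R -> R) by exact: measurable_indic.
rewrite (@integral_jump_measure _ _ (\1_B) mh)//.
rewrite [RHS]integral_mkcond; apply: eq_integral => w _.
have [_ w01 _] := jumpsP w.
rewrite patchE; case: ifPn => [/set_mem|/negP] Aw.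
  have /andP[_ c1] := clamp_itv s.
  rewrite (path_increment w c1); congr EFin; apply: eq_big_seq => t /w01 t01.
  rewrite indicE clamp_lt//; have /andP[_ /ltW->] := t01; rewrite andbT.
  by congr (_%:R); apply: congr1; apply/idP/idP => [/set_mem[]//|st]; exact/mem_set.
rewrite big1// => t _; rewrite indicE memNset// => -[_ /= ?].
by apply: Aw; exact/mem_set.
Qed.

Lemma rate_measure_gen s (A : set (Omega R)) : filtr (clamp s) A ->
  (rate_measure P hl [set p : pred_space R | (s < p.1)%R /\ A p.2] =
   \int[P]_(w in A) (integrated_rate l 1 w - integrated_rate l (clamp s) w)%:E)%E.
Proof.
move=> As; set B := mkset _; have mB : measurable B by exact: measurable_pred_gen.
rewrite -[B]setIT -integral_indic//.
have mh : measurable_fun setT (\1_B : pred_space R -> R) by exact: measurable_indic.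
rewrite (@integral_rate_measure _ _ _ _ (\1_B) mh)//.
rewrite [RHS]integral_mkcond; apply: eq_integral => w _.
rewrite patchE; case: ifPn => [/set_mem|/negP] Aw; last first.
  apply: integral0_eq => t _; rewrite indicE memNset ?mul0r// => -[_ /= ?].
  by apply: Aw; exact/mem_set.
have rE t : \1_B (t, w) = (s < t)%R%:R :> R.
  by rewrite indicE; congr (_%:R); apply: congr1; apply/idP/idP => [/set_mem[]//|st]; exact/mem_set.
have o1 : (1 : R) <= 1 by [].
have [s0|s0] := ltP s 0.
  rewrite clamp_le0 ?ltW// integrated_rate0 subr0 integrated_rateE//.
  apply: eq_integral => t _; rewrite rE indicE.
  have [t01|_] := boolP (t \in _); last by rewrite !mulr0.
  rewrite (lt_le_trans s0) ?mul1r//.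
  by move: t01; rewrite inE/= in_itv/= => /andP[].
have [/= c0 c1] := andP (clamp_itv s).
have mr t : measurable_fun setT (fun r => (rate l (to_pred (r, w)) * \1_(`[0, t]) r)%:E).
  apply/measurable_EFinP; apply: measurable_funM; first exact: measurable_rate_time.
  exact: measurable_indic.
have r0 p : 0 <= rate l p by rewrite ltW// rate_gt0.
have mB1 : measurable_fun setT
    (fun t => (\1_B (t, w) * (rate l (t, w) * \1_(`[0, 1]) t))%:E).
  apply/measurable_EFinP; apply: measurable_funM; last first.
    by apply/measurable_EFinP; exact: (mr 1).
  rewrite (_ : (fun t => _) = \1_(`]s, +oo[%classic)); first exact: measurable_indic.
  by apply/funext => t; rewrite rE indicE mem_setE in_itv/= andbT.
have E : (\int[lam]_t (\1_B (t, w) * (rate l (t, w) * \1_(`[0, 1]) t))%:E +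
    (integrated_rate l (clamp s) w)%:E = (integrated_rate l 1 w)%:E)%E.
  rewrite !integrated_rateE// -ge0_integralD//.
  - apply: eq_integral => t _; rewrite -EFinD rE; congr EFin.
    rewrite !indicE !mem_setE !in_itv/= /to_pred; have [t0|] := leP 0 t; last first.
      by rewrite !mulr0 addr0.
    have [st|ts] /= := ltP s t.
      have [t1|t1] /= := leP t 1; last first.
        rewrite !mulr0 add0r leNgt (_ : clamp s < t) ?mulr0//.
        by rewrite (le_lt_trans c1).
      rewrite mul1r leNgt (_ : clamp s < t) ?mulr0 ?addr0//.
      by rewrite clamp_id// s0 (le_trans (ltW st) t1).
    rewrite mul0r add0r; have [s1|/ltW s1] := leP 1 s; first by rewrite clamp_ge1.
    by rewrite clamp_id ?s0// ts (le_trans ts s1).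
  - by move=> t _; rewrite lee_fin !mulr_ge0.
  - by move=> t _; rewrite lee_fin !mulr_ge0.
  - exact: mr.
by rewrite [RHS]/= EFinB -E addeK.
Qed.

(** The martingale property says that the two measures agree on the generators
    of the predictable sigma-algebra; hence they are equal. *)
Lemma jump_measureE (B : set (pred_space R)) : measurable B ->
  jump_measure P B = rate_measure P hl B.
Proof.
pose g n := [set p : pred_space R | - n%:R < p.1 /\ [set: Omega R] p.2].
apply: (@measure_unique _ R (pred_space R) (@predictable_gen R) g) => //.
- exact: predictable_genI.
- by move=> n; exists (- n%:R), setT; split => //; exact: filtrT.
- apply/seteqP; split => // -[r w] _; exists (Num.bound `|r|) => //=; split => //.
  by rewrite ltrNl (le_lt_trans (ler_norm _))// normrN archi_boundP.
- move=> _ [s [A [As ->]]]; rewrite jump_measure_gen// rate_measure_gen//.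
  by apply: (increment_rate hl hM) => //; exact: clamp_itv.
- move=> n; rewrite jump_measure_gen; last exact: filtrT.
  rewrite clamp_le0 ?oppr_le0//.
  have /integrableP[_] := integrable_size hl hM; apply: le_lt_trans.
  apply: ge0_le_integral => //.
  + by move=> w _; rewrite lee_fin ler0z subr_ge0 path_mono.
  + by apply/measurable_EFinP; apply: measurable_increment; rewrite lexx ler01.
  + apply: measurableT_comp => //.
    by apply/measurable_EFinP; apply: measurable_increment; rewrite lexx ler01.
  + by move=> w _; rewrite lee_abs.
Qed.

Lemma predictable_formula (h : pred_space R -> R) :
    measurable_fun setT h -> (forall p, 0 <= h p) ->
  (\int[P]_w (\sum_(t <- jumps w) h (t, w))%:E = \int[P]_w
   \int[lam]_t (h (t, w) * (rate l (t, w) * \1_(`[0, 1]) t))%:E)%E.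
Proof.
move=> mh h0; rewrite -(integral_jump_measure P mh h0) -(integral_rate_measure P hl mh h0).
apply: eq_measure_integral => B mB _.
exact: jump_measureE.
Qed.

End predictable_formula.

Section compensation.
Variables (R : realType) (P : probability (Omega R) R).
Variables (l : R -> int -> R) (hl : NMC_intensity l).
Hypothesis hM : local_martingale P (compensated l).
Notation lam := (@lebesgue_measure R).

Section bounded_process.
Variables (h : pred_space R -> R) (K : R).
Hypotheses (mh : measurable_fun setT h) (h0 : forall p, 0 <= h p).
Hypothesis hK : forall p, h p <= K.

Let mhr w : measurable_fun setT (fun t => h (to_pred (t, w)) * rate l (to_pred (t, w))).
Proof.
apply: measurable_funM; last exact: measurable_rate_time.
exact: (measurableT_comp (measurableT_comp mh (@measurable_to_pred R)) (pair2_measurable w)).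
Qed.

Let r0 p : 0 <= rate l p. Proof. by rewrite ltW// rate_gt0. Qed.

Lemma integrable_process_rate w :
  lam.-integrable `[0, 1] (fun t => (h (t, w) * rate l (t, w))%:E).
Proof.
have [C C0 rC] := rate_le hl.
apply: (@measurable_bounded_integrable _ _ _ lam (fun t => h (t, w) * rate l (t, w))) => //.
- by rewrite /= lebesgue_measure_itv/= lte_fin ltr01 -EFinB ltry.
- by apply: measurable_funTS; exact: mhr.
exists (K * C); split; first exact: num_real.
move=> x Cx t _ /=; rewrite ger0_norm ?mulr_ge0//.
by apply: le_trans (ltW Cx); apply: ler_pM.
Qed.

Let integral_rateE w :
  ((\int[lam]_(t in `[0, 1]) (h (t, w) * rate l (t, w)))%R%:E =
   \int[lam]_t (h (t, w) * (rate l (t, w) * \1_(`[0, 1]) t))%:E)%E.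
Proof.
rewrite /Rintegral fineK; last first.
  by apply: (integrable_fin_num _ (integrable_process_rate w)).
rewrite integral_mkcond; apply: eq_integral => t _.
by rewrite patchE indicE; case: ifPn => _; rewrite ?mulr1 ?mulr0.
Qed.

(** The rate is bounded, so the integral against it is integrable when h is bounded;
    by the equality of the measures the jump sum is integrable as well, and bounded
    processes may be subtracted from one another. *)
Lemma compensation :
  [/\ P.-integrable setT (fun w => (\sum_(t <- jumps w) h (t, w))%:E),
      P.-integrable setT
        (fun w => (\int[lam]_(t in `[0, 1]) (h (t, w) * rate l (t, w)))%R%:E) &
      (\int[P]_w (\sum_(t <- jumps w) h (t, w))%:E =
       \int[P]_w (\int[lam]_(t in `[0, 1]) (h (t, w) * rate l (t, w)))%R%:E)%E].
Proof.
have E : (\int[P]_w (\sum_(t <- jumps w) h (t, w))%:E =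
    \int[P]_w (\int[lam]_(t in `[0, 1]) (h (t, w) * rate l (t, w)))%R%:E)%E.
  rewrite (predictable_formula hl hM mh h0); apply: eq_integral => w _.
  by rewrite integral_rateE.
have mA := measurable_sum_jumps mh h0.
have A0 w : 0 <= \sum_(t <- jumps w) h (t, w) by exact: sumr_ge0.
have K0 : 0 <= K by rewrite (le_trans (h0 (to_pred (0, point))))//.
have iA : P.-integrable setT (fun w => (\sum_(t <- jumps w) h (t, w))%:E).
  have iK := integrableZl measurableT K (integrable_size hl hM).
  apply: (le_integrable measurableT _ _ iK); first exact/measurable_EFinP.
  move=> w _ /=; rewrite lee_fin ger0_norm// normrM ger0_norm//.
  rewrite size_jumps addrC addKr ger0_norm//.
  rewrite (le_trans (ler_sum _ (fun t _ => hK (t, w))))//.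
  rewrite big_const_seq count_predT iter_addr_0 -mulr_natr.
  by [].
split=> //; apply/integrableP; split.
  rewrite (_ : (fun w => _) = fubini_G lam (fun p : R * Omega R =>
     (h (to_pred p) * (rate l (to_pred p) * \1_(`[0, 1]) p.1))%:E)); last first.
    by apply/funext => w; rewrite integral_rateE.
  apply: measurable_fun_fubini_tonelli_G => //.
    apply/measurable_EFinP; apply: measurable_funM.
      exact: (measurableT_comp mh (@measurable_to_pred R)).
    by apply/measurable_EFinP; exact: measurable_rate_indic.
  by move=> p; rewrite lee_fin !mulr_ge0.
have B0 w : 0 <= \int[lam]_(t in `[0, 1]) (h (t, w) * rate l (t, w)).
  by apply: Rintegral_ge0 => t _; rewrite mulr_ge0.
rewrite (eq_integral (fun w =>
    (\int[lam]_(t in `[0, 1]) (h (t, w) * rate l (t, w)))%R%:E)); last first.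
  by move=> w _; rewrite gee0_abs// lee_fin.
rewrite -E.
have /integrableP[_] := iA; rewrite (eq_integral (fun w =>
  (\sum_(t <- jumps w) h (t, w))%:E))// => w _.
by rewrite gee0_abs// lee_fin.
Qed.

End bounded_process.
End compensation.

(** * Backward equations *)

Section bounded_functions.
Variables (T : Type) (R : realType).
Implicit Types f g : T -> R.

Definition bounded_on_all f := exists K, forall x, `|f x| <= K.

Lemma bounded_on_allM f g :
  bounded_on_all f -> bounded_on_all g -> bounded_on_all (fun x => f x * g x).
Proof.
move=> [K fK] [L gL]; exists (K * L) => x; rewrite normrM.
by apply: ler_pM.
Qed.

Lemma bounded_on_all_sum (I : Type) (s : seq I) (f : I -> T -> R) :
  (forall i, bounded_on_all (f i)) -> bounded_on_all (fun x => \sum_(i <- s) f i x).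
Proof.
move=> fb; elim: s => [|i s [K sK]].
  by exists 0 => x; rewrite big_nil normr0.
have [L iL] := fb i; exists (L + K) => x; rewrite big_cons.
by rewrite (le_trans (ler_normD _ _))// lerD.
Qed.

Lemma bounded_on_all_prod (I : Type) (s : seq I) (f : I -> T -> R) :
  (forall i, bounded_on_all (f i)) -> bounded_on_all (fun x => \prod_(i <- s) f i x).
Proof.
move=> fb; elim: s => [|i s IH].
  by exists 1 => x; rewrite big_nil normr1.
have [K iK] := bounded_on_allM (fb i) IH.
by exists K => x; rewrite big_cons.
Qed.

Lemma bounded_on_all_indic (A : set T) : bounded_on_all (\1_A : T -> R).
Proof. by exists 1 => x; rewrite indicE ger0_norm// lern1 leq_b1. Qed.

Lemma bounded_on_all_clamp (g : R -> R) (t : T -> R) : continuous g ->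
  bounded_on_all (fun x => g (clamp (t x))).
Proof.
move=> cg; have [M _ gM] := continuous_bounded01 cg.
by exists M => x; apply: gM; exact: clamp_itv.
Qed.

End bounded_functions.

Definition start_at (R : realType) (x : int) : set (Omega R) := [set w | w 0 = x].

Lemma measurable_start_at (R : realType) x : measurable (@start_at R x).
Proof. exact: measurable_start. Qed.

Section backward_equation.
Variables (R : realType) (P : probability (Omega R) R).
Variables (l : R -> int -> R) (hl : NMC_intensity l).
Hypothesis hM : local_martingale P (compensated l).
Notation lam := (@lebesgue_measure R).
Variables (x : int) (n : nat) (g : nat -> R -> R).
Hypotheses (cg : forall k, continuous (g k)) (g0 : forall k t, 0 <= g k t).

Definition past (k : nat) (w : Omega R) : R := \prod_(j < k) g j (jump_time j.+1 w).

(** The process that is [past k] times [b k] while k jumps have occurred, on the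
    paths from x. Taking the minimum with the present time does not change the
    jump times that are already past, and makes the process predictable. *)
Definition past_process (b : nat -> R -> R) (p : pred_space R) : R :=
  \sum_(k < n.+1) \1_[set p : pred_space R | p.2 0 = x /\
                        left_lim p.2 (clamp p.1) = x + k%:Z] p *
    ((\prod_(j < k) g j (clamp (Order.min (jump_time j.+1 p.2) p.1))) * b k (clamp p.1)).

Lemma measurable_past_process b : (forall k, continuous (b k)) ->
  measurable_fun setT (past_process b).
Proof.
have mc (f : R -> R) (t : pred_space R -> R) : continuous f ->
    measurable_fun setT t -> measurable_fun setT (fun p => f (clamp (t p))).
  move=> cf mt; apply: (measurableT_comp (f := f \o @clamp R) _ mt).
  apply: continuous_measurable_fun => y.
  by apply: continuous_comp; [exact: clamp_continuous|exact: cf].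
move=> cb; apply: measurable_sum => k; apply: measurable_funM.
  by apply: measurable_indic; exact: measurable_pred_state.
apply: measurable_funM; last by apply: mc => //; exact: measurable_pred_time.
apply: measurable_prod => j _; apply: mc => //.
exact: measurable_pred_past.
Qed.

Lemma past_process_ge0 b p : (forall k t, 0 <= b k t) -> 0 <= past_process b p.
Proof.
by move=> b0; apply: sumr_ge0 => k _; rewrite !mulr_ge0// prodr_ge0.
Qed.

Lemma past_process_bounded b : (forall k, continuous (b k)) ->
  exists K, forall p, past_process b p <= K.
Proof.
move=> cb; suff [K bK] : bounded_on_all (past_process b).
  by exists K => p; rewrite (le_trans (ler_norm _)).
apply: bounded_on_all_sum => k; apply: bounded_on_allM.
  exact: bounded_on_all_indic.
apply: bounded_on_allM; last exact: bounded_on_all_clamp.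
by apply: bounded_on_all_prod => j; exact: bounded_on_all_clamp.
Qed.

Lemma past_process_out b t (w : Omega R) : w 0 != x -> past_process b (t, w) = 0.
Proof.
move=> wx; rewrite /past_process big1// => k _; rewrite indicE memNset ?mul0r//.
by move=> -[/= /eqP]; rewrite (negbTE wx).
Qed.

Lemma past_processE b t (w : Omega R) : 0 <= t <= 1 -> w 0 = x ->
    (forall k, (n < k)%N -> b k t = 0) ->
  past_process b (t, w) =
  past (count (fun r => (r < t)%R) (jumps w)) w *
  b (count (fun r => (r < t)%R) (jumps w)) t.
Proof.
move=> t01 wx bn; rewrite /past_process; set c := count _ _.
have cE (k : nat) : \1_[set p : pred_space R | p.2 0 = x /\
      left_lim p.2 (clamp p.1) = x + k%:Z] (t, w) = (k == c)%:R :> R.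
  rewrite indicE; congr (_%:R); apply: congr1; apply/idP/eqP.
    move=> /set_mem[/= _]; rewrite clamp_id// left_limE wx => /addrI.
    by case.
  by move=> ->; apply/mem_set; split => //=; rewrite clamp_id// left_limE wx.
under eq_bigr do rewrite cE.
have [nc|cn] := ltnP n c.
  rewrite bn// mulr0 big1// => k _.
  have [kc|_] := eqVneq (k : nat) c; last by rewrite /= mul0r.
  by have := ltn_ord k; rewrite kc ltnS leqNgt nc.
have [i0 i0c] : exists i : 'I_n.+1, i = c :> nat by exists (Ordinal (cn : (c < n.+1)%N)).
rewrite (bigD1 i0)//= i0c eqxx mul1r [X in _ + X]big1 ?addr0; last first.
  move=> k kc; have [kE|_] := eqVneq (k : nat) c; last by rewrite /= mul0r.
  by case/eqP: kc; apply: val_inj; rewrite /= kE i0c.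
rewrite clamp_id//; congr (_ * _); apply: eq_bigr => j _; congr (g _ _).
have /andP[t0 t1] := t01.
have jt : jump_time j.+1 w < t.
  by rewrite jump_time_lt// left_limE ltrD2l ltz_nat.
by rewrite min_l ?ltW// clamp_id// jump_time_le1 ltW// jump_time_gt0.
Qed.

Lemma count_jumps_lt k (w : Omega R) : (k < size (jumps w))%N ->
  count (fun r => (r < jump_time k.+1 w)%R) (jumps w) = k.
Proof.
move=> kw; have := left_lim_jump kw; rewrite left_limE => /addrI.
by case.
Qed.

Variable v : nat -> R -> R.
Hypotheses (cv : forall k, continuous (v k)) (v0 : forall k t, 0 <= v k t).
Hypothesis vn : forall k t, (n < k)%N -> v k t = 0.
Hypothesis dv : forall k (t : R), 0 < t < 1 ->
  is_derive t 1 (v k) (l (clamp t) (x + k%:Z) * (v k t - g k t * v k.+1 t)).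

Let gv k t := g k t * v k.+1 t.

Let cgv k : continuous (gv k).
Proof. by move=> t; apply: cvgM; [exact: cg|exact: cv]. Qed.

Let gv0 k t : 0 <= gv k t. Proof. by rewrite mulr_ge0. Qed.

Let gvn k t : (n < k)%N -> gv k t = 0.
Proof. by move=> nk; rewrite /gv vn ?mulr0// (ltn_trans nk). Qed.

Let A (b : nat -> R -> R) (w : Omega R) : R :=
  \sum_(t <- jumps w) past_process b (t, w).

Let B (b : nat -> R -> R) (w : Omega R) : R :=
  \int[lam]_(t in `[0, 1]) (past_process b (t, w) * rate l (t, w)).

Let A_E b (w : Omega R) : w 0 = x -> (forall k t, (n < k)%N -> b k t = 0) ->
  A b w = \sum_(i < size (jumps w)) past i w * b i (jump_time i.+1 w).
Proof.
move=> wx bn; rewrite /A sum_jumpsE; apply: eq_bigr => i _.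
rewrite past_processE ?count_jumps_lt//; last by move=> k; exact: bn.
by rewrite jump_time_le1 ltW// jump_time_gt0.
Qed.

(** Between the jumps, [past k * v k] grows at the rate l (v k - g k v k.+1) times
    [past k]; at a jump it changes by [past k] times g k v k.+1 - v k. So its
    increment over [0, 1] is a compensated jump sum. *)
Lemma backward_path (w : Omega R) : w 0 = x ->
  past (size (jumps w)) w * v (size (jumps w)) 1 - v 0%N 0 =
  (A gv w - A v w) - (B gv w - B v w).
Proof.
move=> wx.
pose V k t := past k w * v k t.
pose f k t := past k w * (l (clamp t) (x + k%:Z) * (v k t - gv k t)).
have [|||_] := @path_change_of_variables R w f V.
- move=> k t; apply: cvgM; first exact: cvg_cst.
  apply: cvgM; first exact: (intensity_continuous hl).
  by apply: cvgB; [exact: cv|exact: cgv].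
- by move=> k t; apply: cvgM; [exact: cvg_cst|exact: cv].
- move=> k t t01; have := dv k t01 => dvk.
  have := @is_deriveZ _ _ _ (v k) (past k w) t 1 _ dvk.
  by [].
have [K1 bK1] := past_process_bounded cgv.
have [K2 bK2] := past_process_bounded cv.
have i1 := integrable_process_rate hl (measurable_past_process cgv)
  (fun p => past_process_ge0 p gv0) bK1 w.
have i2 := integrable_process_rate hl (measurable_past_process cv)
  (fun p => past_process_ge0 p v0) bK2 w.
have -> : \int[lam]_(t in `[0, 1]) f (count (fun r => (r < t)%R) (jumps w)) t = B v w - B gv w.
  rewrite -RintegralB//; apply: eq_Rintegral => t; rewrite inE/= in_itv/= => t01.
  rewrite !past_processE//; try by [move=> k; exact: vn|move=> k; exact: gvn].
  by rewrite /f /rate/= clamp_id// left_limE wx; ring.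
rewrite !A_E//.
have -> : v 0%N 0 = V 0%N 0 by rewrite /V /past big_ord0 mul1r.
rewrite sumrB => H.
rewrite [X in _ = X - _ - _](_ : _ = \sum_(i < size (jumps w)) V i.+1 (jump_time i.+1 w)).
  by rewrite -/(V _ _); lra.
by apply: eq_bigr => i _; rewrite /V /past big_ord_recr/= /gv mulrA.
Qed.

(** Compensated jump sums have mean zero. *)
Lemma backward_law :
  (\int[P]_(w in @start_at R x)
     (past (size (jumps w)) w * v (size (jumps w)) 1)%:E =
   (v 0%N 0)%:E * P (start_at x))%E.
Proof.
have [K1 bK1] := past_process_bounded cgv.
have [K2 bK2] := past_process_bounded cv.
have [iA1 iB1 E1] := compensation hl hM (measurable_past_process cgv)
  (fun p => past_process_ge0 p gv0) bK1.
have [iA2 iB2 E2] := compensation hl hM (measurable_past_process cv)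
  (fun p => past_process_ge0 p v0) bK2.
have mS := @measurable_start_at R x.
pose D w := ((A gv w)%:E - (A v w)%:E - ((B gv w)%:E - (B v w)%:E))%E.
have iA := integrableB measurableT iA1 iA2.
have iB := integrableB measurableT iB1 iB2.
have iD : P.-integrable setT D by exact: (integrableB measurableT iA iB).
have ED : (\int[P]_w D w = 0)%E.
  transitivity (\int[P]_w ((A gv w)%:E - (A v w)%:E) -
      \int[P]_w ((B gv w)%:E - (B v w)%:E))%E; first exact: (integralB measurableT iA iB).
  have -> : (\int[P]_w ((A gv w)%:E - (A v w)%:E) =
      \int[P]_w ((B gv w)%:E - (B v w)%:E))%E.
    transitivity (\int[P]_w (A gv w)%:E - \int[P]_w (A v w)%:E)%E.
      exact: (integralB measurableT iA1 iA2).
    rewrite E1 E2; apply/esym.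
    exact: (integralB measurableT iB1 iB2).
  apply: subee; exact: (integrable_fin_num measurableT iB).
have DS : (\int[P]_(w in @start_at R x) D w = 0)%E.
  rewrite integral_mkcond -[RHS]ED; apply: eq_integral => w _.
  rewrite patchE; case: ifPn => // /negP wx.
  have {}wx : w 0 != x by apply/eqP => xw; apply: wx; exact/mem_set.
  rewrite /D /A /B !big1 ?subee//; try by move=> t _; rewrite past_process_out.
  by rewrite /Rintegral !integral0_eq ?subee//= => t _; rewrite past_process_out// mul0r.
transitivity (\int[P]_(w in @start_at R x) ((cst (v 0%N 0)%:E w) + D w))%E.
  apply: eq_integral => w /[!inE] wx; rewrite /D -!EFinB -EFinD -backward_path//.
  by rewrite addrC subrK.
transitivity (\int[P]_(w in @start_at R x) cst (v 0%N 0)%:E w +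
  \int[P]_(w in @start_at R x) D w)%E.
  apply: integralD => //; first exact: finite_measure_integrable_cst.
  exact: (integrableS measurableT).
by rewrite DS adde0; exact: (integral_cst P mS).
Qed.

End backward_equation.

(** * Solution of the backward equations *)

Section antiderivative.
Variable R : realType.
Notation lam := (@lebesgue_measure R).

Lemma antiderivative (f : R -> R) : continuous f ->
  exists F : R -> R, [/\ continuous F, F 0 = 0 &
    forall t : R, 0 < t < 1 -> is_derive t 1 F (f t)].
Proof.
move=> cf; pose F t := \int[lam]_(r in `[0, t]) f r.
have i1 : lam.-integrable `[0, 1] (EFin \o f) by exact: integrable_continuous.
exists (F \o @clamp R); split.
- apply: continuous_clamp.
  exact: (parameterized_integral_continuous ler01 i1).
- by rewrite /= clamp_le0// /F set_itv1 Rintegral_set1.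
move=> t t01; have /andP[t0 t1] := t01.
have [dF F'] := @continuous_FTC1 R f (BLeft 0) t 1 t1 i1 t0 (cf t).
apply: (@near_eq_is_derive _ _ _ F).
  have H : \forall s \near t, s \in `]0, 1[ by apply: near_in_itvoo; rewrite in_itv/=.
  apply: filterS H => s; rewrite in_itv/= => /andP[s0 s1].
  by rewrite clamp_id// (ltW s0) ltW.
apply: DeriveDef; [exact: dF|by rewrite -derive1E; exact: F'].
Qed.

Lemma is_derive_comp (f g : R -> R) (t df dg : R) :
  is_derive t 1 f df -> is_derive (f t) 1 g dg -> is_derive t 1 (g \o f) (dg * df).
Proof.
move=> [f1 f2] [g1 g2]; apply: DeriveDef.
  apply/derivable1_diffP; apply: differentiable_comp; apply/derivable1_diffP.
    exact: f1.
  exact: g1.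
rewrite -derive1E derive1_comp; [|exact: f1|exact: g1].
by rewrite !derive1E f2 g2.
Qed.

Lemma is_derive_mul (f g : R -> R) (t df dg : R) :
  is_derive t 1 f df -> is_derive t 1 g dg ->
  is_derive t 1 (fun s => f s * g s) (df * g t + f t * dg).
Proof.
move=> f1 g1; have := is_deriveM f1 g1.
by rewrite /GRing.scale/= addrC (mulrC df).
Qed.

Lemma is_derive_eq_val (f : R -> R) (t a b : R) :
  is_derive t 1 f a -> a = b -> is_derive t 1 f b.
Proof. by move=> + <-. Qed.

End antiderivative.

Section backward_solution.
Variables (R : realType) (l : R -> int -> R) (hl : NMC_intensity l).
Implicit Types (g v : nat -> R -> R).

Lemma continuous_expR_comp (f : R -> R) : continuous f -> continuous (fun t => expR (f t)).
Proof.
by move=> cf t; apply: (@continuous_comp _ _ _ f expR); [exact: cf|exact: continuous_expR].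
Qed.

Lemma cumulative_rate z : exists L : R -> R, [/\ continuous L, L 0 = 0 &
  forall t : R, 0 < t < 1 -> is_derive t 1 L (l (clamp t) z)].
Proof. exact/antiderivative/(intensity_continuous hl). Qed.

(** Variation of constants: u t is exp (L t) times the integral of
    g v l exp (- L) over [t, 1]. *)
Lemma backward_step z (g v : R -> R) :
    continuous g -> (forall t, 0 <= g t) -> continuous v -> (forall t, 0 <= v t) ->
  exists u : R -> R, [/\ continuous u, forall t, 0 <= u t, u 1 = 0 &
    forall t : R, 0 < t < 1 -> is_derive t 1 u (l (clamp t) z * (u t - g t * v t))].
Proof.
move=> cg g0 cv v0; have [L [cL _ dL]] := cumulative_rate z.
pose f t := g t * v t * l (clamp t) z * expR (- L t).
have cf : continuous f.
  move=> t; apply: cvgM; last first.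
    by apply: (@continuous_expR_comp (fun t => - L t)) => s; apply: cvgN; exact: cL.
  apply: cvgM; last exact: (intensity_continuous hl).
  by apply: cvgM; [exact: cg|exact: cv].
have f0 t : 0 <= f t.
  rewrite !mulr_ge0 ?expR_ge0//.
  by case: hl => + _ _ => /(_ _ z (clamp_itv t)) /ltW.
have [F [cF F0 dF]] := antiderivative cf.
have cFc : continuous (F \o @clamp R).
  by move=> t; apply: continuous_comp; [exact: clamp_continuous|exact: cF].
exists (fun t => expR (L t) * (F 1 - F (clamp t))); split.
- move=> t; apply: cvgM; first exact: continuous_expR_comp.
  by apply: cvgB; [exact: cvg_cst|exact: cFc].
- move=> t; rewrite mulr_ge0 ?expR_ge0// subr_ge0.
  have /andP[c0 c1] := clamp_itv t.
  have [||c _] := @MVT_segment _ F f (clamp t) 1 c1.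
  + by move=> y; rewrite in_itv/= => /andP[yt y1]; apply: dF; rewrite (le_lt_trans c0 yt).
  + exact: continuous_subspaceT.
  by rewrite -[_ <= F 1]subr_ge0 => ->; rewrite mulr_ge0// subr_ge0.
- by rewrite clamp_ge1// subrr mulr0.
move=> t t01; have /andP[/ltW t0 /ltW t1] := t01.
apply: (@near_eq_is_derive _ _ _ (fun t => expR (L t) * (F 1 - F t))).
  have H : \forall s \near t, s \in `]0, 1[ by apply: near_in_itvoo; rewrite in_itv/=.
  apply: filterS H => s; rewrite in_itv/= => /andP[s0 s1].
  by rewrite clamp_id// (ltW s0) ltW.
have dE := is_derive_comp (dL t t01) (is_derive_expR (L t)).
have dB : is_derive t 1 (fun t => F 1 - F t) (0 - f t).
  by have dFt := dF t t01; exact: is_deriveB.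
apply: (is_derive_eq_val (is_derive_mul dE dB)).
rewrite /f clamp_id ?t0//= sub0r expRN.
by field; rewrite gt_eqF// expR_gt0.
Qed.

(** The n-th equation is homogeneous, and each equation has the solution of the
    next one as its only source; so they are solved from the n-th down. *)
Lemma backward_solution n x g :
    (forall k, continuous (g k)) -> (forall k t, 0 <= g k t) ->
  exists v : nat -> R -> R, [/\ forall k, continuous (v k), forall k t, 0 <= v k t,
    forall k t, (n < k)%N -> v k t = 0, forall k, v k 1 = (k == n)%:R &
    forall k (t : R), 0 < t < 1 ->
      is_derive t 1 (v k) (l (clamp t) (x + k%:Z) * (v k t - g k t * v k.+1 t))].
Proof.
elim: n x g => [|n IH] x g cg g0.
  have [L [cL _ dL]] := cumulative_rate x.
  exists (fun k t => if k is 0%N then expR (L t - L 1) else 0); split.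
  - move=> [|k]; last exact: cst_continuous.
    by apply: continuous_expR_comp => t; apply: cvgB; [exact: cL|exact: cvg_cst].
  - by move=> [|k] t //; exact: expR_ge0.
  - by case.
  - by move=> [|k] //; rewrite subrr expR0.
  move=> [|k] t t01; last first.
    by apply: (is_derive_eq_val (is_derive_cst 0 t 1)); rewrite mulr0 subrr mulr0.
  have dB : is_derive t 1 (fun t => L t - L 1) (l (clamp t) x - 0).
    by have dLt := dL t t01; exact: is_deriveB.
  apply: (is_derive_eq_val (is_derive_comp dB (is_derive_expR _))).
  have -> : x + 0%:Z = x by exact: addr0.
  by rewrite /= mulr0 !subr0 mulrC.
have [v [cv v0 vn v1 dv]] := IH (x + 1) (fun k => g k.+1)
  (fun k => cg k.+1) (fun k => g0 k.+1).
have [u [cu u0 u1 du]] := backward_step x (cg 0%N) (g0 0%N) (cv 0%N) (v0 0%N).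
exists (fun k => if k is k'.+1 then v k' else u); split.
- by case.
- by case.
- by case.
- by case.
move=> [|k] t t01; first by have -> : x + 0%:Z = x by [exact: addr0]; exact: du.
by rewrite -[k.+1]add1n PoszD addrA; exact: dv.
Qed.

End backward_solution.

(** * Quasi-invariance under a change of time *)

Section quasi_invariance.
Variables (R : realType) (P : probability (Omega R) R).
Variables (l : R -> int -> R) (hl : NMC_intensity l).
Hypothesis hM : local_martingale P (compensated l).

Definition stratum (x : int) (n : nat) : set (Omega R) :=
  [set w : Omega R | w 0 = x /\ size (jumps w) = n].

Lemma stratum_final x n :
  stratum x n = [set w : Omega R | w 0 = x] `&` [set w : Omega R | w 1 = x + n%:Z].
Proof.
apply/seteqP; split => w /= [wx wn]; split => //=.
  by rewrite size_jumps wx wn.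
by move: wn; rewrite size_jumps wx => /addrI[].
Qed.

Lemma measurable_stratum x n : measurable (stratum x n).
Proof.
rewrite stratum_final; apply: measurableI; first exact: measurable_start.
exact: measurable_final.
Qed.

(** With the indicator of n as terminal value, the weighted solution ends at
    [past g n] on the paths with n jumps and at 0 on the others. *)
Lemma stratum_law x n (g v : nat -> R -> R) :
    (forall k, continuous (g k)) -> (forall k t, 0 <= g k t) ->
    (forall k, continuous (v k)) -> (forall k t, 0 <= v k t) ->
    (forall k t, (n < k)%N -> v k t = 0) -> (forall k, v k 1 = (k == n)%:R) ->
    (forall k (t : R), 0 < t < 1 ->
      is_derive t 1 (v k) (l (clamp t) (x + k%:Z) * (v k t - g k t * v k.+1 t))) ->
  (\int[P]_(w in stratum x n) (past g n w)%:E = (v 0%N 0)%:E * P (start_at x))%E.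
Proof.
move=> cg g0 cv v0 vn v1 dv; rewrite -(backward_law hl hM cg g0 cv v0 vn dv).
rewrite [LHS]integral_mkcond [RHS]integral_mkcond; apply: eq_integral => w _.
rewrite !patchE v1.
have [ws|ws] := boolP (w \in stratum x n).
  have [wx wn] := set_mem ws.
  by rewrite (mem_set (A := start_at x))// wn eqxx mulr1.
case: ifPn => // /set_mem wx; case: eqP => [wn|_]; last by rewrite mulr0.
by case/negP: ws; apply/mem_set.
Qed.

Variables (theta dtheta : R -> R).
Hypotheses (ctheta : continuous theta) (cdtheta : continuous dtheta).
Hypothesis thetaP : forall t : R, 0 < t < 1 -> is_derive t 1 theta (dtheta t).
Hypothesis theta_itv : forall t, 0 < t < 1 -> 0 < theta t < 1.
Hypotheses (theta0 : theta 0 = 0) (theta1 : theta 1 = 1).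
Hypothesis dtheta0 : forall t, 0 <= dtheta t.

(** The factor of the density of the time-changed law that is due to a jump from
    z to z + 1. With L a primitive of the intensity, the exponential compares the
    probabilities of no jump in state z before the jump, and in state z + 1
    after it. *)
Definition jump_density (L : int -> R -> R) (z : int) (t : R) : R :=
  dtheta t * (l (clamp (theta t)) z / l (clamp t) z) *
  expR ((L z t - L z (theta t)) - (L (z + 1) t - L (z + 1) (theta t))).

Lemma intensity_gt0 z t : 0 < l (clamp t) z.
Proof. by case: hl => + _ _; apply; exact: clamp_itv. Qed.

Lemma jump_density_ge0 L z t : 0 <= jump_density L z t.
Proof. by rewrite !mulr_ge0 ?invr_ge0 ?expR_ge0// ltW// intensity_gt0. Qed.

Lemma jump_density_continuous L z : (forall z, continuous (L z)) ->
  continuous (jump_density L z).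
Proof.
move=> cL t; apply: cvgM.
  apply: cvgM; first exact: cdtheta.
  apply: cvgM.
    by apply: (@continuous_comp _ _ _ theta (fun t => l (clamp t) z));
      [exact: ctheta|exact: (intensity_continuous hl)].
  by apply: cvgV; [rewrite gt_eqF// intensity_gt0|exact: (intensity_continuous hl)].
apply: (@continuous_expR_comp R
  (fun t => (L z t - L z (theta t)) - (L (z + 1) t - L (z + 1) (theta t)))) => {}t.
have cLt y : {for t, continuous (fun t => L y (theta t))}.
  by apply: continuous_comp; [exact: ctheta|exact: cL].
by apply: cvgB; apply: cvgB; first [exact: cL|exact: cLt].
Qed.

(** If v solves the backward equations for g, then the functions
    v k o theta times exp (L - L o theta), with L the primitive in state x + k,
    solve those for the time-changed functions, with the same values at 0 and 1. *)
Lemma quasi_invariance (L : int -> R -> R) x n (g : nat -> R -> R) :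
    (forall z, continuous (L z)) -> (forall z, L z 0 = 0) ->
    (forall z (t : R), 0 < t < 1 -> is_derive t 1 (L z) (l (clamp t) z)) ->
    (forall k, continuous (g k)) -> (forall k t, 0 <= g k t) ->
  (\int[P]_(w in stratum x n)
     (past (fun k t => g k (theta t) * jump_density L (x + k%:Z) t) n w)%:E =
   \int[P]_(w in stratum x n) (past g n w)%:E)%E.
Proof.
move=> cL L0 dL cg g0.
have [v [cv v0 vn v1 dv]] := backward_solution hl n x cg g0.
rewrite (stratum_law cg g0 cv v0 vn v1 dv).
pose c (k : nat) t := L (x + k%:Z) t - L (x + k%:Z) (theta t).
pose u k t := v k (theta t) * expR (c k t).
have ccomp (f : R -> R) : continuous f -> continuous (fun t => f (theta t)).
  by move=> cf t; apply: (@continuous_comp _ _ _ theta f); [exact: ctheta|exact: cf].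
have cc k : continuous (c k).
  by move=> t; apply: cvgB; [exact: cL|exact: ccomp].
have -> : v 0%N 0 = u 0%N 0.
  by rewrite /u /c theta0 subrr expR0 mulr1.
apply: stratum_law.
- move=> k t; apply: cvgM; first exact: ccomp.
  exact: jump_density_continuous.
- by move=> k t; rewrite mulr_ge0// jump_density_ge0.
- by move=> k t; apply: cvgM; [exact: ccomp|exact: continuous_expR_comp].
- by move=> k t; rewrite mulr_ge0// expR_ge0.
- by move=> k t nk; rewrite /u vn// mul0r.
- by move=> k; rewrite /u /c theta1 subrr expR0 mulr1.
move=> k t t01; have dth := thetaP t01.
have dvt := is_derive_comp dth (dv k _ (theta_itv t01)).
have dLt := dL (x + k%:Z) t t01.
have dLth := is_derive_comp dth (dL (x + k%:Z) _ (theta_itv t01)).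
have dc : is_derive t 1 (c k)
    (l (clamp t) (x + k%:Z) - l (clamp (theta t)) (x + k%:Z) * dtheta t).
  exact: is_deriveB.
have dE := is_derive_comp dc (is_derive_expR _).
apply: (is_derive_eq_val (is_derive_mul dvt dE)).
rewrite /= /jump_density /u /c -[k.+1]addn1 PoszD addrA.
pose a := L (x + k%:Z) t - L (x + k%:Z) (theta t).
pose b := L (x + k%:Z + 1) t - L (x + k%:Z + 1) (theta t).
rewrite -/a -/b expRD expRN.
have l0 := intensity_gt0 (x + k%:Z) t.
have e0 := expR_gt0 b.
by field; rewrite !gt_eqF.
Qed.

End quasi_invariance.

(** * The perturbed time *)

Section time_change.
Variables (R : realType) (u : R -> R) (hu : perturbation u).

Let uC : C1_01 u. Proof. by case: hu. Qed.
Let u0 : u 0 = 0. Proof. by case: hu. Qed.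
Let u1 : u 1 = 0. Proof. by case: hu. Qed.

(** The time change, extended to the line by the identity *)
Definition theta (e t : R) : R := t + e * u (clamp t).

Definition dtheta (e t : R) : R := 1 + e * deriv01 u (clamp t).

Lemma thetaE e t : 0 <= t <= 1 -> theta e t = time_change u e t.
Proof. by move=> t01; rewrite /theta clamp_id. Qed.

Lemma theta_0 e : theta e 0 = 0.
Proof. by rewrite /theta clamp_le0// u0 mulr0 addr0. Qed.

Lemma theta_1 e : theta e 1 = 1.
Proof. by rewrite /theta clamp_ge1// u1 mulr0 addr0. Qed.

Lemma theta_continuous e : continuous (theta e).
Proof.
move=> t; apply: cvgD; first exact: cvg_id.
by apply: cvgM; [exact: cvg_cst|exact: (C1_01_continuous uC)].
Qed.

Lemma dtheta_continuous e : continuous (dtheta e).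
Proof.
move=> t; apply: cvgD; first exact: cvg_cst.
by apply: cvgM; [exact: cvg_cst|exact: (C1_01_deriv_continuous uC)].
Qed.

Lemma theta_is_derive e (t : R) : 0 < t < 1 -> is_derive t 1 (theta e) (dtheta e t).
Proof.
move=> t01; have du := C1_01_is_derive uC t01.
have dm := is_derive_mul (is_derive_cst e t 1) du.
have := is_deriveD (is_derive_id t 1) dm.
by rewrite mul0r add0r.
Qed.

Definition theta_inv (e y : R) : R := xget 0 [set t | theta e t = y].

Section small.
Variable K : R.
Hypotheses (K0 : 0 < K) (duK : forall t, 0 <= t <= 1 -> `|deriv01 u t| <= K).

Lemma perturbation_lipschitz a b : 0 <= a <= 1 -> 0 <= b <= 1 ->
  `|u b - u a| <= K * `|b - a|.
Proof.
move=> a01 b01.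
have dK t : 0 <= t <= 1 -> `|(deriv01 u \o @clamp R) t| <= K.
  by move=> _; apply: duK; exact: clamp_itv.
have := lipschitz_is_derive (C1_01_continuous uC)
  (fun t => @C1_01_is_derive R u t uC) dK a01 b01.
by rewrite /= !clamp_id.
Qed.

Lemma perturbation_le t : 0 <= t <= 1 -> `|u t| <= K.
Proof.
move=> t01; have /andP[t0 t1] := t01.
have o01 : 0 <= (0 : R) <= 1 by rewrite lexx ler01.
have := perturbation_lipschitz o01 t01; rewrite u0 !subr0 => /le_trans; apply.
by rewrite ger0_norm// ler_piMr// ltW.
Qed.

Variable e : R.
Hypotheses (e0 : 0 < e) (eK : e * K <= 2^-1).

(** A slope of at least 1/2 makes the time change a bijection with a 2-Lipschitz
    inverse. *)
Lemma theta_expand a b : a <= b -> 2^-1 * (b - a) <= theta e b - theta e a.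
Proof.
move=> ab; have /andP[cab cba] := clamp_lipschitz ab.
have := perturbation_lipschitz (clamp_itv a) (clamp_itv b).
rewrite (ger0_norm (_ : 0 <= clamp b - clamp a)) ?subr_ge0// ler_norml => /andP[H _].
have H1 : K * (clamp b - clamp a) <= K * (b - a).
  by rewrite ler_wpM2l ?(ltW K0)// lerBlDl.
have H2 : e * (K * (b - a)) <= 2^-1 * (b - a).
  by rewrite mulrA ler_wpM2r// subr_ge0.
have H3 : e * (- (K * (b - a))) <= e * (u (clamp b) - u (clamp a)).
  by rewrite ler_wpM2l ?(ltW e0)// (le_trans _ H)// lerN2.
rewrite /theta; move: H2 H3; rewrite mulrN mulrBr; lra.
Qed.

Lemma theta_le a b : (theta e a <= theta e b) = (a <= b).
Proof.
apply/idP/idP => [H|ab]; last first.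
  have := theta_expand ab; rewrite -[theta e a <= _]subr_ge0; apply: le_trans.
  by rewrite mulr_ge0// subr_ge0.
rewrite leNgt; apply/negP => ba.
by have := theta_expand (ltW ba); lra.
Qed.

Lemma theta_lt a b : (theta e a < theta e b) = (a < b).
Proof. by rewrite !ltNge theta_le. Qed.

Lemma theta_itv t : 0 < t < 1 -> 0 < theta e t < 1.
Proof.
move=> /andP[t0 t1]; have := theta_lt 0 t; rewrite theta_0 t0 => ->.
by have := theta_lt t 1; rewrite theta_1 t1 => ->.
Qed.

Lemma dtheta_ge0 t : 0 <= dtheta e t.
Proof.
have := duK (clamp_itv t); rewrite ler_norml => /andP[H _].
have : e * (- K) <= e * deriv01 u (clamp t) by rewrite ler_wpM2l// ltW.
move: eK; rewrite /dtheta mulrN; set a := e * K; set b := e * _ => aK ab.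
by lra.
Qed.

Lemma theta_invK y : theta e (theta_inv e y) = y.
Proof.
suff [t ty] : exists t, theta e t = y by apply: (@xgetPex _ 0 [set t | theta e t = y]); exists t.
have b t : `|theta e t - t| <= 1.
  rewrite /theta addrC addKr normrM (ger0_norm (ltW e0)).
  have : e * `|u (clamp t)| <= e * K.
    by rewrite ler_wpM2l ?(ltW e0)// perturbation_le// clamp_itv.
  by have := eK; lra.
have y1 : y - 1 <= y + 1 by lra.
have [||t _ ty] := @IVT R (theta e) (y - 1) (y + 1) y y1.
- by apply: continuous_subspaceT; exact: theta_continuous.
- have := b (y - 1); have := b (y + 1); rewrite !ler_norml => /andP[a1 _] /andP[_ a2].
  by rewrite ge_min le_max; apply/andP; split; apply/orP; [left|right]; lra.
by exists t.
Qed.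

Lemma theta_invL t : theta_inv e (theta e t) = t.
Proof.
have H a b : theta e a = theta e b -> a <= b by move=> E; rewrite -theta_le E.
by apply/eqP; rewrite eq_le !H// theta_invK.
Qed.

Lemma theta_inv_le r t : (theta_inv e r <= t) = (r <= theta e t).
Proof. by rewrite -theta_le theta_invK. Qed.

Lemma theta_inv_itv r : 0 < r < 1 -> 0 < theta_inv e r < 1.
Proof.
by move=> r01; rewrite -(theta_lt 0) -(theta_lt _ 1) theta_0 theta_1 theta_invK.
Qed.

Lemma theta_inv1 : theta_inv e 1 = 1.
Proof. by have := theta_invL 1; rewrite theta_1. Qed.

Lemma theta_inv_lipschitz a b : `|theta_inv e b - theta_inv e a| <= 2 * `|b - a|.
Proof.
wlog ab : a b / a <= b.
  move=> H; have [ab|/ltW ba] := leP a b; first exact: H.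
  by rewrite distrC (distrC b); exact: H.
have iab : theta_inv e a <= theta_inv e b by rewrite -theta_le !theta_invK.
have := theta_expand iab; rewrite !theta_invK !ger0_norm ?subr_ge0//; lra.
Qed.

Lemma theta_inv_continuous : continuous (theta_inv e).
Proof.
move=> t; apply/cvgrPdist_lt => d d0; near=> s.
rewrite (le_lt_trans (theta_inv_lipschitz s t))// -ltr_pdivlMl//.
by near: s; apply: cvgr_dist_lt; [exact: cvg_id|rewrite mulr_gt0// invr_gt0].
Unshelve. all: by end_near. Qed.

(** The composition is a counting path, because its jump times are the images of
    those of w by the inverse of the time change. *)
Lemma ThetaE (w : Omega R) t : 0 <= t <= 1 -> Theta u e w t = w (theta e t).
Proof.
move=> t01; rewrite (thetaE e t01).
apply: (@xgetPex _ w [set w' : Omega R | forall t, 0 <= t <= 1 ->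
  w' t = w (time_change u e t)]) => //.
have [sw w01 wE] := jumpsP w.
have hw' : is_counting_path (fun t => w 0 +
    (count (fun r => r <= t) (map (theta_inv e) (jumps w)))%:Z).
  exists (map (theta_inv e) (jumps w)); split.
  - rewrite sorted_map; apply: sub_sorted sw => a b /= ab.
    by rewrite -theta_lt !theta_invK.
  - by move=> r /mapP[s /w01 s01 ->]; exact: theta_inv_itv.
  move=> s; congr (_ + _); rewrite (@eq_in_count _ _ pred0) ?count_pred0 ?addr0//.
  by move=> r /mapP[s' /w01 /theta_inv_itv/andP[r0 _] ->]; rewrite leNgt r0.
exists (CountingPath hw') => s s01 /=; rewrite -(thetaE e s01) (wE (theta e s)).
congr (_ + Posz _); rewrite count_map; apply: eq_count => r /=.
exact: theta_inv_le.
Qed.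

Lemma Theta_start (w : Omega R) : Theta u e w 0 = w 0.
Proof. by rewrite ThetaE ?lexx ?ler01// theta_0. Qed.

Lemma Theta_size (w : Omega R) : size (jumps (Theta u e w)) = size (jumps w).
Proof.
have := size_jumps (Theta u e w).
rewrite ThetaE ?lexx ?ler01// theta_1 Theta_start size_jumps => /addrI.
by case.
Qed.

Lemma Theta_jump_time k (w : Omega R) :
  jump_time k.+1 (Theta u e w) = theta_inv e (jump_time k.+1 w).
Proof.
have [kw|wk] := ltnP k (size (jumps w)); last first.
  by rewrite !jump_time_default ?Theta_size// theta_inv1.
have T01 : 0 < jump_time k.+1 w < 1 by rewrite jump_time_gt0 jump_time_lt1.
have T01' : 0 < jump_time k.+1 (Theta u e w) < 1.
  by rewrite jump_time_gt0 jump_time_lt1 Theta_size.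
have H t : 0 < t < 1 ->
    (jump_time k.+1 (Theta u e w) <= t) = (jump_time k.+1 w <= theta e t).
  move=> t01; have /andP[t0 t1] := t01; have /andP[_ th1] := theta_itv t01.
  by rewrite !jump_time_le// Theta_start ThetaE// (ltW t0) ltW.
apply/eqP; rewrite eq_le H ?theta_inv_itv// theta_invK lexx/=.
by rewrite theta_inv_le -H.
Qed.

End small.
End time_change.

(** * Differentiable functions on the cube *)

Section smooth.
Variables (R : realType) (m : nat) (f : 'rV[R]_m -> R).
Hypothesis f1 : Ck_cube 1 f.

Definition set_coord (p : 'rV[R]_m) (k : 'I_m) (r : R) : 'rV[R]_m :=
  \row_j (if j == k then r else p 0 j).

Lemma set_coord_cube p k r : cube p -> 0 <= r <= 1 -> cube (set_coord p k r).
Proof. by move=> pc r01 j; rewrite mxE; case: ifPn. Qed.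

Lemma slice_set_coord p k r : slice f k (set_coord p k r) = slice f k p.
Proof.
apply/funext => s; rewrite /slice; congr f; apply/rowP => j; rewrite !mxE.
by case: (j == k).
Qed.

Lemma partial01_set_coord p k r : partial01 f k (set_coord p k r) = deriv01 (slice f k p) r.
Proof. by rewrite /partial01 slice_set_coord mxE eqxx. Qed.

Lemma slice_derivable p k r : cube p -> 0 <= r <= 1 -> derivable01 (slice f k p) r.
Proof.
move=> pc r01; case: f1 => _ /(_ k)[H _].
by have := H _ (set_coord_cube k pc r01); rewrite slice_set_coord mxE eqxx.
Qed.

Lemma slice_MVT p k a b : cube p -> 0 <= a <= 1 -> 0 <= b <= 1 ->
  exists c, [/\ 0 <= c <= 1, `|c - a| <= `|b - a| &
    slice f k p b - slice f k p a = partial01 f k (set_coord p k c) * (b - a)].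
Proof.
move=> pc a01 b01; pose g := slice f k p \o @clamp R.
have cg : continuous g.
  apply: continuous_clamp; apply/subspace_continuousP => t.
  rewrite /= in_itv/= => t01; apply: derivable01_continuous.
  exact: slice_derivable.
have dg (t : R) : 0 < t < 1 -> is_derive t 1 g (deriv01 (slice f k p) t).
  move=> t01; have /andP[/ltW t0 /ltW t1] := t01.
  apply: (@near_eq_is_derive _ _ _ (slice f k p)).
    have H : \forall s \near t, s \in `]0, 1[ by apply: near_in_itvoo; rewrite in_itv/=.
    apply: filterS H => s; rewrite in_itv/= => /andP[s0 s1] /=.
    by rewrite /g/= clamp_id// (ltW s0) ltW.
  by apply: derivable01_is_derive => //; apply: slice_derivable => //; rewrite t0.
have key (y z : R) : 0 <= y <= 1 -> 0 <= z <= 1 -> y <= z -> exists c,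
    [/\ y <= c <= z & slice f k p z - slice f k p y = partial01 f k (set_coord p k c) * (z - y)].
  move=> y01 z01 yz; have /andP[y0 y1] := y01; have /andP[z0 z1] := z01.
  have [||c] := @MVT_segment _ g (deriv01 (slice f k p)) y z yz.
  - move=> t; rewrite in_itv/= => /andP[yt tz]; apply: dg.
    by rewrite (le_lt_trans y0 yt) (lt_le_trans tz z1).
  - exact: continuous_subspaceT.
  rewrite in_itv/= => yc; rewrite /g/= !clamp_id// => E.
  by exists c; split => //; rewrite E partial01_set_coord.
have [ab|/ltW ba] := leP a b.
  have [c [/andP[ac cb] E]] := key a b a01 b01 ab; exists c; split => //.
    by case/andP: a01 => a0 _; case/andP: b01 => _ b1; rewrite (le_trans a0 ac) (le_trans cb b1).
  by rewrite !ger0_norm ?subr_ge0// lerD2r.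
have [c [/andP[bc ca] E]] := key b a b01 a01 ba; exists c; split => //.
- by case/andP: b01 => b0 _; case/andP: a01 => _ a1; rewrite (le_trans b0 bc) (le_trans ca a1).
- by rewrite distrC (distrC b) !ger0_norm ?subr_ge0// lerD2l lerN2.
- by rewrite -opprB E -mulrN opprB.
Qed.

(** The mean value theorem along the coordinates, one after the other *)
Lemma mean_value (t s : 'rV[R]_m) : cube t -> cube s ->
  exists q : 'I_m -> 'rV[R]_m,
    (forall k, cube (q k) /\ forall j, `|q k 0 j - t 0 j| <= `|s 0 j - t 0 j|) /\
    f s - f t = \sum_k partial01 f k (q k) * (s 0 k - t 0 k).
Proof.
move=> ct cs.
pose p (k : nat) : 'rV[R]_m := \row_j (if (j < k)%N then s 0 j else t 0 j).
have pc k : cube (p k) by move=> j; rewrite mxE; case: ifPn.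
have step (k : 'I_m) : exists q, (cube q /\ forall j, `|q 0 j - t 0 j| <= `|s 0 j - t 0 j|) /\
    f (p k.+1) - f (p k) = partial01 f k q * (s 0 k - t 0 k).
  have [c [c01 cab E]] := slice_MVT k (pc k) (ct k) (cs k).
  exists (set_coord (p k) k c); split; last first.
    rewrite -E /slice; congr (f _ - f _); apply/rowP => j; rewrite !mxE.
      rewrite ltnS leq_eqVlt; have [->|jk] := eqVneq j k; first by rewrite eqxx.
      by rewrite (_ : (j == k :> nat) = false)//; apply/negbTE.
    have [->|//] := eqVneq j k; by rewrite ltnn.
  split; first exact: set_coord_cube.
  move=> j; rewrite !mxE; have [->//|_] := eqVneq j k.
  by case: ifPn => //; rewrite subrr normr0.
have [q Hq] := choice step; exists q; split; first by move=> k; have [] := Hq k.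
have es : p m = s by apply/rowP => j; rewrite mxE ltn_ord.
have et : p 0%N = t by apply/rowP => j; rewrite mxE.
have T := telescope_sumr (fun k => f (p k)) (leq0n m).
rewrite /= es et in T; rewrite -T big_mkord.
apply: eq_bigr => k _; have [_ ->] := Hq k.
by [].
Qed.

Lemma cube_compact : compact (@cube R m).
Proof.
rewrite (_ : @cube R m = [set v : 'rV[R]_m | forall i, `[0, 1]%classic (v ord0 i)]).
  by apply: (@rV_compact R m (fun=> `[0, 1]%classic)) => i; exact: segment_compact.
by apply/seteqP; split => v /= H i; have := H i; rewrite in_itv.
Qed.

Lemma cube_continuous_dist (h : 'rV[R]_m -> R) t e :
    {within @cube R m, continuous h} -> cube t -> 0 < e ->
  exists2 d, 0 < d & forall q, cube q -> (forall j, `|q 0 j - t 0 j| < d) -> `|h q - h t| < e.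
Proof.
move=> /subspace_continuousP ch ct e0; have /cvgrPdist_lt/(_ e e0) := ch t ct.
rewrite near_withinE => /nbhs_ballP[d /= d0 H]; exists d => // q cq qt.
rewrite distrC; apply: H => //; split => // i j; rewrite ord1 /ball/= distrC.
exact: qt.
Qed.

Lemma partial01_bounded :
  exists2 K, 0 < K & forall k t, cube t -> `|partial01 f k t| <= K.
Proof.
have bd (k : 'I_m) : exists2 K, 0 < K & forall t, cube t -> `|partial01 f k t| <= K.
  have c0 : @cube R m !=set0 by exists 0 => j; rewrite mxE lexx ler01.
  have cn : {within @cube R m, continuous (fun t => `|partial01 f k t|)}.
    have [_ /(_ k)[_ [cp _]]] := f1.
    apply/subspace_continuousP => t ct; apply: cvg_norm.
    by move/subspace_continuousP : cp; exact.
  have [c _ cM] := EVT_max_rV c0 cube_compact cn.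
  exists (`|partial01 f k c| + 1); first by rewrite ltr_wpDl.
  by move=> t ct; rewrite (le_trans (cM t _)) ?lerDl//; exact/mem_set.
have [K HK] := choice (fun k => let: ex_intro2 K a b := bd k in ex_intro (fun K => 0 < K /\ _) K (conj a b)).
exists (1 + \sum_k K k).
  rewrite ltr_pwDl// sumr_ge0// => k _; by have [/ltW] := HK k.
move=> k t ct; have [_ /(_ t ct)] := HK k => /le_trans; apply.
rewrite (bigD1 k)//= addrCA lerDl addr_ge0// sumr_ge0// => j _.
by have [/ltW] := HK j.
Qed.

Lemma cube_lipschitz : exists2 K, 0 < K & forall s t, cube s -> cube t ->
  `|f s - f t| <= K * \sum_k `|s 0 k - t 0 k|.
Proof.
have [K K0 dK] := partial01_bounded; exists K => // s t cs ct.
have [q [qP ->]] := mean_value ct cs.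
rewrite (le_trans (ler_norm_sum _ _ _))// mulr_sumr; apply: ler_sum => k _.
by rewrite normrM ler_wpM2r// dK//; have [] := qP k.
Qed.

(** At the boundary of the cube f is not differentiable in the usual sense; the
    mean value theorem and the continuity of the partial derivatives within the
    cube take the place of differentiability. *)
Lemma directional_derivative (t : 'rV[R]_m) (v : R -> 'rV[R]_m) (v0 : 'rV[R]_m) :
    cube t -> (\forall e \near 0^'+, cube (t + e *: v e)) ->
    (forall j, v e 0 j @[e --> 0^'+] --> v0 0 j) ->
  e^-1 * (f (t + e *: v e) - f t) @[e --> 0^'+] -->
    \sum_k partial01 f k t * v0 0 k.
Proof.
move=> ct cv vv0.
have [q Hq] : {q : R -> 'I_m -> 'rV[R]_m & forall e, cube (t + e *: v e) ->
    (forall k, cube (q e k) /\ forall j, `|q e k 0 j - t 0 j| <= `|e * v e 0 j|) /\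
    f (t + e *: v e) - f t = \sum_k partial01 f k (q e k) * (e * v e 0 k)}.
  apply: (@choice R ('I_m -> 'rV[R]_m) (fun e q => cube (t + e *: v e) ->
    (forall k, cube (q k) /\ forall j, `|q k 0 j - t 0 j| <= `|e * v e 0 j|) /\
    f (t + e *: v e) - f t = \sum_k partial01 f k (q k) * (e * v e 0 k))) => e.
  have [ce|nce] := pselect (cube (t + e *: v e)); last by exists (fun=> t) => /nce.
  have sE j : (t + e *: v e) 0 j - t 0 j = e * v e 0 j.
    by rewrite !mxE addrC addKr.
  have [q [qP qE]] := mean_value ct ce; exists q => _; split.
    by move=> k; have [c H] := qP k; split => // j; rewrite -sE.
  by rewrite qE; apply: eq_bigr => k _; rewrite sE.
have e_to0 : (e : R) @[e --> 0^'+] --> (0 : R) by exact: cvg_at_right_filter cvg_id.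
apply: (@cvg_trans _ (\sum_k partial01 f k (q e k) * v e 0 k @[e --> 0^'+])).
  apply: near_eq_cvg; near=> e.
  have e0 : 0 < e by near: e; exact: nbhs_right_gt.
  have [|_ ->] := Hq e; first by near: e.
  rewrite mulr_sumr; apply: eq_bigr => k _.
  by rewrite mulrCA mulKf// gt_eqF.
apply: cvg_big => [|k _]; first exact: add_continuous.
apply: cvgM; last exact: vv0.
apply/cvgrPdist_lt => d d0.
have [_ /(_ k)[_ [cp _]]] := f1.
have [h h0 H] := cube_continuous_dist cp ct d0.
have small : \forall e \near 0^'+, forall j : 'I_m, `|e * v e 0 j| < h.
  apply: filter_forall => j.
  have : e * v e 0 j @[e --> 0^'+] --> 0 * v0 0 j by apply: cvgM.
  rewrite mul0r => /cvgr_dist_lt/(_ h h0); apply: filterS => e.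
  by rewrite sub0r normrN.
near=> e; rewrite distrC; have [|qP _] := Hq e; first by near: e.
have [cq qt] := qP k; apply: H => // j; rewrite (le_lt_trans (qt j))//.
move: j; near: e; exact: small.
Unshelve. all: by end_near. Qed.

End smooth.

(** * Bounded functions and tensor products *)

Section bounded_measurable.
Context d (T : measurableType d) (R : realType) (P : probability T R).
Variables (A : set T) (mA : measurable A).
Implicit Types f g : T -> R.

Definition bounded_measurable f :=
  measurable_fun A f /\ exists K, forall x, A x -> `|f x| <= K.

Lemma bounded_measurable_integrable f :
  bounded_measurable f -> P.-integrable A (EFin \o f).
Proof.
move=> [mf [K fK]]; apply: (@measurable_bounded_integrable _ _ _ P f A mA) => //.
  by apply: (le_lt_trans (probability_le1 P mA)); rewrite ltry.
exists K; split; first exact: num_real.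
by move=> M KM x Ax /=; rewrite (le_trans (fK x Ax))// ltW.
Qed.

Lemma bounded_measurable_cst r : bounded_measurable (fun=> r).
Proof. by split; [exact: measurable_cst|exists `|r|]. Qed.

Lemma bounded_measurableM f g : bounded_measurable f -> bounded_measurable g ->
  bounded_measurable (fun x => f x * g x).
Proof.
move=> [mf [K fK]] [mg [L gL]]; split; first exact: measurable_funM.
by exists (K * L) => x Ax; rewrite normrM ler_pM ?fK ?gL.
Qed.

Lemma bounded_measurableD f g : bounded_measurable f -> bounded_measurable g ->
  bounded_measurable (fun x => f x + g x).
Proof.
move=> [mf [K fK]] [mg [L gL]]; split; first exact: measurable_funD.
exists (K + L) => x Ax; rewrite (le_trans (ler_normD _ _))//.
by rewrite lerD ?fK ?gL.
Qed.

Lemma bounded_measurableB f g : bounded_measurable f -> bounded_measurable g ->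
  bounded_measurable (fun x => f x - g x).
Proof.
move=> [mf [K fK]] [mg [L gL]]; split; first exact: measurable_funB.
exists (K + L) => x Ax; rewrite (le_trans (ler_normB _ _))//.
by rewrite lerD ?fK ?gL.
Qed.

Lemma bounded_measurable_sum (I : Type) (s : seq I) (f : I -> T -> R) :
  (forall i, bounded_measurable (f i)) ->
  bounded_measurable (fun x => \sum_(i <- s) f i x).
Proof.
move=> bf; elim: s => [|i s IH].
  by under eq_fun do rewrite big_nil; exact: bounded_measurable_cst.
by under eq_fun do rewrite big_cons; exact: bounded_measurableD.
Qed.

Lemma bounded_measurable_prod (I : Type) (s : seq I) (f : I -> T -> R) :
  (forall i, bounded_measurable (f i)) ->
  bounded_measurable (fun x => \prod_(i <- s) f i x).
Proof.
move=> bf; elim: s => [|i s IH].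
  by under eq_fun do rewrite big_nil; exact: bounded_measurable_cst.
by under eq_fun do rewrite big_cons; exact: bounded_measurableM.
Qed.

Lemma bounded_measurable_comp (h : R -> R) (f : T -> R) : continuous h ->
  measurable_fun A f -> (forall x, A x -> 0 <= f x <= 1) ->
  bounded_measurable (fun x => h (f x)).
Proof.
move=> ch mf f01; split.
  by apply: (measurableT_comp (f := h)) => //; exact: continuous_measurable_fun.
by have [M _ hM] := continuous_bounded01 ch; exists M => x /f01/hM.
Qed.

Lemma Rintegral_bounded_sum (I : Type) (s : seq I) (f : I -> T -> R) :
  (forall i, bounded_measurable (f i)) ->
  \int[P]_(x in A) (\sum_(i <- s) f i x) = \sum_(i <- s) \int[P]_(x in A) f i x.
Proof.
move=> bf; elim: s => [|i s IH].
  by under eq_Rintegral do rewrite big_nil; rewrite big_nil Rintegral_cst// mul0r.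
under eq_Rintegral do rewrite big_cons.
rewrite big_cons -IH; apply: RintegralD => //; apply: bounded_measurable_integrable => //.
exact: bounded_measurable_sum.
Qed.

Lemma Rintegral_le_bound f e : bounded_measurable f ->
  (forall x, A x -> `|f x| <= e) -> `|\int[P]_(x in A) f x| <= `|e|.
Proof.
move=> bf fe; have fi := bounded_measurable_integrable bf.
apply: (le_trans (le_normr_Rintegral mA fi)).
apply: (@le_trans _ _ (\int[P]_(x in A) `|e|)).
  apply: le_Rintegral => //.
  - exact: (@integrable_abse _ _ _ _ _ _ fi).
  - by apply: bounded_measurable_integrable; exact: bounded_measurable_cst.
  - by move=> x Ax; rewrite (le_trans (fe x Ax))// ler_norm.
rewrite Rintegral_cst// ler_piMr//.
rewrite -lee_fin fineK ?probability_le1//; exact: fin_num_measure.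
Qed.

Lemma bounded_convergence (f_ : nat -> T -> R) f M :
    (forall n, bounded_measurable (f_ n)) -> (forall n x, A x -> `|f_ n x| <= M) ->
    (forall x, A x -> f_ n x @[n --> \oo] --> f x) ->
  bounded_measurable f /\
  \int[P]_(x in A) f_ n x @[n --> \oo] --> \int[P]_(x in A) f x.
Proof.
move=> bf fM f_f.
have bf' : bounded_measurable f.
  split; first by apply: (measurable_fun_cvg (fun n => (bf n).1) f_f).
  exists M => x Ax; have H : `|f_ n x| @[n --> \oo] --> `|f x| by apply: cvg_norm; exact: f_f.
  rewrite -(cvg_lim _ H)//; apply: limr_le; first by apply/cvg_ex; eexists; exact: H.
  by apply: nearW => n; exact: fM.
split=> //; apply: fine_cvg; rewrite fineK; last first.
  by apply: integrable_fin_num => //; exact: bounded_measurable_integrable.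
have [] // := @dominated_convergence _ T R P A mA (fun n x => (f_ n x)%:E)
  (fun x => (f x)%:E) (fun=> M%:E).
- by move=> n; apply/measurable_EFinP; have [] := bf n.
- by apply/measurable_EFinP; have [] := bf'.
- by apply: aeW => x Ax; apply: cvg_EFin; [exact: nearW|exact: f_f].
- by apply: bounded_measurable_integrable; exact: bounded_measurable_cst.
- by apply: aeW => x n Ax; rewrite /= lee_fin fM.
Qed.

End bounded_measurable.

Section tents.
Variables (R : realType) (N : nat).

(** The piecewise affine function that is 1 at i / N.+1 and 0 at the other points
    of this form *)
Definition tent (i : nat) (t : R) : R :=
  clamp (N.+1%:R * t - i%:R + 1) - clamp (N.+1%:R * t - i%:R).

Lemma tent_continuous i : continuous (tent i).
Proof.
move=> t; have c (a : R) : {for t, continuous (fun t : R => clamp (N.+1%:R * t - i%:R + a))}.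
  apply: (@continuous_comp _ _ _ (fun t : R => N.+1%:R * t - i%:R + a) (@clamp R)).
    apply: cvgD; last exact: cvg_cst.
    apply: cvgB; last exact: cvg_cst.
    by apply: cvgM; [exact: cvg_cst|exact: cvg_id].
  exact: clamp_continuous.
have -> : tent i = (fun t => clamp (N.+1%:R * t - i%:R + 1) - clamp (N.+1%:R * t - i%:R + 0)).
  by apply/funext => s; rewrite addr0.
by apply: cvgB; exact: c.
Qed.

Lemma tent_ge0 i t : 0 <= tent i t.
Proof.
rewrite /tent subr_ge0.
have ab : N.+1%:R * t - i%:R <= N.+1%:R * t - i%:R + 1 by rewrite lerDl.
by have /andP[] := clamp_lipschitz ab.
Qed.

Lemma tent_near i t : tent i t != 0 -> `|i%:R / N.+1%:R - t| <= N.+1%:R^-1.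
Proof.
have N0 : 0 < N.+1%:R :> R by rewrite ltr0n.
have -> : i%:R / N.+1%:R - t = - (N.+1%:R * t - i%:R) / N.+1%:R :> R.
  by field; rewrite gt_eqF.
rewrite normrM (ger0_norm (_ : 0 <= N.+1%:R^-1 :> R)) ?invr_ge0 ?ler0n//.
move=> H; rewrite ler_piMl ?invr_ge0 ?ler0n//.
rewrite normrN; move: H; rewrite /tent; set a := _ - i%:R => H.
rewrite ler_norml; apply/andP; split; rewrite leNgt; apply/negP => a1; move/eqP: H; apply.
  by rewrite !clamp_le0 ?subrr//; lra.
by rewrite !clamp_ge1 ?subrr//; lra.
Qed.

Lemma sum_tent t : 0 <= t <= 1 -> \sum_(i < N.+2) tent i t = 1.
Proof.
move=> /andP[t0 t1].
have := telescope_sumr (fun i => - clamp (N.+1%:R * t - i%:R + 1)) (leq0n N.+2).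
rewrite big_mkord (eq_bigr (fun i : 'I_N.+2 => tent i t)); last first.
  move=> i _; rewrite /tent opprK addrC; congr (_ - clamp _).
  by rewrite -natr1; lra.
move=> ->; have N0 : 0 <= N.+1%:R * t by rewrite mulr_ge0.
rewrite clamp_le0; last first.
  rewrite -[N.+2]addn1 natrD opprD addrA subrK subr_le0 -[leRHS]mulr1.
  by rewrite ler_wpM2l.
by rewrite clamp_ge1; lra.
Qed.

End tents.

Section tensor.
Variables (R : realType) (m : nat) (f : 'rV[R]_m -> R) (K : R).
Hypothesis K0 : 0 < K.
Hypothesis fK : forall s t, cube s -> cube t -> `|f s - f t| <= K * \sum_k `|s 0 k - t 0 k|.

Definition grid N (a : {ffun 'I_m -> 'I_N.+2}) : 'rV[R]_m :=
  \row_j ((a j)%:R / N.+1%:R).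

Lemma grid_cube N a : cube (@grid N a).
Proof.
move=> j; rewrite mxE divr_ge0//= ler_pdivrMr ?ltr0n// mul1r ler_nat.
by rewrite -ltnS.
Qed.

Definition tensor N (a : {ffun 'I_m -> 'I_N.+2}) (t : 'rV[R]_m) : R :=
  \prod_j tent N (a j) (t 0 j).

Lemma tensor_ge0 N a t : 0 <= @tensor N a t.
Proof. by rewrite prodr_ge0// => j _; exact: tent_ge0. Qed.

Lemma sum_tensor N t : cube t -> \sum_a @tensor N a t = 1.
Proof.
move=> ct; rewrite -(bigA_distr_bigA (fun j (i : 'I_N.+2) => tent N i (t 0 j))) big1// => j _.
exact: sum_tent.
Qed.

Definition interpolation N (t : 'rV[R]_m) : R := \sum_a f (@grid N a) * tensor a t.

(** The tensor products of tents form a partition of unity of the cube, each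
    supported near a point of the grid. *)
Lemma interpolation_close N t : cube t ->
  `|interpolation N t - f t| <= K * m%:R / N.+1%:R.
Proof.
move=> ct.
have -> : interpolation N t - f t = \sum_a (f (@grid N a) - f t) * tensor a t.
  rewrite /interpolation -[X in _ - X]mulr1 -(sum_tensor N ct) mulr_sumr -sumrB.
  by apply: eq_bigr => a _; rewrite mulrBl.
have <- : K * m%:R / N.+1%:R * \sum_a @tensor N a t = K * m%:R / N.+1%:R.
  by rewrite sum_tensor// mulr1.
rewrite (le_trans (ler_norm_sum _ _ _))// mulr_sumr.
apply: ler_sum => a _; rewrite normrM (ger0_norm (tensor_ge0 _ _)).
have [->|a0] := eqVneq (tensor a t) 0; first by rewrite !mulr0.
rewrite ler_wpM2r ?tensor_ge0// (le_trans (fK (grid_cube a) ct))//.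
have -> : K * m%:R / N.+1%:R = K * \sum_(j < m) N.+1%:R^-1.
  by rewrite sumr_const card_ord -mulrA mulr_natl.
rewrite ler_wpM2l ?(ltW K0)//.
apply: ler_sum => j _; rewrite mxE; apply: tent_near.
by move: a0; rewrite /tensor; apply: contra_neq => j0; rewrite (bigD1 j)//= j0 mul0r.
Qed.

Lemma interpolation_cvg t : cube t -> interpolation N t @[N --> \oo] --> f t.
Proof.
move=> ct; apply/cvgrPdist_le => e e0.
have : (K * m%:R) * (N.+1%:R)^-1 @[N --> \oo] --> (K * m%:R) * (0 : R).
  by apply: cvgM; [exact: cvg_cst|exact: (@cvg_harmonic R)].
rewrite mulr0 => /cvgrPdist_le/(_ e e0); apply: filterS => N.
rewrite sub0r normrN ger0_norm; last by rewrite mulr_ge0// mulr_ge0// ltW.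
by rewrite distrC; apply: le_trans; exact: interpolation_close.
Qed.

Context d (T : measurableType d) (P : probability T R).
Variables (A : set T) (mA : measurable A).

Definition measurable_point (X : T -> 'rV[R]_m) :=
  (forall j, measurable_fun A (fun w => X w 0 j)) /\ (forall w, A w -> cube (X w)).

Lemma measurable_point_comp X : measurable_point X -> measurable_fun A (fun w => f (X w)).
Proof.
move=> [mX cX].
apply: (@measurable_fun_cvg _ _ _ _ (fun N w => interpolation N (X w))) => [N|w Aw].
  apply: measurable_sum => a; apply: measurable_funM; first exact: measurable_cst.
  apply: measurable_prod => j _; apply: (measurableT_comp (f := @tent R N (a j))) => //.
  by apply: continuous_measurable_fun; exact: tent_continuous.
by apply: interpolation_cvg; exact: cX.
Qed.

Lemma lipschitz_bounded : exists M, forall t, cube t -> `|f t| <= M.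
Proof.
exists (`|f 0| + K * m%:R) => t ct; have c0 : @cube R m 0 by move=> j; rewrite mxE lexx ler01.
rewrite -[f t](subrK (f 0)) (le_trans (ler_normD _ _))// addrC lerD2l.
rewrite (le_trans (fK ct c0))// ler_wpM2l ?(ltW K0)//.
have -> : m%:R = \sum_(j < m) 1 :> R by rewrite sumr_const card_ord.
apply: ler_sum => j _; rewrite mxE subr0.
by have /andP[t0 t1] := ct j; rewrite ger0_norm.
Qed.

Lemma bounded_measurable_point X : measurable_point X -> bounded_measurable A (fun w => f (X w)).
Proof.
move=> mX; split; first exact: measurable_point_comp.
have [M fM] := lipschitz_bounded; exists M => w Aw.
by apply: fM; have [_] := mX; exact.
Qed.

(** Tensor products determine the weighted law of a random point of the cube:
    Lipschitz functions are uniform limits of their combinations. *)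
Lemma tensor_extension (X Y : T -> 'rV[R]_m) (rho : T -> R) :
    measurable_point X -> measurable_point Y -> bounded_measurable A rho ->
    (forall h : 'I_m -> R -> R, (forall j, continuous (h j)) -> (forall j t, 0 <= h j t) ->
      \int[P]_(w in A) (\prod_j h j (X w 0 j)) =
      \int[P]_(w in A) (rho w * \prod_j h j (Y w 0 j))) ->
  \int[P]_(w in A) f (X w) = \int[P]_(w in A) (rho w * f (Y w)).
Proof.
move=> pX pY brho E.
have bfX := bounded_measurable_point pX; have bfY := bounded_measurable_point pY.
have bten N a Z : measurable_point Z -> bounded_measurable A (fun w => @tensor N a (Z w)).
  move=> [mZ cZ]; apply: bounded_measurable_prod => j.
  apply: (@bounded_measurable_comp _ _ _ A (@tent R N (a j)) (fun w => Z w 0 j)) => //.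
    exact: tent_continuous.
  by move=> w /cZ.
have bint N Z : measurable_point Z -> bounded_measurable A (fun w => interpolation N (Z w)).
  move=> pZ; apply: bounded_measurable_sum => a.
  by apply: bounded_measurableM; [exact: bounded_measurable_cst|exact: bten].
have EN N : \int[P]_(w in A) interpolation N (X w) =
    \int[P]_(w in A) (rho w * interpolation N (Y w)).
  rewrite Rintegral_bounded_sum//; last first.
    by move=> a; apply: bounded_measurableM; [exact: bounded_measurable_cst|exact: bten].
  transitivity (\int[P]_(w in A) \sum_a f (@grid N a) * (rho w * tensor a (Y w))).
    rewrite Rintegral_bounded_sum//; last first.
      move=> a; apply: bounded_measurableM; first exact: bounded_measurable_cst.
      by apply: bounded_measurableM => //; exact: bten.
    apply: eq_bigr => a _; rewrite !RintegralZl//.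
    - congr (_ * _); apply: (E (fun j => @tent R N (a j))) => j.
        exact: tent_continuous.
      exact: tent_ge0.
    - by apply: bounded_measurable_integrable => //; apply: bounded_measurableM => //; exact: bten.
    - by apply: bounded_measurable_integrable => //; exact: bten.
  apply: eq_Rintegral => w _; rewrite mulr_sumr; apply: eq_bigr => a _.
  by rewrite mulrCA.
have [_ [C rhoC]] := brho.
have close N : `|\int[P]_(w in A) f (X w) - \int[P]_(w in A) (rho w * f (Y w))| <=
    (1 + `|C|) * (K * m%:R) * (N.+1%:R)^-1.
  have -> : \int[P]_(w in A) f (X w) - \int[P]_(w in A) (rho w * f (Y w)) =
    \int[P]_(w in A) ((f (X w) - interpolation N (X w)) -
      rho w * (f (Y w) - interpolation N (Y w))).
    have i1 := bounded_measurable_integrable P mA bfX.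
    have i2 := bounded_measurable_integrable P mA (bounded_measurableM brho bfY).
    have i3 := bounded_measurable_integrable P mA (bint N X pX).
    have i4 := bounded_measurable_integrable P mA (bounded_measurableM brho (bint N Y pY)).
    transitivity (\int[P]_(w in A) ((f (X w) - interpolation N (X w)) -
       (rho w * f (Y w) - rho w * interpolation N (Y w)))).
      rewrite RintegralB//; [rewrite !RintegralB// EN; lra|..].
        exact: bounded_measurable_integrable (bounded_measurableB bfX (bint N X pX)).
      exact: bounded_measurable_integrable (bounded_measurableB
        (bounded_measurableM brho bfY) (bounded_measurableM brho (bint N Y pY))).
    by apply: eq_Rintegral => w _; rewrite mulrBr.
  have p0 : 0 <= (1 + `|C|) * (K * m%:R) * (N.+1%:R)^-1.
    by rewrite !mulr_ge0 ?invr_ge0// ?(ltW K0)// addr_ge0.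
  rewrite -[leRHS](ger0_norm p0); apply: Rintegral_le_bound => //.
    apply: bounded_measurableB; first by apply: bounded_measurableB => //; exact: bint.
    by apply: bounded_measurableM => //; apply: bounded_measurableB => //; exact: bint.
  move=> w Aw; rewrite (le_trans (ler_normB _ _))// normrM.
  rewrite -mulrA mulrDl mul1r lerD//.
    by rewrite distrC; apply: interpolation_close; have [_] := pX; exact.
  apply: ler_pM => //; first by rewrite (le_trans (rhoC w Aw))// ler_norm.
  by rewrite distrC; apply: interpolation_close; have [_] := pY; exact.
apply/eqP; rewrite -subr_eq0 -normr_le0.
have : (1 + `|C|) * (K * m%:R) * (N.+1%:R)^-1 @[N --> \oo] --> (1 + `|C|) * (K * m%:R) * (0 : R).
  by apply: cvgM; [exact: cvg_cst|exact: (@cvg_harmonic R)].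
rewrite mulr0 => H; rewrite -(cvg_lim _ H)//; apply: limr_ge; first by apply/cvg_ex; exists 0.
by apply: nearW => N; exact: close.
Qed.

End tensor.

(** * The law of the time-changed jump times *)

Section times.
Variables (R : realType) (m : nat).

Definition times (w : Omega R) : 'rV[R]_m := \row_(j < m) jump_time j.+1 w.

Lemma times_cube w : cube (times w).
Proof. by move=> j; rewrite mxE ltW ?jump_time_gt0// jump_time_le1. Qed.

Lemma times_point (A : set (Omega R)) : measurable A -> measurable_point A times.
Proof.
move=> mA; split => [j|w _]; last exact: times_cube.
under eq_fun do rewrite mxE.
by apply: measurable_funTS; exact: measurable_jump_time.
Qed.

Lemma bounded_measurable_past (A : set (Omega R)) n (g : nat -> R -> R) :
  (forall k, continuous (g k)) -> bounded_measurable A (past g n).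
Proof.
move=> cg; apply: bounded_measurable_prod => j.
apply: (@bounded_measurable_comp _ _ _ A (g j) (fun w => jump_time j.+1 w)) => //.
  by apply: measurable_funTS; exact: measurable_jump_time.
by move=> w _; rewrite ltW ?jump_time_gt0// jump_time_le1.
Qed.

(** On a path with n jumps the times of index larger than n are equal to 1. *)
Lemma prod_past n (h : nat -> R -> R) w : size (jumps w) = n ->
    (forall j t, (m <= j)%N -> h j t = 1) ->
  \prod_(j < m) h j (jump_time j.+1 w) =
  \prod_(n <= j < maxn m n) h j 1 * past h n w.
Proof.
move=> wn h1.
transitivity (\prod_(0 <= j < maxn m n) h j (jump_time j.+1 w)).
  rewrite -(big_mkord xpredT (fun j => h j (jump_time j.+1 w))).
  rewrite (@big_cat_nat _ _ _ m 0 (maxn m n)) ?leq_maxl//=.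
  rewrite [X in _ = _ * X]big_nat [X in _ = _ * X]big1 ?mulr1// => j /andP[mj _].
  by rewrite h1.
rewrite (@big_cat_nat _ _ _ n 0 (maxn m n)) ?leq_maxr//= mulrC; congr (_ * _).
  by apply: eq_big_nat => j /andP[nj _]; rewrite jump_time_default// wn.
by rewrite big_mkord.
Qed.

End times.

Section time_changed_law.
Variables (R : realType) (P : probability (Omega R) R).
Variables (l : R -> int -> R) (hl : NMC_intensity l).
Hypothesis hM : local_martingale P (compensated l).
Variables (u : R -> R) (hu : perturbation u) (K : R).
Hypotheses (K0 : 0 < K) (duK : forall t, 0 <= t <= 1 -> `|deriv01 u t| <= K).
Variable e : R.
Hypotheses (e0 : 0 < e) (eK : e * K <= 2^-1).
Variable L : int -> R -> R.
Hypotheses (cL : forall z, continuous (L z)) (L0 : forall z, L z 0 = 0).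
Hypothesis dL : forall z (t : R), 0 < t < 1 -> is_derive t 1 (L z) (l (clamp t) z).

Definition density (x : int) (n : nat) : Omega R -> R :=
  past (fun k => jump_density l (theta u e) (dtheta u e) L (x + k%:Z)) n.

Lemma density_bounded_measurable x n A : bounded_measurable A (density x n).
Proof.
apply: bounded_measurable_past => k; apply: jump_density_continuous => //.
- exact: theta_continuous.
- exact: dtheta_continuous.
Qed.

Lemma times_Theta m w j : times m (Theta u e w) 0 j = theta_inv u e (jump_time j.+1 w).
Proof. by rewrite mxE (Theta_jump_time hu K0 duK e0 eK). Qed.

Lemma times_Theta_point m (A : set (Omega R)) :
  measurable_point A (fun w => times m (Theta u e w)).
Proof.
split => [j|w _]; last exact: times_cube.
under eq_fun do rewrite times_Theta.
apply: (measurableT_comp (f := theta_inv u e)).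
  by apply: continuous_measurable_fun; exact: (theta_inv_continuous hu K0 duK e0 eK).
by apply: measurable_funTS; exact: measurable_jump_time.
Qed.

(** For a product of functions of the jump times this is quasi-invariance, for the
    functions composed with the inverse time change; the factors beyond the n-th
    are constant on the stratum. *)
Lemma time_changed_law m (f : 'rV[R]_m -> R) x n : Ck_cube 1 f ->
  \int[P]_(w in stratum x n) f (times m (Theta u e w)) =
  \int[P]_(w in stratum x n) (density x n w * f (times m w)).
Proof.
move=> f1; have [C C0 fC] := cube_lipschitz f1.
have mS := @measurable_stratum R x n.
apply: (tensor_extension C0 fC mS (times_Theta_point m _) (times_point m mS)
  (density_bounded_measurable x n _)) => h ch h0.
pose hn (j : nat) : R -> R := if insub j is Some i then h i else fun=> 1.
have hnE (j : 'I_m) : hn j = h j by rewrite /hn valK.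
have chn j : continuous (hn j).
  by rewrite /hn; case: insub => [i|]; [exact: ch|exact: cst_continuous].
have hn0 j t : 0 <= hn j t by rewrite /hn; case: insub => [i|].
have hn1 j t : (m <= j)%N -> hn j t = 1.
  by move=> mj; rewrite /hn insubF// ltnNge mj.
pose g k t := hn k (theta_inv u e t).
have i1 := theta_inv1 hu K0 duK e0 eK.
have cg k : continuous (g k).
  move=> t; apply: (@continuous_comp _ _ _ (theta_inv u e) (hn k)).
    exact: (theta_inv_continuous hu K0 duK e0 eK).
  exact: chn.
pose c := \prod_(n <= j < maxn m n) hn j 1.
transitivity (\int[P]_(w in stratum x n) (c * past g n w)).
  apply: eq_Rintegral => w /set_mem[_ wn].
  transitivity (\prod_(j < m) g j (jump_time j.+1 w)).
    by apply: eq_bigr => j _; rewrite times_Theta -hnE.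
  rewrite (prod_past (h := g) wn)//; last by move=> j t mj; exact: hn1.
  by rewrite /g i1.
transitivity (\int[P]_(w in stratum x n) (c * past (fun k t => g k (theta u e t) *
    jump_density l (theta u e) (dtheta u e) L (x + k%:Z) t) n w)); last first.
  apply: eq_Rintegral => w /set_mem[_ wn].
  rewrite (eq_bigr (fun j : 'I_m => hn j (jump_time j.+1 w))); last first.
    by move=> j _; rewrite mxE hnE.
  rewrite (prod_past wn hn1) mulrCA; congr (_ * _); rewrite /density /past -big_split/=.
  by apply: eq_bigr => j _; rewrite /g (theta_invL hu K0 duK e0 eK) mulrC.
rewrite !RintegralZl//.
- congr (_ * fine _); apply/esym; apply: quasi_invariance => //.
  + exact: theta_continuous.
  + exact: dtheta_continuous.
  + by move=> t; exact: theta_is_derive.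
  + by move=> t; exact: (theta_itv hu K0 duK e0 eK).
  + exact: theta_0.
  + exact: theta_1.
  + exact: (dtheta_ge0 duK e0 eK).
  + by move=> k t; exact: hn0.
- apply: bounded_measurable_integrable => //; apply: bounded_measurable_past => k t.
  apply: cvgM.
    apply: (@continuous_comp _ _ _ (theta u e) (g k)); last exact: cg.
    exact: theta_continuous.
  apply: jump_density_continuous => //.
  - exact: theta_continuous.
  - exact: dtheta_continuous.
- apply: bounded_measurable_integrable => //; exact: bounded_measurable_past.
Qed.

End time_changed_law.

(** * The derivative of the density *)

Section score.
Variables (R : realType) (l : R -> int -> R) (hl : NMC_intensity l).
Variables (u : R -> R) (hu : perturbation u) (K : R).
Hypotheses (K0 : 0 < K) (duK : forall t, 0 <= t <= 1 -> `|deriv01 u t| <= K).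
Variable L : int -> R -> R.
Hypotheses (cL : forall z, continuous (L z)) (L0 : forall z, L z 0 = 0).
Hypothesis dL : forall z (t : R), 0 < t < 1 -> is_derive t 1 (L z) (l (clamp t) z).

(** The derivative of the density at e = 0, as in statistics *)
Definition score (z : int) (t : R) : R :=
  deriv01 u t + reciprocal_invariant l t z * u t.

Definition changed_density (z : int) (t e : R) : R :=
  jump_density l (theta u e) (dtheta u e) L z t.

Let l_is_derive z (t : R) : 0 < t < 1 ->
  is_derive t 1 (fun s => l (clamp s) z) (deriv01 (l ^~ z) t).
Proof.
case: hl => _ _ /(_ z) lC t01; have := C1_01_is_derive lC t01.
by rewrite /= clamp_id//; case/andP: t01 => /ltW-> /ltW->.
Qed.

Lemma deriv01_ln z (t : R) : 0 < t < 1 ->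
  deriv01 (fun s => ln (l s z)) t = deriv01 (l ^~ z) t / l t z.
Proof.
move=> t01; have /andP[/ltW t0 /ltW t1] := t01.
have lt0 : 0 < l t z by case: hl => + _ _; apply; rewrite t0.
apply: is_derive_deriv01 => //.
have dl : is_derive t 1 (l ^~ z) (deriv01 (l ^~ z) t).
  apply: derivable01_is_derive => //; case: hl => _ _ /(_ z)[+ _].
  by apply; rewrite t0.
apply: (is_derive_eq_val (is_derive_comp dl (is_derive1_ln lt0))).
by rewrite mulrC.
Qed.

(** The factor theta' contributes u', the ratio of the intensities contributes
    u d_t log l, and the exponential u times the jump of the intensity. *)
Lemma changed_density_derive z (t : R) : 0 < t < 1 ->
  is_derive (0 : R) 1 (changed_density z t) (score z t).
Proof.
move=> t01; have /andP[/ltW t0 /ltW t1] := t01.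
have ct : clamp t = t by rewrite clamp_id// t0.
have lt0 : 0 < l t z by case: hl => + _ _; apply; rewrite t0.
have lin (c d : R) : is_derive (0 : R) 1 (fun e => c + e * d) d.
  apply: (is_derive_eq_val (is_deriveD (is_derive_cst c (0 : R) 1)
    (is_derive_mul (is_derive_id (0 : R) 1) (is_derive_cst d (0 : R) 1)))).
  by rewrite /cst; ring.
have dth : is_derive (0 : R) 1 (fun e => theta u e t) (u t).
  by rewrite /theta ct; exact: lin.
have ddth : is_derive (0 : R) 1 (fun e => dtheta u e t) (deriv01 u t).
  by rewrite /dtheta ct; exact: lin.
have th0 : theta u 0 t = t by rewrite /theta mul0r addr0.
have comp (f : R -> R) d : is_derive t 1 f d ->
    is_derive (0 : R) 1 (fun e => f (theta u e t)) (d * u t).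
  by move=> df; apply: (is_derive_comp dth); rewrite th0.
have d1 := comp _ _ (l_is_derive z t01).
have d2 := comp _ _ (dL z t01); have d3 := comp _ _ (dL (z + 1) t01).
pose c e := (L z t - L z (theta u e t)) - (L (z + 1) t - L (z + 1) (theta u e t)).
have dc : is_derive (0 : R) 1 c ((l t (z + 1) - l t z) * u t).
  apply: (is_derive_eq_val (is_deriveB (is_deriveB (is_derive_cst (L z t) (0 : R) 1) d2)
    (is_deriveB (is_derive_cst (L (z + 1) t) (0 : R) 1) d3))).
  by rewrite ct; ring.
have dE := is_derive_comp dc (is_derive_expR _).
have dq := is_derive_mul d1 (is_derive_cst (l (clamp t) z)^-1 (0 : R) 1).
apply: (is_derive_eq_val (is_derive_mul (is_derive_mul ddth dq) dE)).
rewrite /score /reciprocal_invariant deriv01_ln// /dtheta /c/= th0 !subrr expR0 ct /cst.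
by field; rewrite gt_eqF.
Qed.

Lemma changed_density0 z t : changed_density z t 0 = 1.
Proof.
rewrite /changed_density /jump_density /dtheta /theta !mul0r !addr0 !subrr expR0.
by rewrite divff ?mulr1// gt_eqF// intensity_gt0.
Qed.

(** Bounds of the first order in e, uniform in the other variable, which dominate
    the difference quotients of the density *)
Definition near_one (I : Type) (D : set I) (a : I -> R -> R) := exists2 C, 0 <= C &
  forall e i, 0 < e -> e <= 1 -> e * K <= 2^-1 -> D i -> `|a i e - 1| <= C * e.

Notation unit_itv := [set t : R | 0 <= t <= 1].

Lemma near_oneM (I : Type) (D : set I) a b : near_one D a -> near_one D b ->
  near_one D (fun i e => a i e * b i e).
Proof.
move=> [A A0 aA] [B B0 bB]; exists (A * (1 + B) + B); first by rewrite addr_ge0// mulr_ge0// addr_ge0.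
move=> e t e0 e1 eK t01.
have -> : a t e * b t e - 1 = (a t e - 1) * b t e + (b t e - 1) by ring.
rewrite (le_trans (ler_normD _ _))// [leRHS]mulrDl lerD ?bB// normrM mulrAC.
apply: ler_pM => //; first exact: aA.
rewrite -[b t e](subrK 1) addrC (le_trans (ler_normD _ _))// normr1 lerD2l.
by rewrite (le_trans (bB _ _ _ _ _ _))// ler_piMr.
Qed.

Lemma near_one_expR c : (exists2 C, 0 <= C & forall e t, 0 < e -> e <= 1 -> e * K <= 2^-1 ->
    0 <= t <= 1 -> `|c t e| <= C * e) -> near_one unit_itv (fun t e => expR (c t e)).
Proof.
move=> [C C0 cC]; exists (C * expR C); first by rewrite mulr_ge0// expR_ge0.
move=> e t e0 e1 eK t01; have cCe := cC e t e0 e1 eK t01.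
rewrite mulrAC (le_trans (_ : _ <= `|c t e| * expR C)) ?ler_wpM2r ?expR_ge0//.
have eC1 : 1 <= expR C by have := expR_ge1Dx C; lra.
have cleC : c t e <= C by rewrite (le_trans (ler_norm _))// (le_trans cCe)// ler_piMr.
have := expR_ge1Dx (c t e); have := expR_ge1Dx (- c t e).
rewrite expRN => H1 H2; have ec0 := expR_gt0 (c t e).
(* c <= exp c - 1 <= c exp c, both from the tangent line of exp at 0 *)
have H3 : expR (c t e) - 1 <= c t e * expR (c t e).
  have := ler_wpM2r (ltW ec0) H1; rewrite mulVf ?gt_eqF//; lra.
have H4 : `|c t e| <= `|c t e| * expR C by rewrite ler_peMr.
rewrite ler_norml; apply/andP; split.
  have := ler_norm (- c t e); rewrite normrN; lra.
rewrite (le_trans H3)//; apply: (@le_trans _ _ (`|c t e| * expR (c t e))).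
  by rewrite ler_wpM2r ?ler_norm// ltW.
by rewrite ler_wpM2l// ler_expR.
Qed.

Lemma changed_density_near_one z : near_one unit_itv (changed_density z).
Proof.
have moved e t : 0 < e -> 0 <= t <= 1 -> `|theta u e t - t| <= e * K.
  move=> e0 t01; rewrite /theta addrC addKr normrM (gtr0_norm e0).
  rewrite ler_wpM2l ?(ltW e0)// clamp_id//; exact: (perturbation_le hu K0 duK).
have thI e t : 0 < e -> e * K <= 2^-1 -> 0 <= t <= 1 -> 0 <= theta u e t <= 1.
  move=> e0 eK /andP[t0 t1].
  by rewrite -(theta_0 hu e) -[X in _ <= _ <= X](theta_1 hu e) !(theta_le hu K0 duK e0 eK) t0.
have cml y : continuous (fun t => l (clamp t) y) by exact: intensity_continuous.
have [C _ lC] := continuous_bounded01 (cml z).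
have cinv : continuous (fun t => (l (clamp t) z)^-1).
  by move=> t; apply: cvgV; [rewrite gt_eqF// intensity_gt0|exact: cml].
have [D D0 lD] := continuous_bounded01 cinv.
apply: near_oneM; [apply: near_oneM|].
- exists K; first exact: ltW.
  move=> e t e0 _ _ t01; rewrite /dtheta addrC addKr normrM (gtr0_norm e0) mulrC.
  by rewrite ler_wpM2r ?(ltW e0)// duK// clamp_itv.
- have [M M0 lM] := C1_01_lipschitz (let: And3 _ _ lC := hl in lC z).
  exists (M * K * D); first by rewrite !mulr_ge0// ltW.
  move=> e t e0 _ eK t01; have l0 := intensity_gt0 hl z t.
  have -> : l (clamp (theta u e t)) z / l (clamp t) z - 1 =
    (l (clamp (theta u e t)) z - l (clamp t) z) * (l (clamp t) z)^-1.
    by rewrite mulrBl divff// gt_eqF.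
  rewrite normrM mulrAC; apply: ler_pM => //; last exact: lD.
  rewrite (le_trans (lM _ _ (clamp_itv _) (clamp_itv _)))// -mulrA ler_wpM2l ?(ltW M0)//.
  by rewrite !clamp_id ?thI// mulrC moved.
apply: near_one_expR.
have LL y : exists2 C, 0 <= C & forall e t, 0 < e -> e <= 1 -> e * K <= 2^-1 ->
    0 <= t <= 1 -> `|L y t - L y (theta u e t)| <= C * e.
  have [M M0 lM] := continuous_bounded01 (cml y); exists (M * K); first by rewrite mulr_ge0// ltW.
  move=> e t e0 _ eK t01.
  rewrite distrC (le_trans (lipschitz_is_derive (@cL y) (@dL y) lM t01 (thI e t e0 eK t01)))//.
  by rewrite -mulrA ler_wpM2l ?(ltW M0)// mulrC moved.
have [A A0 HA] := LL z; have [B B0 HB] := LL (z + 1).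
exists (A + B); first exact: addr_ge0.
move=> e t e0 e1 eK t01; rewrite (le_trans (ler_normB _ _))// mulrDl lerD//.
  exact: HA.
exact: HB.
Qed.

Local Notation dens x n w e := (density l u e L x n w).

Lemma densityE x n w e : dens x n w e =
  \prod_(j < n) changed_density (x + j%:Z) (jump_time j.+1 w) e.
Proof. by []. Qed.

Lemma densityS x n w e : dens x n.+1 w e =
  dens x n w e * changed_density (x + n%:Z) (jump_time n.+1 w) e.
Proof. by rewrite !densityE big_ord_recr. Qed.

Lemma density_near_one x n : near_one setT (fun w e => dens x n w e).
Proof.
elim: n => [|n IH].
  by exists 0 => // e w *; rewrite densityE big_ord0 subrr normr0 mul0r.
have [C C0 HC] := changed_density_near_one (x + n%:Z).
have H : near_one setT (fun w e => changed_density (x + n%:Z) (jump_time n.+1 w) e).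
  exists C => // e w e0 e1 eK _; apply: HC => //.
  by rewrite /= ltW ?jump_time_gt0// jump_time_le1.
have [D D0 HD] := near_oneM IH H; exists D => // e w e0 e1 eK _.
by rewrite densityS; exact: HD.
Qed.

Lemma density_derive x n (w : Omega R) : (n <= size (jumps w))%N ->
  is_derive (0 : R) 1 (fun e => dens x n w e)
    (\sum_(j < n) score (x + j%:Z) (jump_time j.+1 w)).
Proof.
elim: n => [_|n IH nw].
  rewrite big_ord0 (_ : (fun e => dens x 0 w e) = cst 1); first exact: is_derive_cst.
  by apply/funext => e; rewrite densityE big_ord0.
have T01 : 0 < jump_time n.+1 w < 1 by rewrite jump_time_gt0 jump_time_lt1.
rewrite (_ : (fun e => dens x n.+1 w e) = fun e => dens x n w e *
    changed_density (x + n%:Z) (jump_time n.+1 w) e); last first.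
  by apply/funext => e; exact: densityS.
apply: (is_derive_eq_val (is_derive_mul (IH (ltnW nw)) (changed_density_derive (x + n%:Z) T01))).
rewrite changed_density0 mulr1 big_ord_recr/= densityE [X in _ + X * _]big1 ?mul1r// => j _.
exact: changed_density0.
Qed.

Lemma density0 x n w : dens x n w 0 = 1.
Proof. by rewrite densityE big1// => j _; exact: changed_density0. Qed.

Lemma density_quotient x n (w : Omega R) : stratum x n w ->
  e^-1 * (density l u e L x n w - 1) @[e --> 0^'+] -->
  int_dX (fun t z => score z t) w.
Proof.
move=> [wx wn]; rewrite int_dXE wn.
rewrite (eq_bigr (fun j : 'I_n => score (x + j%:Z) (jump_time j.+1 w))); last first.
  by move=> j _; rewrite wx.
have wn' : (n <= size (jumps w))%N by rewrite wn.
have [d dE] := density_derive x wn'.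
have H : h^-1 *: (((fun e => dens x n w e) \o shift (0 : R)) (h *: (1 : R)) - dens x n w 0)
    @[h --> (0 : R)^'] --> \sum_(j < n) score (x + j%:Z) (jump_time j.+1 w).
  by rewrite -dE; exact: d.
have {H} := cvg_dnbhs_at_right H; rewrite density0.
rewrite (_ : (fun h => _) = (fun e => e^-1 * (density l u e L x n w - 1)))//.
by apply/funext => h /=; rewrite addr0 [h *: 1]mulr1.
Qed.

End score.

(** * Duality on the paths with a given number of jumps *)

Section directional_derivative_of_functionals.
Variables (R : realType) (u : R -> R) (hu : perturbation u) (K : R).
Hypotheses (K0 : 0 < K) (duK : forall t, 0 <= t <= 1 -> `|deriv01 u t| <= K).

(** Steps that tend to 0 and at which the time change is a bijection *)
Definition small_step (i : nat) : R := Order.min 1 (2 * K)^-1 * i.+1%:R^-1.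

Lemma small_step_gt0 i : 0 < small_step i.
Proof. by rewrite mulr_gt0 ?invr_gt0 ?ltr0n// lt_min ltr01/= invr_gt0 mulr_gt0. Qed.

Lemma small_step_le i : small_step i <= Order.min 1 (2 * K)^-1.
Proof.
rewrite ler_piMr//; last by rewrite invf_le1 ?ltr0n// ler1n.
by rewrite le_min ler01/= invr_ge0 mulr_ge0// ltW.
Qed.

Lemma small_step_le1 i : small_step i <= 1.
Proof. by rewrite (le_trans (small_step_le i))// ge_min lexx. Qed.

Lemma small_step_half i : small_step i * K <= 2^-1.
Proof.
rewrite (@le_trans _ _ ((2 * K)^-1 * K))//.
  by rewrite ler_wpM2r ?(ltW K0)// (le_trans (small_step_le i))// ge_min lexx orbT.
by rewrite invfM -mulrA mulVf ?mulr1// gt_eqF.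
Qed.

Lemma small_step_cvg : small_step i @[i --> \oo] --> (0 : R)^'+.
Proof.
have H : small_step i @[i --> \oo] --> (0 : R).
  rewrite -[X in _ --> X](mulr0 (Order.min 1 (2 * K)^-1)).
  by apply: cvgM; [exact: cvg_cst|exact: (@cvg_harmonic R)].
move=> A /= [d d0 dA]; move/cvgrPdist_lt : H => /(_ d d0).
apply: filterS => i Hi; apply: dA => //; exact: small_step_gt0.
Qed.

Lemma near_small : \forall e \near (0 : R)^'+, 0 < e /\ e * K <= 2^-1.
Proof.
near=> e; split; first by near: e; exact: nbhs_right_gt.
rewrite -ler_pdivlMr//; near: e; apply: nbhs_right_le.
by rewrite mulr_gt0 ?invr_gt0.
Unshelve. all: by end_near. Qed.

Lemma theta_inv_close e t : 0 < e -> e * K <= 2^-1 -> `|theta_inv u e t - t| <= e * K.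
Proof.
move=> e0 eK; rewrite -[X in `|_ - X|](theta_invK hu K0 duK e0 eK) /theta.
rewrite opprD addNKr normrN normrM (gtr0_norm e0) ler_wpM2l ?(ltW e0)//.
by apply: (perturbation_le hu K0 duK); exact: clamp_itv.
Qed.

(** By definition theta_inv e t - t = - e u (theta_inv e t). *)
Lemma theta_inv_quotient t : 0 <= t <= 1 ->
  e^-1 * (theta_inv u e t - t) @[e --> 0^'+] --> - u t.
Proof.
move=> t01.
have cu : {for t, continuous (u \o @clamp R)}.
  by apply: C1_01_continuous; case: hu.
have it : theta_inv u e t @[e --> 0^'+] --> t.
  apply/cvgrPdist_le => d d0.
  have e_to0 : e * K @[e --> (0 : R)^'+] --> 0.
    rewrite -[X in _ --> X](mul0r K); apply: cvgM; last exact: cvg_cst.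
    exact: cvg_at_right_filter cvg_id.
  move/cvgrPdist_le : e_to0 => /(_ d d0) H; near=> e.
  have [e0 eK] : 0 < e /\ e * K <= 2^-1 by near: e; exact: near_small.
  rewrite distrC (le_trans (theta_inv_close t e0 eK))//.
  have : `|0 - e * K| <= d by near: e.
  by rewrite sub0r normrN; apply: le_trans; exact: ler_norm.
have : - (u \o @clamp R) (theta_inv u e t) @[e --> 0^'+] --> - (u \o @clamp R) t.
  by apply: cvgN; exact: (cvg_comp _ _ it cu).
rewrite /= (clamp_id t01); apply: cvg_trans; apply: near_eq_cvg; near=> e.
have [e0 eK] : 0 < e /\ e * K <= 2^-1 by near: e; exact: near_small.
rewrite /= -[X in _ - X](theta_invK hu K0 duK e0 eK) /theta.
by rewrite opprD addNKr mulrN mulKf// gt_eqF.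
Unshelve. all: by end_near. Qed.

Variables (m : nat) (f : 'rV[R]_m -> R).
Hypothesis f1 : Ck_cube 1 f.

Lemma times_derivative (w : Omega R) :
  e^-1 * (f (times m (Theta u e w)) - f (times m w)) @[e --> 0^'+] -->
  \sum_k partial01 f k (times m w) * - u (jump_time k.+1 w).
Proof.
pose v e := e^-1 *: (times m (Theta u e w) - times m w).
pose v0 : 'rV[R]_m := \row_k - u (jump_time k.+1 w).
have vE e : 0 < e -> times m w + e *: v e = times m (Theta u e w).
  by move=> e0; rewrite scalerA divff ?gt_eqF// scale1r addrC subrK.
have := @directional_derivative _ _ _ f1 (times m w) v v0 (@times_cube _ m w).
rewrite (eq_bigr (fun k => partial01 f k (times m w) * - u (jump_time k.+1 w))); last first.
  by move=> k _; rewrite mxE.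
move=> H; apply: cvg_trans (H _ _).
- apply: near_eq_cvg; near=> e.
  have e0 : 0 < e by near: e; exact: nbhs_right_gt.
  by rewrite vE.
- near=> e; have e0 : 0 < e by near: e; exact: nbhs_right_gt.
  by rewrite vE//; exact: times_cube.
move=> j; rewrite mxE.
have T01 : 0 <= jump_time j.+1 w <= 1 by rewrite ltW ?jump_time_gt0// jump_time_le1.
apply: cvg_trans (theta_inv_quotient T01).
apply: near_eq_cvg; near=> e.
have [e0 eK] : 0 < e /\ e * K <= 2^-1 by near: e; exact: near_small.
by rewrite !mxE (Theta_jump_time hu K0 duK e0 eK).
Unshelve. all: by end_near. Qed.

Lemma times_quotient_bounded : exists M, forall e w, 0 < e -> e * K <= 2^-1 ->
  `|e^-1 * (f (times m (Theta u e w)) - f (times m w))| <= M.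
Proof.
have [C C0 fC] := cube_lipschitz f1; exists (C * \sum_(j < m) K) => e w e0 eK.
rewrite normrM (gtr0_norm (_ : 0 < e^-1)) ?invr_gt0// ler_pdivrMl//.
rewrite (le_trans (fC _ _ (@times_cube _ _ _) (@times_cube _ _ _)))//.
rewrite mulrCA ler_wpM2l ?(ltW C0)// mulr_sumr; apply: ler_sum => j _.
by rewrite !mxE (Theta_jump_time hu K0 duK e0 eK) theta_inv_close.
Qed.

End directional_derivative_of_functionals.

Section stratum_duality.
Variables (R : realType) (P : probability (Omega R) R).
Variables (l : R -> int -> R) (hl : NMC_intensity l).
Hypothesis hM : local_martingale P (compensated l).
Variables (u : R -> R) (hu : perturbation u).
Variables (m : nat) (phi : int -> 'rV[R]_m -> R).
Hypothesis phi1 : forall x, Ck_cube 1 (phi x).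
Variable Phi : Omega R -> R.
Hypothesis PhiE : forall w, Phi w = phi (w 0) (times m w).

Lemma deriv_bound : exists2 K, 0 < K & forall t, 0 <= t <= 1 -> `|deriv01 u t| <= K.
Proof.
have uC : C1_01 u by case: hu.
have [K K0 uK] := continuous_bounded01 (C1_01_deriv_continuous uC); exists K => // t t01.
by have := uK t t01; rewrite /= clamp_id.
Qed.

Lemma deriv_dirE w : deriv_dir u Phi w =
  \sum_k partial01 (phi (w 0)) k (times m w) * - u (jump_time k.+1 w).
Proof.
have [K K0 duK] := deriv_bound.
suff H : e^-1 * (Phi (Theta u e w) - Phi w) @[e --> 0^'+] -->
    \sum_k partial01 (phi (w 0)) k (times m w) * - u (jump_time k.+1 w).
  by rewrite /deriv_dir; exact: cvg_lim.
apply: cvg_trans (times_derivative hu K0 duK (@phi1 (w 0)) (w := w)).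
apply: near_eq_cvg; near=> e.
have [e0 eK] : 0 < e /\ e * K <= 2^-1 by near: e; exact: near_small.
by rewrite !PhiE (Theta_start hu K0 duK e0 eK).
Unshelve. all: by end_near. Qed.

(** The difference quotients at e = 0 of both sides of the change of law converge
    boundedly. *)
Lemma stratum_duality x n :
  let S w := Phi w * int_dX (fun t z => score l u z t) w in
  [/\ bounded_measurable (stratum x n) (deriv_dir u Phi),
      bounded_measurable (stratum x n) S &
      \int[P]_(w in stratum x n) deriv_dir u Phi w = \int[P]_(w in stratum x n) S w].
Proof.
move=> S; have [K K0 duK] := deriv_bound.
have [L [cL L0 dL]] : exists L : int -> R -> R, [/\ forall z, continuous (L z),
    forall z, L z 0 = 0 & forall z (t : R), 0 < t < 1 -> is_derive t 1 (L z) (l (clamp t) z)].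
  have [L HL] := choice (cumulative_rate hl); exists L.
  by split => z; have [] := HL z.
pose A := @stratum R x n; have mA : measurable A by exact: measurable_stratum.
pose s i := small_step K i.
have s0 i : 0 < s i by exact: small_step_gt0.
have s1 i : s i <= 1 by exact: small_step_le1.
have sK i : s i * K <= 2^-1 by exact: small_step_half.
pose f := phi x; have f1 : Ck_cube 1 f by exact: phi1.
have [C C0 fC] := cube_lipschitz f1.
have bf : bounded_measurable A (fun w => f (times m w)).
  exact: (bounded_measurable_point C0 fC (times_point m mA)).
have bft i : bounded_measurable A (fun w => f (times m (Theta u (s i) w))).
  exact: (bounded_measurable_point C0 fC (times_Theta_point hu K0 duK (s0 i) (sK i) m A)).
pose D i w := density l u (s i) L x n w.
have bD i : bounded_measurable A (D i) by exact: density_bounded_measurable.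
pose a i w := (s i)^-1 * (f (times m (Theta u (s i) w)) - f (times m w)).
pose b i w := (s i)^-1 * (D i w - 1) * f (times m w).
have bcst r : bounded_measurable A (fun=> r : R) by exact: bounded_measurable_cst.
have ba i : bounded_measurable A (a i).
  by apply: bounded_measurableM => //; exact: bounded_measurableB.
have bb i : bounded_measurable A (b i).
  apply: bounded_measurableM => //; apply: bounded_measurableM => //.
  exact: bounded_measurableB.
have [Ma aM] := times_quotient_bounded hu K0 duK f1.
have [Mb bM] : exists M, forall i w, A w -> `|b i w| <= M.
  have [B B0 DB] := density_near_one hl hu K0 duK cL dL x n.
  have [M fM] := lipschitz_bounded C0 fC.
  exists (B * M) => i w Aw; rewrite /b normrM ler_pM//; last by apply: fM; exact: times_cube.
  rewrite normrM (gtr0_norm (_ : 0 < (s i)^-1)) ?invr_gt0// ler_pdivrMl// mulrC.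
  exact: DB.
have wx w : A w -> w 0 = x by case.
have acvg w : A w -> a i w @[i --> \oo] --> deriv_dir u Phi w.
  move=> Aw; rewrite deriv_dirE (wx w Aw).
  exact: (cvg_comp _ _ (small_step_cvg K0) (times_derivative hu K0 duK f1 (w := w))).
have bcvg w : A w -> b i w @[i --> \oo] --> S w.
  move=> Aw; rewrite /S PhiE (wx w Aw) mulrC; apply: cvgM; last exact: cvg_cst.
  have H : e^-1 * (density l u e L x n w - 1) @[e --> 0^'+] -->
    int_dX (fun t z => score l u z t) w by exact: (density_quotient hl dL Aw).
  exact: (cvg_comp _ _ (small_step_cvg K0) H).
have [bda ia] := bounded_convergence P mA ba (fun i w _ => aM (s i) w (s0 i) (sK i)) acvg.
have [bdb ib] := bounded_convergence P mA bb bM bcvg.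
split => //; rewrite -(cvg_lim _ ia)//; apply: cvg_lim => //.
apply: cvg_trans ib; apply: near_eq_cvg; apply: nearW => i.
have int g : bounded_measurable A g -> P.-integrable A (EFin \o g).
  exact: bounded_measurable_integrable.
transitivity ((s i)^-1 * (\int[P]_(w in A) (D i w * f (times m w)) -
    \int[P]_(w in A) f (times m w))).
  have bDf := bounded_measurableM (bD i) bf.
  rewrite -RintegralB//; [|exact: int|exact: int].
  rewrite -RintegralZl//; last by apply: int; exact: bounded_measurableB.
  by apply: eq_Rintegral => w _; rewrite /b; ring.
rewrite -(time_changed_law hl hM hu K0 duK (s0 i) (sK i) cL L0 dL x n f1).
rewrite -RintegralB//; [|exact: int|exact: int].
by rewrite -RintegralZl//; apply: int; exact: bounded_measurableB.
Qed.

End stratum_duality.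

(** * The compensated integral as a sum over the jumps *)

Section product_rule.
Variable R : realType.

(** Limits within [0, 1] are unique at the end points as well. *)
Lemma unit_itv_proper (t : R) : 0 <= t <= 1 -> ProperFilter (within `[0, 1]%classic t^').
Proof.
move=> /andP[t0 t1]; apply: Build_ProperFilter_ex => A /= [d /= d0 dA].
have [t1'|t1'] := ltP t 1.
  have m0 : 0 < Order.min (d / 2) (1 - t) by rewrite lt_min divr_gt0//= subr_gt0.
  have md : Order.min (d / 2) (1 - t) < d.
    by rewrite gt_min; apply/orP; left; lra.
  have m1 : Order.min (d / 2) (1 - t) <= 1 - t by rewrite ge_min lexx orbT.
  exists (t + Order.min (d / 2) (1 - t)); apply: dA.
  - by rewrite /= opprD addNKr normrN gtr0_norm.
  - by rewrite gt_eqF// ltrDl.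
  - by rewrite /= in_itv/=; apply/andP; split; lra.
have t_1 : t = 1 by apply/eqP; rewrite eq_le t1.
rewrite {t t0 t1 t1'}t_1 in dA *.
have m0 : 0 < Order.min (d / 2) 1 by rewrite lt_min divr_gt0//=.
have md : Order.min (d / 2) 1 < d by rewrite gt_min; apply/orP; left; lra.
have m1 : Order.min (d / 2) 1 <= 1 by rewrite ge_min lexx orbT.
exists (1 - Order.min (d / 2) 1); apply: dA.
- by rewrite /= opprB addrCA subrr addr0 gtr0_norm.
- by rewrite lt_eqF// ltrBlDr ltrDl.
- by rewrite /= in_itv/=; apply/andP; split; lra.
Qed.

Lemma deriv01M (f g : R -> R) t : 0 <= t <= 1 -> derivable01 f t -> derivable01 g t ->
  deriv01 (fun s => f s * g s) t = deriv01 f t * g t + f t * deriv01 g t.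
Proof.
move=> t01 df dg; have FF := unit_itv_proper t01.
apply: cvg_lim => //.
have cg : g s @[s --> within `[0, 1]%classic t^'] --> g t.
  apply: cvg_trans (derivable01_continuous dg); apply: cvg_app.
  move=> U HU; have {}HU : \forall s \near t, `[0, 1]%classic s -> U s by exact: HU.
  suff : \forall s \near t, s != t -> `[0, 1]%classic s -> U s by [].
  by apply: filterS HU => s + _; apply.
have : diffquot01 f t s * g s + f t * diffquot01 g t s
    @[s --> within `[0, 1]%classic t^'] --> deriv01 f t * g t + f t * deriv01 g t.
  apply: cvgD; first by apply: cvgM; [exact: df|exact: cg].
  by apply: cvgM; [exact: cvg_cst|exact: dg].
apply: cvg_trans; apply: near_eq_cvg; apply: nearW => s.
by rewrite /diffquot01; ring.
Qed.

End product_rule.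

Section compensated_integral.
Variables (R : realType) (l : R -> int -> R) (hl : NMC_intensity l).
Variables (u : R -> R) (hu : perturbation u).

Let uC : C1_01 u. Proof. by case: hu. Qed.
Let lC z : C1_01 (l ^~ z). Proof. by case: hl => _ _; exact. Qed.
Let l_gt0 (t : R) z : 0 <= t <= 1 -> 0 < l t z. Proof. by case: hl => + _ _; apply. Qed.

Lemma deriv01_intensityM z (t : R) : 0 <= t <= 1 ->
  deriv01 (fun s => l s z * u s) t = deriv01 (l ^~ z) t * u t + l t z * deriv01 u t.
Proof.
move=> t01; apply: (deriv01M t01); first by have [+ _] := lC z; exact.
by have [+ _] := uC; exact.
Qed.

(** The time integral is the variation of l u along the path between the jumps, that
    is, minus the sum of its jumps, since u vanishes at 0 and 1. *)
Lemma int_compensatedE (w : Omega R) : int_compensated l (dlog_weighted l u) w =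
  int_dX (fun t z => deriv01 u t + reciprocal_invariant l t z * u t) w.
Proof.
pose V (k : nat) (t : R) := l (clamp t) (w 0 + k%:Z) * u (clamp t).
pose f (k : nat) (t : R) := deriv01 (l ^~ (w 0 + k%:Z)) (clamp t) * u (clamp t) +
  l (clamp t) (w 0 + k%:Z) * deriv01 u (clamp t).
have cl z : continuous (fun t => l (clamp t) z) by exact: intensity_continuous.
have cu : continuous (fun t => u (clamp t)) by exact: C1_01_continuous.
have cV k : continuous (V k) by move=> t; apply: cvgM; [exact: cl|exact: cu].
have cf k : continuous (f k).
  move=> t; apply: cvgD; apply: cvgM.
  - exact: (C1_01_deriv_continuous (@lC (w 0 + k%:Z))).
  - exact: cu.
  - exact: cl.
  - exact: (C1_01_deriv_continuous uC).
have dV k (t : R) : 0 < t < 1 -> is_derive t 1 (V k) (f k t).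
  move=> t01; exact: (is_derive_mul (C1_01_is_derive (@lC (w 0 + k%:Z)) t01)
    (C1_01_is_derive uC t01)).
have [_] := path_change_of_variables w cf cV dV.
have -> : \int[lebesgue_measure]_(t in `[0, 1])
      f (count (fun r => (r < t)%R) (jumps w)) t =
    \int[lebesgue_measure]_(t in `[0, 1])
      (dlog_weighted l u t (left_lim w t) * l t (left_lim w t)).
  apply: eq_Rintegral => t; rewrite inE/= in_itv/= => t01.
  rewrite /dlog_weighted divfK ?gt_eqF ?l_gt0//.
  by rewrite deriv01_intensityM// /f left_limE clamp_id.
rewrite /int_compensated => ->; have [_ u0 u1] := hu.
rewrite {1 2}/V clamp_ge1// clamp_le0// u0 u1 !mulr0 subrr add0r !int_dXE -sumrB.
apply: eq_bigr => k _; have [T0 T1] : 0 < jump_time k.+1 w /\ jump_time k.+1 w < 1.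
  by rewrite jump_time_gt0 jump_time_lt1.
set T := jump_time k.+1 w in T0 T1 *.
have T01 : 0 <= T <= 1 by rewrite !ltW.
have lT := l_gt0 (w 0 + k%:Z) T01.
rewrite /V clamp_id// /dlog_weighted deriv01_intensityM// /reciprocal_invariant.
rewrite (deriv01_ln hl) ?T0// -[k.+1]addn1 PoszD addrA.
by field; rewrite gt_eqF.
Qed.

End compensated_integral.

(** * Summation over the starts and the numbers of jumps *)

Section quasi_integral.
Context d (T : measurableType d) (R : realType) (P : probability T R).
Variable A : nat -> set T.
Hypotheses (mA : forall i, measurable (A i)) (tA : trivIset setT A)
  (cA : \bigcup_i A i = setT).
Variable Y : T -> R.
Hypothesis bY : forall i, bounded_measurable (A i) Y.

Let measurable_Y : measurable_fun setT Y.
Proof. by rewrite -cA; apply/measurable_fun_bigcup => // i; have [] := bY i. Qed.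

Let bounded_part (g : R -> R) i : measurable_fun setT g -> (forall r : R, `|g r| <= `|r|) ->
  bounded_measurable (A i) (fun w => g (Y w)).
Proof.
move=> mg g_le; split.
  by apply: measurable_funTS; exact: (measurableT_comp mg measurable_Y).
have [_ [K YK]] := bY i; exists K => w Aw; rewrite (le_trans (g_le _))//.
exact: YK.
Qed.

Let part_cvg (g : R -> R) : measurable_fun setT g -> (forall r, 0 <= g r) ->
    (forall r, `|g r| <= `|r|) ->
  (\sum_(i < n) \int[P]_(w in A i) g (Y w))%:E @[n --> \oo] --> (\int[P]_w (g (Y w))%:E)%E.
Proof.
move=> mg g0 g_le.
have mgY : measurable_fun setT (fun w => (g (Y w))%:E).
  by apply/measurable_EFinP; exact: (measurableT_comp mg measurable_Y).
have E := @ge0_integral_bigcup _ T R P A (fun w => (g (Y w))%:E) mA.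
rewrite -[X in (\int[_]_(_ in X) _)%E]cA E; last 3 first.
- by rewrite cA.
- by move=> w _; rewrite lee_fin.
- exact: tA.
have ge i : (0 <= \int[P]_(w in A i) (g (Y w))%:E)%E.
  by apply: integral_ge0 => w _; rewrite lee_fin.
have := @is_cvg_nneseries R (fun i => \int[P]_(w in A i) (g (Y w))%:E)%E xpredT 0 (fun n _ _ => ge n).
apply: cvg_trans; apply: near_eq_cvg; apply: nearW => n.
rewrite big_mkord -sumEFin; apply: eq_bigr => i _.
rewrite /Rintegral fineK//; apply: integrable_fin_num => //.
by apply: bounded_measurable_integrable => //; exact: bounded_part.
Qed.

(** The positive and negative parts are summed separately; their difference is not
    of the form oo - oo. *)
Lemma quasi_integral_cvg :
    ((\int[P]_w (Order.max (Y w) 0)%:E < +oo)%E \/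
     (\int[P]_w (Order.max (- Y w) 0)%:E < +oo)%E) ->
  (\sum_(i < n) \int[P]_(w in A i) Y w)%:E @[n --> \oo] --> (\int[P]_w (Y w)%:E)%E.
Proof.
move=> hY.
pose gp (r : R) := Order.max r 0; pose gn (r : R) := Order.max (- r) 0.
have mgp : measurable_fun setT gp by apply: measurable_maxr => //; exact: measurable_cst.
have mgn : measurable_fun setT gn.
  apply: measurable_maxr; last exact: measurable_cst.
  by apply: continuous_measurable_fun; exact: opp_continuous.
have gp0 r : 0 <= gp r by rewrite le_max lexx orbT.
have gn0 r : 0 <= gn r by rewrite le_max lexx orbT.
have gpn r : r = gp r - gn r by rewrite /gp /gn !maxEle oppr_le0; case: (leP r 0); case: (leP 0 r); lra.
have gp_le r : `|gp r| <= `|r|.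
  by rewrite ger0_norm// /gp ge_max normr_ge0 ler_norm.
have gn_le r : `|gn r| <= `|r|.
  by rewrite ger0_norm// /gn ge_max normr_ge0 -normrN ler_norm.
have Hp := part_cvg mgp gp0 gp_le; have Hn := part_cvg mgn gn0 gn_le.
have -> : (\int[P]_w (Y w)%:E = \int[P]_w (gp (Y w))%:E - \int[P]_w (gn (Y w))%:E)%E.
  rewrite integralE; congr (_ - _)%E; apply: eq_integral => w _.
    by rewrite funeposE -EFin_max.
  by rewrite funenegE -EFinN -EFin_max.
have ip : (0 <= \int[P]_w (gp (Y w))%:E)%E by apply: integral_ge0 => w _; rewrite lee_fin.
have jn : (0 <= \int[P]_w (gn (Y w))%:E)%E by apply: integral_ge0 => w _; rewrite lee_fin.
have D : (\int[P]_w (gp (Y w))%:E +? - \int[P]_w (gn (Y w))%:E)%E.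
  case: hY => h.
    by apply: fin_num_adde_defr; rewrite ge0_fin_numE.
  by apply: fin_num_adde_defl; rewrite fin_numN ge0_fin_numE.
have H : ((\sum_(i < n) \int[P]_(w in A i) gp (Y w))%:E -
      (\sum_(i < n) \int[P]_(w in A i) gn (Y w))%:E)%E @[n --> \oo] -->
    (\int[P]_w (gp (Y w))%:E - \int[P]_w (gn (Y w))%:E)%E by exact: (cvgeB D Hp Hn).
apply: cvg_trans H; apply: near_eq_cvg; apply: nearW => n /=.
rewrite -EFinB -sumrB; congr (_%:E); apply: eq_bigr => i _.
have int (g : R -> R) : measurable_fun setT g -> (forall r : R, `|g r| <= `|r|) ->
    P.-integrable (A i) (EFin \o (fun w => g (Y w))).
  by move=> mg g_le; apply: bounded_measurable_integrable => //; exact: bounded_part.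
rewrite -RintegralB//; [|exact: int|exact: int].
by apply: eq_Rintegral => w _; rewrite -gpn.
Qed.

End quasi_integral.

Section strata.
Variable R : realType.

Definition nth_stratum (i : nat) : set (Omega R) :=
  if @pickle_inv (int * nat)%type i is Some p then stratum p.1 p.2 else set0.

Lemma measurable_nth_stratum i : measurable (nth_stratum i).
Proof.
by rewrite /nth_stratum; case: pickle_inv => [p|//]; exact: measurable_stratum.
Qed.

Lemma trivIset_nth_stratum : trivIset setT nth_stratum.
Proof.
move=> i j _ _ [w []]; rewrite /nth_stratum.
have := pickle_invK (T := (int * nat)%type) i; have := pickle_invK (T := (int * nat)%type) j.
case: pickle_inv => [[x n]|] //= <-; case: pickle_inv => [[y k]|] //= <-.
by move=> [<- <-] [<- <-].
Qed.

Lemma bigcup_nth_stratum : \bigcup_i nth_stratum i = setT.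
Proof.
rewrite -subTset => w _; exists (pickle (w 0, size (jumps w))); first exact: I.
by rewrite /nth_stratum pickleK_inv; split.
Qed.

Lemma expectation_strata (P : probability (Omega R) R) (Y Z : Omega R -> R) :
    (forall x n, [/\ bounded_measurable (stratum x n) Y, bounded_measurable (stratum x n) Z &
      \int[P]_(w in stratum x n) Y w = \int[P]_(w in stratum x n) Z w]) ->
    has_expectation P Y -> has_expectation P Z ->
  ('E_P[Y] = 'E_P[Z])%E.
Proof.
move=> YZ hY hZ.
have bY i : bounded_measurable (nth_stratum i) Y.
  rewrite /nth_stratum; case: pickle_inv => [p|]; first by have [] := YZ p.1 p.2.
  by split; [exact: measurable_fun_set0|exists 0].
have bZ i : bounded_measurable (nth_stratum i) Z.
  rewrite /nth_stratum; case: pickle_inv => [p|]; first by have [] := YZ p.1 p.2.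
  by split; [exact: measurable_fun_set0|exists 0].
have cY := quasi_integral_cvg (P := P) measurable_nth_stratum trivIset_nth_stratum
  bigcup_nth_stratum bY hY.
have cZ := quasi_integral_cvg (P := P) measurable_nth_stratum trivIset_nth_stratum
  bigcup_nth_stratum bZ hZ.
rewrite unlock -(cvg_lim _ cY)//; apply: cvg_lim => //; apply: cvg_trans cZ.
apply: near_eq_cvg; apply: nearW => n; congr (_%:E); apply: eq_bigr => i _.
rewrite /nth_stratum; case: pickle_inv => [p|]; first by have [_ _ ->] := YZ p.1 p.2.
by rewrite /Rintegral !integral_set0.
Qed.

End strata.

Theorem proposition2p8 (R : realType) (l : R -> int -> R)
    (mu : probability int R) (P : probability (Omega R) R)
    (hl : NMC_intensity l) (hP : NMC_law l mu P)
    (Phi : Omega R -> R) (hPhi : simple_functional Phi)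
    (u : R -> R) (hu : perturbation u)
    (hD : has_expectation P (deriv_dir u Phi)) :
  let Y1 := fun w => Phi w * int_compensated l (dlog_weighted l u) w in
  let Y2 := fun w =>
    Phi w * int_dX (fun t z => deriv01 u t + reciprocal_invariant l t z * u t) w in
  (has_expectation P Y1 -> 'E_P[deriv_dir u Phi] = 'E_P[Y1])%E /\
  (has_expectation P Y2 -> 'E_P[deriv_dir u Phi] = 'E_P[Y2])%E.
Proof.
move=> Y1 Y2; have Y12 : Y1 = Y2.
  by apply/funext => w; rewrite /Y1 (int_compensatedE hl hu).
rewrite Y12; have [_ hM] := hP; have [m [phi [_ phi_smooth PhiE]]] := hPhi.
suff H : has_expectation P Y2 -> ('E_P[deriv_dir u Phi] = 'E_P[Y2])%E by [].
apply: expectation_strata => // x n.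
by apply: (stratum_duality hl hM hu (fun x => phi_smooth x 1%N) PhiE).
Qed.
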